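(* If $M_m$ is a rotationally symmetric plane with $G_m\ge0$, then $\mathfrak C_m$ equals the set of souls of $M_m$, i.e. a point $q\in M_m$ lies in $\mathfrak C_m$ if and only if $\{q\}$ is the soul produced by the Cheeger–Gromoll soul construction for some choice of basepoint.
   Context: For a smooth function $m\colon[0,\infty)\to[0,\infty)$ with $m(0)=0$, $m'(0)=1$, $m>0$ on $(0,\infty)$ and smooth odd extension, $M_m$ is $\mathbb R^2$ with metric $dr^2+m(r)^2d\theta^2$, Gaussian curvature $G_m=-m''/m$. A ray is a unit speed geodesic on $[0,\infty)$ minimizing between any two of its points. $\mathfrak C_m$ is the set of points $q$ such that every unit tangent vector at $q$ makes angle $\le\pi/2$ with some ray starting at $q$. Soul construction (Cheeger–Gromoll) with basepoint $p$ in a complete open manifold of nonnegative curvature: for a ray $\sigma$ from $p$ let $B_\sigma=\bigcup_{t\ge0}B(\sigma(t),t)$ be its open horoball; $C_0$ is the complement of the union of $B_\sigma$ over all rays $\sigma$ from $p$ (a compact totally convex set); inductively, while $C_i$ has nonempty boundary, $C_{i+1}$ is the set of points of $C_i$ at maximal distance from $\partial C_i$; the process terminates in a compact totally convex set without boundary, the soul. For $M_m$ the soul is a single point. *)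

(* Defs.v *)
From Stdlib Require Import Reals Lra.
From Coquelicot Require Import Coquelicot.
Open Scope R_scope.

(** Points of M_m = R^2 are pairs (x,y) : R*R (Cartesian coordinates). *)
Definition pt := (R * R)%type.
Definition dot (u v : pt) : R := fst u * fst v + snd u * snd v.
Definition edist (u v : pt) : R :=
  sqrt ((fst u - fst v)^2 + (snd u - snd v)^2).

Definition smooth (f : R -> R) : Prop :=
  forall (n : nat) (x : R), ex_derive (Derive_n f n) x.

(** m is given by its (smooth) odd extension to R. *)
Definition admissible_m (m : R -> R) : Prop :=
  smooth m /\ (forall r, m (- r) = - m r) /\ m 0 = 0 /\ Derive m 0 = 1 /\
  (forall r, 0 < r -> 0 < m r).

Definition Gm (m : R -> R) (r : R) : R := - Derive_n m 2 r / m r.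

(** The metric dr^2 + m(r)^2 dtheta^2 written in Cartesian coordinates:
    at q <> 0 with r = |q|,
    g_q(u,v) = (q.u)(q.v)/r^2 + m(r)^2/r^2 * (u.v - (q.u)(q.v)/r^2);
    at the pole it is the Euclidean inner product. *)
Definition gmet (m : R -> R) (q u v : pt) : R :=
  let r := sqrt (dot q q) in
  if Req_EM_T r 0 then dot u v
  else dot q u * dot q v / r ^ 2
       + (m r) ^ 2 / r ^ 2 * (dot u v - dot q u * dot q v / r ^ 2).

Definition cx (c : R -> pt) : R -> R := fun s => fst (c s).
Definition cy (c : R -> pt) : R -> R := fun s => snd (c s).
Definition C1curve (c : R -> pt) : Prop :=
  forall t, 0 <= t <= 1 ->
    ex_derive (cx c) t /\ ex_derive (cy c) t /\
    continuous (Derive (cx c)) t /\ continuous (Derive (cy c)) t.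
Definition vel (c : R -> pt) (t : R) : pt := (Derive (cx c) t, Derive (cy c) t).

Definition glength (m : R -> R) (c : R -> pt) : R :=
  RInt (fun t => sqrt (gmet m (c t) (vel c t) (vel c t))) 0 1.
Definition dist (m : R -> R) (x y : pt) : R :=
  real (Glb_Rbar (fun L => exists c, C1curve c /\ c 0 = x /\ c 1 = y /\
                                      L = glength m c)).

Definition ray (m : R -> R) (q : pt) (sigma : R -> pt) : Prop :=
  sigma 0 = q /\
  forall s t, 0 <= s -> 0 <= t -> dist m (sigma s) (sigma t) = Rabs (s - t).

Definition init_vel (sigma : R -> pt) (w : pt) : Prop :=
  filterlim (fun h => (fst (sigma h) - fst (sigma 0)) / h) (at_right 0)
            (locally (fst w)) /\
  filterlim (fun h => (snd (sigma h) - snd (sigma 0)) / h) (at_right 0)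
            (locally (snd w)).

Definition gnorm (m : R -> R) (q v : pt) : R := sqrt (gmet m q v v).
Definition angle (m : R -> R) (q u v : pt) : R :=
  acos (gmet m q u v / (gnorm m q u * gnorm m q v)).

Definition frakC (m : R -> R) (q : pt) : Prop :=
  forall v : pt, gmet m q v v = 1 ->
    exists sigma w, ray m q sigma /\ init_vel sigma w /\ angle m q v w <= PI / 2.

Definition set_pt := pt -> Prop.

(** C_0 for basepoint p: complement of the union of the open horoballs
    B_sigma = U_{t>=0} B(sigma t, t) over all rays sigma from p. *)
Definition C0 (m : R -> R) (p : pt) : set_pt :=
  fun x => forall sigma, ray m p sigma -> forall t, 0 <= t -> t <= dist m (sigma t) x.

(** Topological interior (the manifold topology of M_m is the Euclidean one). *)
Definition tint (C : set_pt) (x : pt) : Prop :=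
  exists e, 0 < e /\ forall y, edist x y < e -> C y.

(** Boundary of a (compact totally convex) set C, as a manifold with boundary:
    - 2-dimensional case (nonempty interior): topological boundary;
    - 1-dimensional case (no interior, >= 2 points, i.e. a geodesic segment):
      the points of C not strictly between two other points of C;
    - 0-dimensional case: empty. *)
Definition bdry (m : R -> R) (C : set_pt) (x : pt) : Prop :=
  C x /\
  (((exists y, tint C y) /\ ~ tint C x) \/
   (~ (exists y, tint C y) /\ (exists a b, C a /\ C b /\ a <> b) /\
    ~ (exists a b, C a /\ C b /\ a <> x /\ b <> x /\
                   dist m a b = dist m a x + dist m x b))).

Definition distset (m : R -> R) (A : set_pt) (x : pt) : R :=
  real (Glb_Rbar (fun r => exists y, A y /\ r = dist m x y)).

Definition maxdist (m : R -> R) (C : set_pt) : set_pt :=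
  fun x => C x /\ forall y, C y -> distset m (bdry m C) y <= distset m (bdry m C) x.

Definition soul_of (m : R -> R) (p : pt) (Soul : set_pt) : Prop :=
  exists (C : nat -> set_pt) (n : nat),
    (forall x, C 0%nat x <-> C0 m p x) /\
    (forall i, (i < n)%nat ->
        (exists x, bdry m (C i) x) /\
        (forall x, C (Datatypes.S i) x <-> maxdist m (C i) x)) /\
    ~ (exists x, bdry m (C n) x) /\
    (forall x, C n x <-> Soul x).

(* Main.v *)
(** Since [G_m >= 0], [m'] is nonincreasing with values in [[0, 1]].  Call a radius [rho > 0] bent if some
    geodesic leaving the circle of radius [rho] outwards turns by more than [PI] around the pole.  A point
    [q] other than the pole satisfies either side of the equivalence if and only if [|q|] is not bent; the
    pole satisfies both, because all meridians are rays.

    If [rho = |q|] is not bent, then all geodesics leaving [q] outwards, including the two tangent to the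
    circle of radius [rho], are rays.  The two tangential rays put [q] in the critical set, and the
    horoballs of the rays cover everything but [q], so that [q] is the soul based at [q].  When [m'] is
    constant beyond some radius [r < rho], points on the segment from the pole to [q] may escape the
    horoballs of the tangential rays.  If the constant exceeds [1/2], a straight line of the cone that
    first dips slightly inwards is a ray whose horoball contains [pol r 0]; the constant [1/2] is the
    least possible, and with [r1] the least radius beyond which [m' = 1/2], the construction based at
    radius [2 rho - r1] gives the segment from radius [r1] to radius [2 rho - r1], whose midpoint is [q].

    If [rho] is bent, moving [q] towards the pole increases the distance to all far away points at a
    definite rate.  Hence no ray from [q] starts inwards or along the circle, and a point slightly closer
    to the pole than [q] lies deeper in [C_0] than [q].

    All lower bounds on distances come from calibration: a curve from radius [rho] to radius [R] of
    minimal radius [r0] and angle [th] has length at least [k * th + J k r0 rho + J k r0 R] for every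
    [0 <= k <= m r0], where [J k] is the integral of [sqrt (1 - k^2 / m^2)]. *)

From Stdlib Require Import Reals Lra Lia Psatz Classical IndefiniteDescription.
From Coquelicot Require Import Coquelicot.
Require Import Defs.
Open Scope R_scope.

(** The argument is purely metric: neither the geodesic equation nor the existence of minimizers is
    used. A geodesic is the graph over the radius of an explicit angle function, and it is shown to
    minimize by comparing its length with lower bounds valid for all curves. The obstacle is a
    competitor that dips to a radius [r0] with [m r0 < c]: there the form of constant [c] has norm
    above 1 and must be replaced by that of constant [m r0]. The detour makes up for this loss as
    long as the angle to be covered is at most [PI], and only up to an error that decays with the
    outer radius. Minimality is therefore asymptotic at first and is pulled back along the geodesic
    by the triangle inequality.

    The slope 1/2 is critical because in a cone of slope [a] a tangential geodesic turns by PI / (2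
    a) in total, which is [PI] for a = 1/2. The unrolled cone of slope 1/2 is a half plane in which
    a meridian is perpendicular to the tangential rays, so their Busemann functions are constant
    along it. This is why a whole segment survives in [C0] there, and why the basepoint has to be
    moved outwards. *)

(** * One-variable calculus: continuity, monotonicity, integrals and increments *)

Lemma continuous_eps (f : R -> R) (x : R) :
  continuous f x <->
  forall eps, 0 < eps -> exists d, 0 < d /\ forall y, Rabs (y - x) < d -> Rabs (f y - f x) < eps.
Proof.
  split.
  - intros H eps He. apply filterlim_locally with (eps := mkposreal eps He) in H.
    destruct H as [d Hd]. exists d. split; [apply cond_pos|].
    intros y Hy. exact (Hd y Hy).
  - intros H. apply filterlim_locally. intros eps.
    destruct (H eps (cond_pos eps)) as [d [Hd1 Hd2]].
    exists (mkposreal d Hd1). intros y Hy. exact (Hd2 y Hy).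
Qed.

Lemma lipschitz_continuous (f : R -> R) (k x : R) :
  (forall y, Rabs (f y - f x) <= k * Rabs (y - x)) -> continuous f x.
Proof.
  intros H. apply continuous_eps. intros eps He.
  assert (Hk : 0 < Rabs k + 1) by (pose proof (Rabs_pos k); lra).
  exists (eps / (Rabs k + 1)). split; [apply Rdiv_lt_0_compat; lra|].
  intros y Hy. apply Rle_lt_trans with (1 := H y).
  apply Rle_lt_trans with ((Rabs k + 1) * Rabs (y - x)).
  - pose proof (Rle_abs k). pose proof (Rabs_pos (y - x)). nra.
  - apply Rmult_lt_compat_l with (r := Rabs k + 1) in Hy; [|lra].
    replace ((Rabs k + 1) * (eps / (Rabs k + 1))) with eps in Hy by (field; lra). exact Hy.
Qed.

Lemma is_derive_continuous (f : R -> R) (x d : R) : is_derive f x d -> continuous f x.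
Proof. intros H. apply (ex_derive_continuous f x). now exists d. Qed.

(** Clamping the argument turns a function continuous on [a, b] into one continuous on all of R, as
    the integral and intermediate value lemmas require. *)
Definition clip (a b t : R) : R := Rmax a (Rmin b t).

Lemma clip_range (a b t : R) : a <= b -> a <= clip a b t <= b.
Proof. intros. unfold clip, Rmax, Rmin. repeat destruct Rle_dec; lra. Qed.

Lemma clip_id (a b t : R) : a <= t <= b -> clip a b t = t.
Proof. intros. unfold clip, Rmax, Rmin. repeat destruct Rle_dec; lra. Qed.

Lemma clip_continuous (a b t : R) : continuous (clip a b) t.
Proof.
  apply lipschitz_continuous with 1. intros y.
  unfold clip, Rmax, Rmin, Rabs. repeat destruct Rle_dec; repeat destruct Rcase_abs; lra.
Qed.

Lemma clip_comp_continuous (f : R -> R) (a b t : R) : a <= b ->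
  (forall x, a <= x <= b -> continuous f x) -> continuous (fun s => f (clip a b s)) t.
Proof.
  intros Hab H. apply (continuous_comp (clip a b) f).
  - apply clip_continuous.
  - apply H, clip_range, Hab.
Qed.

(** The derivative is asked for in the open interval only, because the angle swept by a tangential
    geodesic has infinite slope at its initial radius. *)
Lemma monotone_of_derive (f df : R -> R) (a b : R) :
  a <= b -> (forall x, a <= x <= b -> continuous f x) ->
  (forall x, a < x < b -> is_derive f x (df x)) ->
  (forall x, a < x < b -> 0 <= df x) -> f a <= f b.
Proof.
  intros Hab Hc Hd Hp. destruct (Req_dec a b) as [->|Hne]; [lra|].
  assert (Hab' : a < b) by lra.
  (* [MVT_gen] may return an endpoint, where the sign of [df] is unknown; padding by 0 makes that
     case harmless. *)
  destruct (MVT_gen f a b (fun x => if Rlt_dec a x then (if Rlt_dec x b then df x else 0) else 0)) as [c [Hc1 Hc2]].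
  - intros x. rewrite Rmin_left, Rmax_right by lra. intros Hx.
    destruct (Rlt_dec a x); [|lra]. destruct (Rlt_dec x b); [|lra]. apply Hd; lra.
  - intros x. rewrite Rmin_left, Rmax_right by lra. intros Hx.
    apply continuity_pt_filterlim. apply Hc; lra.
  - rewrite Rmin_left, Rmax_right in Hc1 by lra.
    assert (0 <= f b - f a); [|lra]. rewrite Hc2.
    destruct (Rlt_dec a c); [|lra]. destruct (Rlt_dec c b); [|lra].
    apply Rmult_le_pos; [apply Hp; lra|lra].
Qed.

Lemma ex_RInt_cont (f : R -> R) (a b : R) : a <= b ->
  (forall x, a <= x <= b -> continuous f x) -> ex_RInt f a b.
Proof.
  intros Hab H. apply (ex_RInt_continuous f). intros z.
  rewrite Rmin_left, Rmax_right by lra. apply H.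
Qed.

Lemma is_derive_RInt_cont (f : R -> R) (a x : R) :
  (forall y, continuous f y) -> is_derive (fun t => RInt f a t) x (f x).
Proof.
  intros H. apply (is_derive_RInt f (fun t => RInt f a t) a x).
  - apply filter_forall. intros y. apply (RInt_correct f).
    apply (ex_RInt_continuous f). intros; apply H.
  - apply H.
Qed.

(** Since [dG] need not be integrable, a primitive of [s] minus [G] is shown to be monotone instead
    of integrating [dG]. *)
Lemma increment_le_RInt (G dG s : R -> R) (a b : R) :
  a <= b -> (forall t, a <= t <= b -> continuous G t) ->
  (forall t, a < t < b -> is_derive G t (dG t)) ->
  (forall t, a <= t <= b -> continuous s t) ->
  (forall t, a < t < b -> dG t <= s t) -> G b - G a <= RInt s a b.
Proof.
  intros Hab HG HdG Hs Hle.
  set (s' := fun t => s (clip a b t)).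
  assert (Hs' : forall t, continuous s' t) by (intros t; now apply clip_comp_continuous).
  replace (RInt s a b) with (RInt s' a b).
  2:{ apply RInt_ext. intros x. rewrite Rmin_left, Rmax_right by lra. intros Hx.
      unfold s'. now rewrite clip_id by lra. }
  assert (H : (fun t => RInt s' a t - G t) a <= (fun t => RInt s' a t - G t) b).
  { apply (monotone_of_derive (fun t => RInt s' a t - G t) (fun t => s' t - dG t)); auto.
    - intros x Hx. apply (continuous_minus (fun t => RInt s' a t) G); [|apply HG; lra].
      eapply is_derive_continuous. now apply is_derive_RInt_cont.
    - intros x Hx. apply (is_derive_minus (fun t => RInt s' a t) G);
        [now apply is_derive_RInt_cont|now apply HdG].
    - intros x Hx. unfold s'. rewrite clip_id by lra. specialize (Hle x Hx). lra. }
  simpl in H. rewrite RInt_point in H. unfold zero in H; simpl in H. lra.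
Qed.

(** * The metric split into radial and angular parts, and concave warping functions *)

Definition speed (m : R -> R) (c : R -> pt) (t : R) : R := sqrt (gmet m (c t) (vel c t) (vel c t)).

Definition C1on (c : R -> pt) (a b : R) : Prop :=
  forall t, a <= t <= b ->
    ex_derive (cx c) t /\ ex_derive (cy c) t /\
    continuous (Derive (cx c)) t /\ continuous (Derive (cy c)) t.

Definition cross (u v : pt) : R := fst u * snd v - snd u * fst v.
Definition nrm (q : pt) : R := sqrt (dot q q).

Lemma dot_self_ge0 (q : pt) : 0 <= dot q q.
Proof. unfold dot. nra. Qed.

Lemma nrm_ge0 (q : pt) : 0 <= nrm q.
Proof. apply sqrt_pos. Qed.

Lemma nrm_sq (q : pt) : nrm q * nrm q = dot q q.
Proof. apply sqrt_sqrt, dot_self_ge0. Qed.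

Lemma dot_cross (u v : pt) : dot u v * dot u v + cross u v * cross u v = dot u u * dot v v.
Proof. unfold dot, cross. ring. Qed.

Lemma nrm0 (q : pt) : nrm q = 0 -> q = (0, 0).
Proof.
  intros H. pose proof (nrm_sq q) as E. rewrite H in E. unfold dot in E.
  destruct q as [a b]; simpl in *. f_equal; nra.
Qed.

(** [dot q u / nrm q] is dr(u) and [cross q u / nrm q ^ 2] is dtheta(u), so this is the metric in
    polar form without any choice of an angle. *)
Lemma gmet_polar (m : R -> R) (q u v : pt) : nrm q <> 0 ->
  gmet m q u v = dot q u * dot q v / (nrm q) ^ 2
                 + (m (nrm q)) ^ 2 * (cross q u * cross q v) / (nrm q) ^ 4.
Proof.
  intros H. unfold gmet. fold (nrm q). destruct Req_EM_T; [easy|].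
  assert (E : dot u v * nrm q ^ 2 = dot q u * dot q v + cross q u * cross q v).
  { simpl. rewrite Rmult_1_r, nrm_sq. unfold dot, cross. ring. }
  replace (cross q u * cross q v) with (dot u v * nrm q ^ 2 - dot q u * dot q v) by lra.
  field. exact H.
Qed.

Lemma gmet_origin (m : R -> R) (q u v : pt) : nrm q = 0 -> gmet m q u v = dot u v.
Proof. intros H. unfold gmet. fold (nrm q). now destruct Req_EM_T. Qed.

Lemma gmet_ge0 (m : R -> R) (q u : pt) : 0 <= gmet m q u u.
Proof.
  destruct (Req_dec (nrm q) 0) as [H|H].
  - rewrite gmet_origin by easy. apply dot_self_ge0.
  - rewrite gmet_polar by easy.
    assert (0 < nrm q) by (pose proof (nrm_ge0 q); lra).
    apply Rplus_le_le_0_compat; apply Rmult_le_pos; try (apply Rlt_le, Rinv_0_lt_compat, pow_lt; lra); nra.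
Qed.

Lemma gmet_scale (m : R -> R) (q : pt) (k : R) (u : pt) :
  gmet m q (k * fst u, k * snd u) (k * fst u, k * snd u) = k ^ 2 * gmet m q u u.
Proof.
  destruct (Req_dec (nrm q) 0) as [H|H].
  - rewrite !gmet_origin by easy. unfold dot; simpl; ring.
  - rewrite !gmet_polar by easy. unfold dot, cross; simpl; field. easy.
Qed.

(** All that the rest of the proof uses of the two hypotheses: regularity is needed to first order
    only, and the curvature enters through the monotonicity of m'. *)
Record warp (m : R -> R) : Prop := {
  warp_derive : forall r, is_derive m r (Derive m r);
  warp_C1 : forall r, continuous (Derive m) r;
  warp_0 : m 0 = 0;
  warp_D0 : Derive m 0 = 1;
  warp_pos : forall r, 0 < r -> 0 < m r;
  warp_dec : forall x y, 0 <= x <= y -> Derive m y <= Derive m x }.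

Lemma warp_of_curvature (m : R -> R) : admissible_m m ->
  (forall r, 0 < r -> 0 <= Gm m r) -> warp m.
Proof.
  intros (Hs & _ & H0 & H1 & Hp) HG.
  assert (D1 : forall r, is_derive m r (Derive m r)).
  { intros r. apply Derive_correct. exact (Hs 0%nat r). }
  assert (D2 : forall r, is_derive (Derive m) r (Derive_n m 2 r)).
  { intros r. apply Derive_correct. exact (Hs 1%nat r). }
  constructor; auto.
  - intros r. eapply is_derive_continuous, D2.
  - intros x y Hxy.
    assert (- Derive m x <= - Derive m y); [|lra].
    apply (monotone_of_derive (fun t => - Derive m t) (fun t => - Derive_n m 2 t)); [lra| | |].
    + intros t _. apply (continuous_opp (Derive m)). eapply is_derive_continuous, D2.
    + intros t _. apply (is_derive_opp (Derive m)), D2.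
    + intros t Ht. assert (Ht0 : 0 < t) by lra.
      specialize (HG t Ht0). specialize (Hp t Ht0). unfold Gm in HG.
      apply Rmult_le_compat_r with (r := m t) in HG; [|lra].
      unfold Rdiv in HG. rewrite Rmult_0_l, Rmult_assoc, Rinv_l, Rmult_1_r in HG by lra. exact HG.
Qed.

Section Warped.
Context (m : R -> R) (W : warp m).

Lemma m_continuous (r : R) : continuous m r.
Proof. eapply is_derive_continuous, warp_derive, W. Qed.

Lemma dm_le1 (r : R) : 0 <= r -> Derive m r <= 1.
Proof. intros H. rewrite <- (warp_D0 m W). apply (warp_dec m W); lra. Qed.

Lemma m_tangent_le (x y : R) : 0 <= x <= y -> m y <= m x + Derive m x * (y - x).
Proof.
  intros H.
  assert (m x + Derive m x * (x - x) - m x <= m x + Derive m x * (y - x) - m y); [|lra].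
  apply (monotone_of_derive (fun t => m x + Derive m x * (t - x) - m t)
           (fun t => Derive m x - Derive m t)); [lra| | |].
  - intros t _. apply (continuous_minus (fun t => m x + Derive m x * (t - x)) m), m_continuous.
    apply (ex_derive_continuous (fun t => m x + Derive m x * (t - x))). auto_derive; auto.
  - intros t _. apply (is_derive_minus (fun t => m x + Derive m x * (t - x)) m).
    + auto_derive; auto; ring.
    + apply (warp_derive m W).
  - intros t Ht. pose proof (warp_dec m W x t). lra.
Qed.

(** By concavity [m] stays below its tangent lines, and a tangent line of negative slope would force
    [m] below 0. *)
Lemma dm_ge0 (r : R) : 0 <= r -> 0 <= Derive m r.
Proof.
  intros H. destruct (Rle_dec 0 (Derive m r)) as [|Hn]; [easy|exfalso].
  set (d := - Derive m r). assert (Hd : 0 < d) by (unfold d; lra).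
  assert (Hm : 0 <= m r).
  { destruct (Req_dec r 0) as [->|]; [rewrite (warp_0 m W); lra|].
    apply Rlt_le, (warp_pos m W); lra. }
  assert (Hq : 0 <= m r / d) by (apply Rdiv_le_0_compat; lra).
  (* At this radius the tangent line at [r] takes the value [- d]. *)
  pose proof (m_tangent_le r (r + m r / d + 1) ltac:(lra)) as E.
  pose proof (warp_pos m W (r + m r / d + 1) ltac:(lra)).
  replace (Derive m r) with (- d) in E by (unfold d; ring).
  replace (m r + - d * (r + m r / d + 1 - r)) with (- d) in E by (field; lra). lra.
Qed.

Lemma m_mono (x y : R) : 0 <= x <= y -> m x <= m y.
Proof.
  intros H. apply (monotone_of_derive m (Derive m)); [lra| | |].
  - intros; apply m_continuous.
  - intros; apply (warp_derive m W).
  - intros; apply dm_ge0; lra.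
Qed.

Lemma m_le (r : R) : 0 <= r -> m r <= r.
Proof.
  intros H. pose proof (m_tangent_le 0 r ltac:(lra)) as E.
  rewrite (warp_0 m W), (warp_D0 m W) in E. lra.
Qed.

Lemma m_ge0 (r : R) : 0 <= r -> 0 <= m r.
Proof. intros H. rewrite <- (warp_0 m W). apply m_mono. lra. Qed.

Lemma m_diff_le (x y : R) : 0 <= x <= y -> m y - m x <= y - x.
Proof.
  intros H. pose proof (m_tangent_le x y H). pose proof (dm_le1 x ltac:(lra)). nra.
Qed.

Lemma gmet_le_dot (q u : pt) : gmet m q u u <= dot u u.
Proof.
  destruct (Req_dec (nrm q) 0) as [H|H].
  - rewrite gmet_origin by easy. lra.
  - assert (Hp : 0 < nrm q) by (pose proof (nrm_ge0 q); lra).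
    rewrite gmet_polar by easy.
    pose proof (dot_cross q u) as E. rewrite <- (nrm_sq q) in E.
    assert (Hm : (m (nrm q)) ^ 2 <= nrm q ^ 2).
    { pose proof (m_le (nrm q) ltac:(lra)). pose proof (m_ge0 (nrm q) ltac:(lra)). nra. }
    replace (dot u u) with (dot q u * dot q u / nrm q ^ 2 + nrm q ^ 2 * (cross q u * cross q u) / nrm q ^ 4).
    2:{ replace (cross q u * cross q u) with (nrm q * nrm q * dot u u - dot q u * dot q u) by lra.
        field. lra. }
    apply Rplus_le_compat_l. apply Rmult_le_compat_r.
    { apply Rlt_le, Rinv_0_lt_compat, pow_lt, Hp. }
    apply Rmult_le_compat_r; [nra|exact Hm].
Qed.

End Warped.

(** * Lengths and distances *)

Lemma cont_plus (f g : R -> R) x : continuous f x -> continuous g x -> continuous (fun t => f t + g t) x.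
Proof. intros. now apply (continuous_plus f g). Qed.
Lemma cont_minus (f g : R -> R) x : continuous f x -> continuous g x -> continuous (fun t => f t - g t) x.
Proof. intros. now apply (continuous_minus f g). Qed.
Lemma cont_opp (f : R -> R) x : continuous f x -> continuous (fun t => - f t) x.
Proof. intros. now apply (continuous_opp f). Qed.
Lemma cont_mult (f g : R -> R) x : continuous f x -> continuous g x -> continuous (fun t => f t * g t) x.
Proof. intros. now apply (continuous_mult f g). Qed.
Lemma cont_inv (f : R -> R) x : continuous f x -> f x <> 0 -> continuous (fun t => / f t) x.
Proof. intros. now apply (continuous_Rinv_comp f). Qed.
Lemma cont_div (f g : R -> R) x : continuous f x -> continuous g x -> g x <> 0 -> continuous (fun t => f t / g t) x.
Proof. intros. apply cont_mult; [easy|now apply cont_inv]. Qed.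
Lemma cont_pow (f : R -> R) n x : continuous f x -> continuous (fun t => f t ^ n) x.
Proof.
  intros H. induction n as [|n IH]; simpl; [apply continuous_const|now apply cont_mult].
Qed.
Lemma cont_sqrt (f : R -> R) x : continuous f x -> continuous (fun t => sqrt (f t)) x.
Proof. intros H. apply (continuous_comp f sqrt); [easy|apply continuous_sqrt]. Qed.
Lemma cont_comp (f g : R -> R) x : continuous f x -> continuous g (f x) -> continuous (fun t => g (f t)) x.
Proof. intros H H'. now apply (continuous_comp f g). Qed.
Lemma cont_id x : continuous (fun t : R => t) x.
Proof. apply continuous_id. Qed.
Lemma cont_const (k x : R) : continuous (fun _ : R => k) x.
Proof. apply continuous_const. Qed.
Lemma cont_cos (x : R) : continuous cos x.
Proof. apply (ex_derive_continuous cos). auto_derive; auto. Qed.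
Lemma cont_sin (x : R) : continuous sin x.
Proof. apply (ex_derive_continuous sin). auto_derive; auto. Qed.
Lemma cont_atan (x : R) : continuous atan x.
Proof. apply (ex_derive_continuous atan). auto_derive; auto. Qed.

Ltac cont := repeat first
  [ assumption | apply cont_const | apply cont_id
  | lazymatch goal with
    | |- continuous (fun t => @?f t + @?g t) _ => apply (cont_plus f g)
    | |- continuous (fun t => @?f t - @?g t) _ => apply (cont_minus f g)
    | |- continuous (fun t => - @?f t) _ => apply (cont_opp f)
    | |- continuous (fun t => @?f t * @?g t) _ => apply (cont_mult f g)
    | |- continuous (Rmult ?k) _ => apply (cont_mult (fun _ => k) (fun t => t))
    | |- continuous (fun t => @?f t ^ ?n) _ => apply (cont_pow f n)
    | |- continuous (fun t => sqrt (@?f t)) _ => apply (cont_sqrt f)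
    end ].

Lemma cont_loc_ne (f : R -> R) x : continuous f x -> f x <> 0 -> locally x (fun t => f t <> 0).
Proof.
  intros H Hx. destruct (proj1 (continuous_eps f x) H (Rabs (f x))) as [d [Hd1 Hd2]];
    [now apply Rabs_pos_lt|].
  exists (mkposreal d Hd1). intros y Hy E. specialize (Hd2 y Hy).
  rewrite E in Hd2. replace (0 - f x) with (- f x) in Hd2 by ring. rewrite Rabs_Ropp in Hd2. lra.
Qed.

Lemma cont_squeeze (f g : R -> R) x :
  (forall t, Rabs (f t) <= g t) -> continuous g x -> g x = 0 -> continuous f x.
Proof.
  intros Hle Hg H0. apply continuous_eps. intros eps He.
  destruct (proj1 (continuous_eps g x) Hg eps He) as [d [Hd1 Hd2]].
  exists d. split; [easy|]. intros y Hy. specialize (Hd2 y Hy).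
  assert (f x = 0) as ->.
  { specialize (Hle x). rewrite H0 in Hle. pose proof (Rabs_pos (f x)).
    destruct (Req_dec (f x) 0) as [|Hn]; [easy|]. apply Rabs_pos_lt in Hn. lra. }
  rewrite H0 in Hd2. rewrite Rminus_0_r in *. apply Rle_lt_trans with (g y); [apply Hle|].
  pose proof (Rle_abs (g y)). lra.
Qed.

Section Warped.
Context (m : R -> R) (W : warp m).

Lemma m_ratio_continuous : continuous (fun r => if Req_EM_T r 0 then 1 else m r / r) 0.
Proof.
  apply continuous_eps. intros eps He.
  pose proof (warp_derive m W 0) as HD. rewrite (warp_D0 m W) in HD.
  apply is_derive_Reals in HD. destruct (HD eps He) as [d Hd].
  exists d. split; [apply cond_pos|]. intros y Hy.
  destruct (Req_EM_T 0 0); [|lra]. destruct Req_EM_T as [E|E].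
  - rewrite Rminus_diag, Rabs_R0. exact He.
  - specialize (Hd y E). rewrite Rplus_0_l, (warp_0 m W), Rminus_0_r in Hd.
    apply Hd. now rewrite Rminus_0_r in Hy.
Qed.

(** The relative amount by which the angular part of the metric falls short of the Euclidean one. It
    tends to 0 at the pole because m'(0) = 1, which is what makes the metric continuous there. *)
Definition defect (r : R) : R := 1 - (if Req_EM_T r 0 then 1 else m r / r) ^ 2.

Lemma gmet_defect (q v : pt) :
  gmet m q v v = dot v v - defect (nrm q) * (cross q v * cross q v / nrm q ^ 2).
Proof.
  unfold defect. destruct Req_EM_T as [H|H].
  - rewrite gmet_origin by easy. lra.
  - rewrite gmet_polar by easy. pose proof (dot_cross q v) as E. rewrite <- (nrm_sq q) in E.
    replace (dot q v * dot q v) with (nrm q * nrm q * dot v v - cross q v * cross q v) by lra.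
    field. easy.
Qed.

Lemma cross_sq_le (q v : pt) : cross q v * cross q v / nrm q ^ 2 <= dot v v.
Proof.
  destruct (Req_dec (nrm q) 0) as [H|H].
  - rewrite H. unfold Rdiv. simpl. rewrite Rmult_0_l, Rinv_0, Rmult_0_r. apply dot_self_ge0.
  - pose proof (dot_cross q v) as E. rewrite <- (nrm_sq q) in E.
    assert (0 < nrm q) by (pose proof (nrm_ge0 q); lra).
    apply Rle_div_l; [nra|]. nra.
Qed.

Lemma nrm_curve_continuous (c : R -> pt) t :
  continuous (cx c) t -> continuous (cy c) t -> continuous (fun s => nrm (c s)) t.
Proof.
  intros Hx Hy. unfold nrm, dot. apply cont_sqrt, cont_plus; apply cont_mult; assumption.
Qed.

Lemma speed_continuous (c : R -> pt) t :
  ex_derive (cx c) t -> ex_derive (cy c) t ->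
  continuous (Derive (cx c)) t -> continuous (Derive (cy c)) t -> continuous (speed m c) t.
Proof.
  intros Hx Hy Hdx Hdy.
  apply (ex_derive_continuous (cx c)) in Hx. apply (ex_derive_continuous (cy c)) in Hy.
  pose proof (nrm_curve_continuous c t Hx Hy) as Hn.
  unfold speed. apply cont_sqrt.
  assert (Hdot : continuous (fun s => dot (vel c s) (vel c s)) t).
  { unfold dot, vel; simpl. cont. }
  assert (Hcr : continuous (fun s => cross (c s) (vel c s)) t).
  { unfold cross, vel; simpl. apply cont_minus; apply cont_mult; assumption. }
  destruct (Req_dec (nrm (c t)) 0) as [H0|H0].
  - apply (continuous_ext (fun s => dot (vel c s) (vel c s) -
      defect (nrm (c s)) * (cross (c s) (vel c s) * cross (c s) (vel c s) / nrm (c s) ^ 2))).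
    { intros s. now rewrite gmet_defect. }
    apply cont_minus; [exact Hdot|].
    (* At the pole the angular quotient has no limit, but it is bounded by the Euclidean square of
       the velocity, and its factor [defect] tends to 0. *)
    apply cont_squeeze with (g := fun s => Rabs (defect (nrm (c s))) * dot (vel c s) (vel c s)).
    + intros s. rewrite Rabs_mult. apply Rmult_le_compat_l; [apply Rabs_pos|].
      rewrite Rabs_right; [apply cross_sq_le|].
      apply Rle_ge. unfold Rdiv. apply Rmult_le_pos; [nra|].
      destruct (Req_dec (nrm (c s)) 0) as [E|E].
      * rewrite E. simpl. rewrite Rmult_0_l, Rinv_0. lra.
      * apply Rlt_le, Rinv_0_lt_compat. assert (0 < nrm (c s)) by (pose proof (nrm_ge0 (c s)); lra).
        apply pow_lt; lra.
    + apply cont_mult; [|exact Hdot].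
      apply (cont_comp (fun s => defect (nrm (c s))) Rabs);
        [|apply lipschitz_continuous with 1; intros; rewrite Rmult_1_l; apply Rabs_triang_inv2].
      unfold defect. apply cont_minus; [apply cont_const|]. apply cont_pow.
      apply (cont_comp (fun s => nrm (c s)) (fun r => if Req_EM_T r 0 then 1 else m r / r)); [exact Hn|].
      rewrite H0. apply m_ratio_continuous.
    + unfold defect. rewrite H0. destruct Req_EM_T; [|lra].
      replace (1 - 1 ^ 2) with 0 by ring. rewrite Rabs_R0. ring.
  - eapply continuous_ext_loc.
    { pose proof (cont_loc_ne _ _ Hn H0) as L. revert L. apply filter_imp. intros s Hs.
      symmetry. now apply gmet_polar. }
    assert (Hdt : continuous (fun s => dot (c s) (vel c s)) t).
    { unfold dot, vel; simpl. apply cont_plus; apply cont_mult; assumption. }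
    apply cont_plus.
    + apply cont_div; [now apply cont_mult|now apply cont_pow|now apply pow_nonzero].
    + apply cont_div; [|now apply cont_pow|now apply pow_nonzero].
      apply cont_mult; [|now apply cont_mult]. apply cont_pow.
      apply (cont_comp (fun s => nrm (c s)) m); [exact Hn|now apply m_continuous].
Qed.

Lemma speed_continuous_on (c : R -> pt) a b : C1on c a b ->
  forall t, a <= t <= b -> continuous (speed m c) t.
Proof. intros H t Ht. apply speed_continuous; apply (H t Ht). Qed.

Lemma glength_ge0 (c : R -> pt) : C1curve c -> 0 <= glength m c.
Proof.
  intros H. apply RInt_ge_0; [lra| |intros; apply sqrt_pos].
  apply (ex_RInt_cont (speed m c)); [lra|]. apply speed_continuous_on, H.
Qed.

(** [dist] applies [real] to an infimum in Rbar. Infinite values are excluded: the straight segment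
    is an admissible curve, and lengths are nonnegative. *)
Lemma dist_glb (x y : pt) :
  (forall c, C1curve c -> c 0 = x -> c 1 = y -> dist m x y <= glength m c) /\
  (forall l, (forall c, C1curve c -> c 0 = x -> c 1 = y -> l <= glength m c) -> l <= dist m x y).
Proof.
  unfold dist. set (E := fun L => exists c, C1curve c /\ c 0 = x /\ c 1 = y /\ L = glength m c).
  pose proof (Glb_Rbar_correct E) as [H1 H2].
  assert (Hne : exists c, C1curve c /\ c 0 = x /\ c 1 = y).
  { exists (fun t => (fst x + t * (fst y - fst x), snd x + t * (snd y - snd x))).
    split; [|split; [destruct x|destruct y]; simpl; f_equal; ring].
    intros t _. unfold cx, cy; simpl.
    assert (D : forall a b s, is_derive (fun u => a + u * b) s b) by (intros; auto_derive; auto; ring).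
    repeat split; try (eexists; apply D).
    - apply (continuous_ext (fun _ => fst y - fst x)); [|apply cont_const].
      intros s. symmetry. apply is_derive_unique, D.
    - apply (continuous_ext (fun _ => snd y - snd x)); [|apply cont_const].
      intros s. symmetry. apply is_derive_unique, D. }
  destruct Hne as [c0 [Hc0 [Hx Hy]]].
  destruct (Glb_Rbar E) as [d| |] eqn:HE; simpl in *.
  - split.
    + intros c Hc Hcx Hcy. specialize (H1 (glength m c)). simpl in H1. apply H1. exists c; auto.
    + intros l Hl. specialize (H2 (Finite l)). simpl in H2. apply H2.
      intros L [c (Hc & Hcx & Hcy & ->)]. simpl. auto.
  - exfalso. apply (H1 (glength m c0)). exists c0; auto.
  - exfalso. apply (H2 (Finite 0)). intros L [c (Hc & _ & _ & ->)]. simpl. now apply glength_ge0.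
Qed.

Lemma dist_le_glength (c : R -> pt) : C1curve c -> dist m (c 0) (c 1) <= glength m c.
Proof. intros H. now apply (dist_glb (c 0) (c 1)). Qed.

Lemma dist_ge (x y : pt) (l : R) :
  (forall c, C1curve c -> c 0 = x -> c 1 = y -> l <= glength m c) -> l <= dist m x y.
Proof. apply dist_glb. Qed.

Lemma dist_approx (x y : pt) (l : R) : dist m x y < l ->
  exists c, C1curve c /\ c 0 = x /\ c 1 = y /\ glength m c < l.
Proof.
  intros H. apply NNPP. intros Hn.
  assert (l <= dist m x y); [|lra]. apply dist_ge. intros c Hc H0 H1.
  apply Rnot_lt_le. intros Hlt. apply Hn. exists c; auto.
Qed.

Lemma dist_ge0 (x y : pt) : 0 <= dist m x y.
Proof. apply dist_ge. intros c Hc _ _. now apply glength_ge0. Qed.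

Lemma is_derive_vel (c : R -> pt) (phi : R -> R) (t d : R) :
  is_derive phi t d -> ex_derive (cx c) (phi t) -> ex_derive (cy c) (phi t) ->
  is_derive (cx (fun s => c (phi s))) t (d * Derive (cx c) (phi t)) /\
  is_derive (cy (fun s => c (phi s))) t (d * Derive (cy c) (phi t)).
Proof.
  intros Hp Hx Hy. split.
  - apply (is_derive_comp (cx c) phi); [now apply Derive_correct|easy].
  - apply (is_derive_comp (cy c) phi); [now apply Derive_correct|easy].
Qed.

Lemma vel_of (c : R -> pt) (t a b : R) : is_derive (cx c) t a -> is_derive (cy c) t b -> vel c t = (a, b).
Proof. intros H1 H2. unfold vel. now rewrite (is_derive_unique _ _ _ H1), (is_derive_unique _ _ _ H2). Qed.

Lemma speed_comp (c : R -> pt) (phi : R -> R) (t d : R) :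
  is_derive phi t d -> ex_derive (cx c) (phi t) -> ex_derive (cy c) (phi t) ->
  speed m (fun s => c (phi s)) t = Rabs d * speed m c (phi t).
Proof.
  intros Hp Hx Hy. destruct (is_derive_vel c phi t d Hp Hx Hy) as [H1 H2].
  unfold speed. rewrite (vel_of _ _ _ _ H1 H2). cbv beta.
  pose proof (gmet_scale m (c (phi t)) d (vel c (phi t))) as E. simpl fst in E; simpl snd in E.
  rewrite E, sqrt_mult by (try apply gmet_ge0; nra).
  f_equal. rewrite <- Rsqr_pow2. apply sqrt_Rsqr_abs.
Qed.

Lemma C1_comp (c : R -> pt) (phi dphi : R -> R) (a b t : R) : C1on c a b ->
  locally t (fun s => a <= phi s <= b /\ is_derive phi s (dphi s)) -> continuous dphi t ->
  ex_derive (cx (fun s => c (phi s))) t /\ ex_derive (cy (fun s => c (phi s))) t /\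
  continuous (Derive (cx (fun s => c (phi s)))) t /\ continuous (Derive (cy (fun s => c (phi s)))) t.
Proof.
  intros HC HL Hd.
  destruct (locally_singleton _ _ HL) as [Ht Hpt].
  destruct (HC _ Ht) as (Hx & Hy & Hdx & Hdy).
  destruct (is_derive_vel c phi t _ Hpt Hx Hy) as [H1 H2].
  assert (Hpc : continuous phi t) by (eapply is_derive_continuous, Hpt).
  repeat split; [eexists; exact H1|eexists; exact H2| |].
  - apply (continuous_ext_loc _ (fun s => dphi s * Derive (cx c) (phi s))).
    + revert HL. apply filter_imp. intros s [Hs Hps]. symmetry. apply is_derive_unique.
      apply is_derive_vel; [easy|apply HC, Hs|apply HC, Hs].
    + apply cont_mult; [easy|]. now apply (cont_comp phi (Derive (cx c))).
  - apply (continuous_ext_loc _ (fun s => dphi s * Derive (cy c) (phi s))).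
    + revert HL. apply filter_imp. intros s [Hs Hps]. symmetry. apply is_derive_unique.
      apply is_derive_vel; [easy|apply HC, Hs|apply HC, Hs].
    + apply cont_mult; [easy|]. now apply (cont_comp phi (Derive (cy c))).
Qed.

End Warped.

(** * Reparametrization, concatenation and orthogonal images of curves: [dist] is a symmetric,
    invariant distance *)

Definition smoothstep (u : R) : R := 3 * u ^ 2 - 2 * u ^ 3.

(** The values stay in [0, 1] on a neighbourhood of [0, 1], so a curve controlled only on [0, 1]
    becomes differentiable around the whole interval once composed with [smoothstep]. The derivative
    vanishes at 0 and 1, so that composed curves can be joined. *)
Lemma smoothstep_range (u : R) : -1/2 <= u <= 3/2 -> 0 <= smoothstep u <= 1.
Proof.
  intros H. unfold smoothstep. split.
  - replace (3 * u ^ 2 - 2 * u ^ 3) with (u ^ 2 * (3 - 2 * u)) by ring.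
    apply Rmult_le_pos; [apply pow2_ge_0|lra].
  - apply Rminus_le. replace (3 * u ^ 2 - 2 * u ^ 3 - 1) with (- ((1 - u) ^ 2 * (1 + 2 * u))) by ring.
    apply Ropp_le_cancel. rewrite Ropp_0, Ropp_involutive. apply Rmult_le_pos; [apply pow2_ge_0|lra].
Qed.

Lemma smoothstep_derive (a k p q t : R) :
  is_derive (fun t => a + k * smoothstep (p * t + q)) t
    (k * p * (6 * (p * t + q) - 6 * (p * t + q) ^ 2)).
Proof. unfold smoothstep. auto_derive; auto. ring. Qed.

Lemma is_derive_glue (f1 f2 : R -> R) (t0 d : R) : f1 t0 = f2 t0 ->
  is_derive f1 t0 d -> is_derive f2 t0 d ->
  is_derive (fun t => if Rle_dec t t0 then f1 t else f2 t) t0 d.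
Proof.
  intros E H1 H2. apply is_derive_Reals in H1. apply is_derive_Reals in H2.
  apply is_derive_Reals. intros eps He.
  destruct (H1 eps He) as [d1 Hd1]. destruct (H2 eps He) as [d2 Hd2].
  assert (Hm : 0 < Rmin d1 d2) by (apply Rmin_glb_lt; apply cond_pos).
  exists (mkposreal _ Hm). intros h Hh Hlt. simpl in Hlt.
  pose proof (Rmin_l d1 d2). pose proof (Rmin_r d1 d2).
  destruct (Rle_dec t0 t0); [|lra]. destruct Rle_dec.
  - apply Hd1; [easy|lra].
  - rewrite E. apply Hd2; [easy|lra].
Qed.

Lemma C1_glue (f1 f2 : R -> R) (t0 d : R) : f1 t0 = f2 t0 ->
  ex_derive f1 t0 -> ex_derive f2 t0 -> Derive f1 t0 = d -> Derive f2 t0 = d ->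
  continuous (Derive f1) t0 -> continuous (Derive f2) t0 ->
  ex_derive (fun t => if Rle_dec t t0 then f1 t else f2 t) t0 /\
  continuous (Derive (fun t => if Rle_dec t t0 then f1 t else f2 t)) t0.
Proof.
  intros E X1 X2 E1 E2 C1 C2.
  set (f := fun t : R => if Rle_dec t t0 then f1 t else f2 t).
  assert (D : is_derive f t0 d).
  { unfold f. apply is_derive_glue; auto; [rewrite <- E1|rewrite <- E2]; now apply Derive_correct. }
  split; [now exists d|]. apply continuous_eps. intros eps He.
  destruct (proj1 (continuous_eps _ _) C1 eps He) as [d1 [P1 Q1]].
  destruct (proj1 (continuous_eps _ _) C2 eps He) as [d2 [P2 Q2]].
  exists (Rmin d1 d2). split; [now apply Rmin_glb_lt|]. intros y Hy.
  pose proof (Rmin_l d1 d2). pose proof (Rmin_r d1 d2).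
  rewrite (is_derive_unique _ _ _ D).
  destruct (Rtotal_order y t0) as [Hlt|[->|Hgt]].
  - rewrite (Derive_ext_loc _ f1); [rewrite <- E1; apply Q1; lra|].
    assert (Hp : 0 < t0 - y) by lra. exists (mkposreal _ Hp). intros z Hz. unfold f.
    apply (Rabs_def2 (z - y)) in Hz. simpl in Hz. destruct Rle_dec; [easy|lra].
  - rewrite (is_derive_unique _ _ _ D), Rminus_diag, Rabs_R0. exact He.
  - rewrite (Derive_ext_loc _ f2); [rewrite <- E2; apply Q2; lra|].
    assert (Hp : 0 < y - t0) by lra. exists (mkposreal _ Hp). intros z Hz. unfold f.
    apply (Rabs_def2 (z - y)) in Hz. simpl in Hz. destruct Rle_dec; [lra|easy].
Qed.

Lemma C1_ext_loc (c c' : R -> pt) (t : R) : locally t (fun s => c s = c' s) ->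
  ex_derive (cx c) t /\ ex_derive (cy c) t /\
    continuous (Derive (cx c)) t /\ continuous (Derive (cy c)) t ->
  ex_derive (cx c') t /\ ex_derive (cy c') t /\
    continuous (Derive (cx c')) t /\ continuous (Derive (cy c')) t.
Proof.
  intros L (H1 & H2 & H3 & H4).
  assert (L2 : locally t (fun s => locally s (fun u => c u = c' u))) by now apply locally_locally.
  repeat split.
  - apply (ex_derive_ext_loc (cx c)); [|easy]. revert L. apply filter_imp.
    intros s Hs. unfold cx. now rewrite Hs.
  - apply (ex_derive_ext_loc (cy c)); [|easy]. revert L. apply filter_imp.
    intros s Hs. unfold cy. now rewrite Hs.
  - apply (continuous_ext_loc _ (Derive (cx c))); [|easy].
    revert L2. apply filter_imp. intros s Hs. symmetry. apply Derive_ext_loc.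
    revert Hs. apply filter_imp. intros u Hu. unfold cx. now rewrite Hu.
  - apply (continuous_ext_loc _ (Derive (cy c))); [|easy].
    revert L2. apply filter_imp. intros s Hs. symmetry. apply Derive_ext_loc.
    revert Hs. apply filter_imp. intros u Hu. unfold cy. now rewrite Hu.
Qed.

Section Warped.
Context (m : R -> R) (W : warp m).

Lemma speed_ext_loc (c c' : R -> pt) (t : R) : locally t (fun s => c s = c' s) ->
  speed m c t = speed m c' t.
Proof.
  intros L. unfold speed, vel.
  rewrite (Derive_ext_loc (cx c) (cx c')), (Derive_ext_loc (cy c) (cy c')).
  - now rewrite (locally_singleton _ _ L).
  - revert L. apply filter_imp. intros s Hs. unfold cy. now rewrite Hs.
  - revert L. apply filter_imp. intros s Hs. unfold cx. now rewrite Hs.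
Qed.

Lemma locally_interval (a b t : R) : a < t < b -> locally t (fun s => a < s < b).
Proof.
  intros H. assert (Hp : 0 < Rmin (t - a) (b - t)) by (apply Rmin_glb_lt; lra).
  exists (mkposreal _ Hp). intros s Hs. apply (Rabs_def2 (s - t)) in Hs. simpl in Hs.
  pose proof (Rmin_l (t - a) (b - t)). pose proof (Rmin_r (t - a) (b - t)). lra.
Qed.

Lemma smooth_C1 (c : R -> pt) (a b p q t : R) : a <= b -> C1on c a b ->
  -1/2 < p * t + q < 3/2 ->
  let c' := fun t => c (a + (b - a) * smoothstep (p * t + q)) in
  ex_derive (cx c') t /\ ex_derive (cy c') t /\
    continuous (Derive (cx c')) t /\ continuous (Derive (cy c')) t.
Proof.
  intros Hab HC Ht c'.
  apply (C1_comp c (fun t => a + (b - a) * smoothstep (p * t + q))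
    (fun t => (b - a) * p * (6 * (p * t + q) - 6 * (p * t + q) ^ 2)) a b t HC).
  - assert (Hc : continuous (fun t => p * t + q) t) by cont.
    specialize (Hc _ (locally_interval _ _ _ Ht)). revert Hc.
    unfold filtermap. apply filter_imp. intros s Hs. split; [|apply smoothstep_derive].
    pose proof (smoothstep_range (p * s + q) ltac:(lra)). nra.
  - cont.
Qed.

Lemma smooth_length (c : R -> pt) (a b p q s t : R) : a <= b -> C1on c a b -> 0 < p ->
  p * s + q = 0 -> p * t + q = 1 ->
  RInt (speed m (fun t => c (a + (b - a) * smoothstep (p * t + q)))) s t = RInt (speed m c) a b.
Proof.
  intros Hab HC Hp Es Et. assert (Hst : s <= t) by nra.
  assert (Hr : forall x, s <= x <= t -> 0 <= p * x + q <= 1) by (intros; nra).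
  set (phi := fun t => a + (b - a) * smoothstep (p * t + q)).
  set (dphi := fun t => (b - a) * p * (6 * (p * t + q) - 6 * (p * t + q) ^ 2)).
  assert (Hphi : forall x, s <= x <= t -> a <= phi x <= b).
  { intros x Hx. pose proof (smoothstep_range (p * x + q) ltac:(specialize (Hr x Hx); lra)). unfold phi. nra. }
  rewrite (RInt_ext _ (fun x => scal (dphi x) (speed m c (phi x)))).
  - rewrite (RInt_comp (speed m c) phi dphi).
    + unfold phi. rewrite Es, Et. unfold smoothstep. f_equal; ring.
    + intros x. rewrite Rmin_left, Rmax_right by lra. intros Hx.
      apply (speed_continuous_on m W c a b HC). now apply Hphi.
    + intros x _. split; [apply smoothstep_derive|unfold dphi; cont].
  - intros x. rewrite Rmin_left, Rmax_right by lra. intros Hx.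
    transitivity (Rabs (dphi x) * speed m c (phi x)); [apply (speed_comp m c phi x (dphi x))|].
    4: { rewrite Rabs_pos_eq; [reflexivity|]. unfold dphi. specialize (Hr x ltac:(lra)).
      replace (6 * (p * x + q) - 6 * (p * x + q) ^ 2) with (6 * (p * x + q) * (1 - (p * x + q))) by ring.
      repeat apply Rmult_le_pos; lra. }
    + apply smoothstep_derive.
    + apply HC, Hphi; lra.
    + apply HC, Hphi; lra.
Qed.

Lemma dist_le_RInt_speed (c : R -> pt) (a b : R) : a <= b -> C1on c a b ->
  dist m (c a) (c b) <= RInt (speed m c) a b.
Proof.
  intros Hab HC.
  rewrite <- (smooth_length c a b 1 0 0 1 Hab HC) by lra.
  set (c' := fun t => c (a + (b - a) * smoothstep (1 * t + 0))).
  replace (c a) with (c' 0) by (unfold c', smoothstep; f_equal; ring).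
  replace (c b) with (c' 1) by (unfold c', smoothstep; f_equal; ring).
  apply dist_le_glength; [exact W|]. intros t Ht. apply (smooth_C1 c a b 1 0 t Hab HC). lra.
Qed.

Lemma dist_sym_le (x y : pt) : dist m y x <= dist m x y.
Proof.
  apply dist_ge; [exact W|]. intros c HC <- <-.
  set (phi := fun t : R => 0 + (1 - 0) * smoothstep (-1 * t + 1)).
  set (dphi := fun t : R => (1 - 0) * -1 * (6 * (-1 * t + 1) - 6 * (-1 * t + 1) ^ 2)).
  assert (HC' : C1curve (fun t => c (phi t))).
  { intros t Ht. apply (smooth_C1 c 0 1 (-1) 1 t); [lra|exact HC|lra]. }
  assert (Hphi : forall x, 0 <= x <= 1 -> 0 <= phi x <= 1).
  { intros x Hx. unfold phi. pose proof (smoothstep_range (-1 * x + 1) ltac:(lra)). lra. }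
  pose proof (dist_le_glength m W _ HC') as HL. cbv beta in HL.
  replace (phi 0) with 1 in HL by (unfold phi, smoothstep; ring).
  replace (phi 1) with 0 in HL by (unfold phi, smoothstep; ring).
  apply Rle_trans with (1 := HL). apply Req_le. unfold glength.
  change (RInt (speed m (fun t => c (phi t))) 0 1 = RInt (speed m c) 0 1).
  rewrite (RInt_ext _ (fun x => opp (scal (dphi x) (speed m c (phi x))))).
  - rewrite (RInt_opp (fun x => scal (dphi x) (speed m c (phi x)))).
    + rewrite (RInt_comp (speed m c) phi dphi).
      * replace (phi 0) with 1 by (unfold phi, smoothstep; ring).
        replace (phi 1) with 0 by (unfold phi, smoothstep; ring).
        apply opp_RInt_swap. apply ex_RInt_swap, ex_RInt_cont; [lra|]. now apply speed_continuous_on.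
      * intros x. rewrite Rmin_left, Rmax_right by lra. intros Hx.
        apply (speed_continuous_on m W c 0 1 HC). now apply Hphi.
      * intros x _. split; [apply smoothstep_derive|unfold dphi; cont].
    + apply ex_RInt_cont; [lra|]. intros x Hx. apply cont_mult; [unfold dphi; cont|].
      apply (cont_comp phi (speed m c)).
      * eapply is_derive_continuous. apply smoothstep_derive.
      * apply (speed_continuous_on m W c 0 1 HC). now apply Hphi.
  - intros x. rewrite Rmin_left, Rmax_right by lra. intros Hx.
    transitivity (Rabs (dphi x) * speed m c (phi x)).
    { apply (speed_comp m c phi x (dphi x)); [apply smoothstep_derive|apply HC, Hphi; lra|apply HC, Hphi; lra]. }
    rewrite Rabs_left1; [unfold opp, scal; simpl; unfold mult; simpl; ring|].
    unfold dphi. replace (6 * (-1 * x + 1) - 6 * (-1 * x + 1) ^ 2) with (6 * x * (1 - x)) by ring.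
    assert (0 <= x * (1 - x)) by (apply Rmult_le_pos; lra). lra.
Qed.

Lemma dist_sym (x y : pt) : dist m x y = dist m y x.
Proof. apply Rle_antisym; apply dist_sym_le. Qed.

Lemma dist_triangle (x y z : pt) : dist m x z <= dist m x y + dist m y z.
Proof.
  apply Rnot_lt_le. intros Hlt.
  set (e := (dist m x z - (dist m x y + dist m y z)) / 2).
  destruct (dist_approx m W x y (dist m x y + e)) as [c1 (C1 & A1 & B1 & L1)]; [unfold e; lra|].
  destruct (dist_approx m W y z (dist m y z + e)) as [c2 (C2 & A2 & B2 & L2)]; [unfold e; lra|].
  (* Both halves arrive at and leave [y] with zero velocity, hence the joined curve is C^1 at
     1/2. *)
  set (g1 := fun t => c1 (0 + (1 - 0) * smoothstep (2 * t + 0))).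
  set (g2 := fun t => c2 (0 + (1 - 0) * smoothstep (2 * t + -1))).
  set (c := fun t => if Rle_dec t (1/2) then g1 t else g2 t).
  assert (E1 : g1 (1/2) = y).
  { unfold g1, smoothstep. rewrite <- B1. f_equal. field. }
  assert (E2 : g2 (1/2) = y).
  { unfold g2, smoothstep. rewrite <- A2. f_equal. field. }
  assert (L1' : forall t, t < 1/2 -> locally t (fun s => g1 s = c s)).
  { intros t Ht. generalize (locally_interval (t - 1) (1/2) t ltac:(lra)). apply filter_imp.
    intros s Hs. unfold c. destruct Rle_dec; [easy|lra]. }
  assert (L2' : forall t, 1/2 < t -> locally t (fun s => g2 s = c s)).
  { intros t Ht. generalize (locally_interval (1/2) (t + 1) t ltac:(lra)). apply filter_imp.
    intros s Hs. unfold c. destruct Rle_dec; [lra|easy]. }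
  assert (HC : C1curve c).
  { intros t Ht. destruct (Rtotal_order t (1/2)) as [Hlt'|[->|Hgt]].
    - apply (C1_ext_loc g1 c t (L1' t Hlt')). apply (smooth_C1 c1 0 1 2 0 t); [lra|exact C1|lra].
    - destruct (smooth_C1 c1 0 1 2 0 (1/2) ltac:(lra) C1 ltac:(lra)) as (X1 & Y1 & U1 & V1).
      destruct (smooth_C1 c2 0 1 2 (-1) (1/2) ltac:(lra) C2 ltac:(lra)) as (X2 & Y2 & U2 & V2).
      assert (Z1 : Derive (cx g1) (1/2) = 0 /\ Derive (cy g1) (1/2) = 0).
      { destruct (is_derive_vel c1 (fun t => 0 + (1 - 0) * smoothstep (2 * t + 0)) (1/2) _
          (smoothstep_derive 0 (1-0) 2 0 (1/2))) as [P Q].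
        - apply C1. unfold smoothstep; lra.
        - apply C1. unfold smoothstep; lra.
        - split; [rewrite (is_derive_unique (cx g1) _ _ P)|rewrite (is_derive_unique (cy g1) _ _ Q)]; field. }
      assert (Z2 : Derive (cx g2) (1/2) = 0 /\ Derive (cy g2) (1/2) = 0).
      { destruct (is_derive_vel c2 (fun t => 0 + (1 - 0) * smoothstep (2 * t + -1)) (1/2) _
          (smoothstep_derive 0 (1-0) 2 (-1) (1/2))) as [P Q].
        - apply C2. unfold smoothstep; lra.
        - apply C2. unfold smoothstep; lra.
        - split; [rewrite (is_derive_unique (cx g2) _ _ P)|rewrite (is_derive_unique (cy g2) _ _ Q)]; field. }
      assert (Ex : forall t, cx c t = if Rle_dec t (1/2) then cx g1 t else cx g2 t).
      { intros t. unfold cx, c. now destruct Rle_dec. }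
      assert (Ey : forall t, cy c t = if Rle_dec t (1/2) then cy g1 t else cy g2 t).
      { intros t. unfold cy, c. now destruct Rle_dec. }
      destruct (C1_glue (cx g1) (cx g2) (1/2) 0) as [Gx Hx]; try tauto.
      { unfold cx. now rewrite E1, E2. }
      destruct (C1_glue (cy g1) (cy g2) (1/2) 0) as [Gy Hy]; try tauto.
      { unfold cy. now rewrite E1, E2. }
      repeat split.
      + eapply ex_derive_ext; [|exact Gx]. intros t. now rewrite Ex.
      + eapply ex_derive_ext; [|exact Gy]. intros t. now rewrite Ey.
      + eapply continuous_ext; [|exact Hx]. intros s. apply Derive_ext. intros t. now rewrite Ex.
      + eapply continuous_ext; [|exact Hy]. intros s. apply Derive_ext. intros t. now rewrite Ey.
    - apply (C1_ext_loc g2 c t (L2' t Hgt)). apply (smooth_C1 c2 0 1 2 (-1) t); [lra|exact C2|lra]. }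
  pose proof (dist_le_glength m W c HC) as HL.
  replace (c 0) with x in HL.
  2:{ unfold c. destruct Rle_dec; [|lra]. unfold g1, smoothstep. rewrite <- A1. f_equal. ring. }
  replace (c 1) with z in HL.
  2:{ unfold c. destruct Rle_dec; [lra|]. unfold g2, smoothstep. rewrite <- B2. f_equal. ring. }
  assert (HX : glength m c = glength m c1 + glength m c2); [|unfold e in *; lra].
  unfold glength. change (fun t => sqrt (gmet m (c t) (vel c t) (vel c t))) with (speed m c).
  change (fun t => sqrt (gmet m (c1 t) (vel c1 t) (vel c1 t))) with (speed m c1).
  change (fun t => sqrt (gmet m (c2 t) (vel c2 t) (vel c2 t))) with (speed m c2).
  rewrite <- (RInt_Chasles (speed m c) 0 (1/2) 1).
  2,3: apply ex_RInt_cont; [lra|]; intros u Hu; apply (speed_continuous_on m W c 0 1 HC); lra.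
  change (RInt (speed m c) 0 (1/2) + RInt (speed m c) (1/2) 1 = RInt (speed m c1) 0 1 + RInt (speed m c2) 0 1).
  f_equal.
  - rewrite <- (smooth_length c1 0 1 2 0 0 (1/2)) by (try exact C1; lra).
    apply RInt_ext. intros t. rewrite Rmin_left, Rmax_right by lra. intros Ht.
    symmetry. apply speed_ext_loc, L1'. lra.
  - rewrite <- (smooth_length c2 0 1 2 (-1) (1/2) 1) by (try exact C2; lra).
    apply RInt_ext. intros t. rewrite Rmin_left, Rmax_right by lra. intros Ht.
    symmetry. apply speed_ext_loc, L2'. lra.
Qed.

(** A rotation if [sg = 1], a reflection if [sg = -1]. *)
Definition ortho (al be sg : R) (p : pt) : pt :=
  (al * fst p - sg * be * snd p, be * fst p + sg * al * snd p).

Definition isortho (al be sg : R) : Prop := al ^ 2 + be ^ 2 = 1 /\ sg ^ 2 = 1.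

Lemma ortho_dot al be sg u v : isortho al be sg -> dot (ortho al be sg u) (ortho al be sg v) = dot u v.
Proof.
  intros [H1 H2]. unfold dot, ortho; simpl.
  transitivity ((al ^ 2 + be ^ 2) * (fst u * fst v) + sg ^ 2 * (al ^ 2 + be ^ 2) * (snd u * snd v)).
  - ring.
  - rewrite H1, H2. ring.
Qed.

Lemma ortho_gmet al be sg q u v : isortho al be sg ->
  gmet m (ortho al be sg q) (ortho al be sg u) (ortho al be sg v) = gmet m q u v.
Proof. intros H. unfold gmet. now rewrite !ortho_dot by exact H. Qed.

Lemma ortho_cancel al be sg p : isortho al be sg ->
  ortho al (- (sg * be)) sg (ortho al be sg p) = p.
Proof.
  intros [H1 H2]. destruct p as [x y]. unfold ortho; simpl. f_equal.
  - transitivity (x * (al ^ 2 + sg ^ 2 * be ^ 2) + y * sg * al * be * (sg ^ 2 - 1)); [ring|].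
    rewrite H2. transitivity (x * (al ^ 2 + be ^ 2)); [ring|rewrite H1; ring].
  - transitivity (y * sg ^ 2 * (al ^ 2 + be ^ 2)); [ring|rewrite H1, H2; ring].
Qed.

Lemma isortho_inv al be sg : isortho al be sg -> isortho al (- (sg * be)) sg.
Proof.
  intros [H1 H2]. split; [|easy]. transitivity (al ^ 2 + sg ^ 2 * be ^ 2); [ring|]. rewrite H2; lra.
Qed.

Lemma dist_ortho_le al be sg x y : isortho al be sg ->
  dist m (ortho al be sg x) (ortho al be sg y) <= dist m x y.
Proof.
  intros H. apply dist_ge; [exact W|]. intros c HC <- <-.
  set (c' := fun t => ortho al be sg (c t)).
  assert (D : forall t, 0 <= t <= 1 ->
    is_derive (cx c') t (al * Derive (cx c) t - sg * be * Derive (cy c) t) /\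
    is_derive (cy c') t (be * Derive (cx c) t + sg * al * Derive (cy c) t)).
  { intros t Ht. destruct (HC t Ht) as (X & Y & _ & _).
    apply Derive_correct in X. apply Derive_correct in Y. split.
    - apply (is_derive_minus (fun t => al * cx c t) (fun t => sg * be * cy c t)).
      + now apply (is_derive_scal (cx c)).
      + now apply (is_derive_scal (cy c)).
    - apply (is_derive_plus (fun t => be * cx c t) (fun t => sg * al * cy c t)).
      + now apply (is_derive_scal (cx c)).
      + now apply (is_derive_scal (cy c)). }
  (* [c] need not be differentiable outside [0, 1], so its image is taken after composition with
     [smoothstep]. *)
  assert (HC' : C1curve (fun t => c' (0 + (1 - 0) * smoothstep (1 * t + 0))) /\
    glength m c = glength m (fun t => c' (0 + (1 - 0) * smoothstep (1 * t + 0)))).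
  { set (d := fun t => c (0 + (1 - 0) * smoothstep (1 * t + 0))).
    set (d' := fun t => c' (0 + (1 - 0) * smoothstep (1 * t + 0))).
    assert (Dd : forall t, -1/2 < t < 3/2 ->
      is_derive (cx d') t (al * Derive (cx d) t - sg * be * Derive (cy d) t) /\
      is_derive (cy d') t (be * Derive (cx d) t + sg * al * Derive (cy d) t)).
    { intros t Ht. destruct (smooth_C1 c 0 1 1 0 t ltac:(lra) HC ltac:(lra)) as (X & Y & _ & _).
      apply Derive_correct in X. apply Derive_correct in Y. split.
      - apply (is_derive_minus (fun t => al * cx d t) (fun t => sg * be * cy d t)).
        + now apply (is_derive_scal (cx d)).
        + now apply (is_derive_scal (cy d)).
      - apply (is_derive_plus (fun t => be * cx d t) (fun t => sg * al * cy d t)).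
        + now apply (is_derive_scal (cx d)).
        + now apply (is_derive_scal (cy d)). }
    split.
    - intros t Ht. destruct (smooth_C1 c 0 1 1 0 t ltac:(lra) HC ltac:(lra)) as (X & Y & U & V).
      destruct (Dd t ltac:(lra)) as [P Q].
      pose proof (locally_interval (-1/2) (3/2) t ltac:(lra)) as L.
      repeat split; [eexists; exact P|eexists; exact Q| |].
      + apply (continuous_ext_loc _ (fun t => al * Derive (cx d) t - sg * be * Derive (cy d) t)).
        * revert L. apply filter_imp. intros s Hs. symmetry. now apply is_derive_unique, Dd.
        * cont; exact U || exact V.
      + apply (continuous_ext_loc _ (fun t => be * Derive (cx d) t + sg * al * Derive (cy d) t)).
        * revert L. apply filter_imp. intros s Hs. symmetry. now apply is_derive_unique, Dd.
        * cont; exact U || exact V.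
    - unfold glength.
      transitivity (RInt (speed m d) 0 1).
      + symmetry. apply (smooth_length c 0 1 1 0 0 1); try lra. exact HC.
      + apply RInt_ext. intros t. rewrite Rmin_left, Rmax_right by lra. intros Ht.
        destruct (Dd t ltac:(lra)) as [P Q]. unfold speed. f_equal.
        rewrite (vel_of _ _ _ _ P Q). symmetry.
        apply (ortho_gmet al be sg (d t) (vel d t) (vel d t) H). }
  destruct HC' as [HC' ->].
  pose proof (dist_le_glength m W _ HC') as HL. unfold c' in HL.
  replace (0 + (1 - 0) * smoothstep (1 * 0 + 0)) with 0 in HL by (unfold smoothstep; ring).
  replace (0 + (1 - 0) * smoothstep (1 * 1 + 0)) with 1 in HL by (unfold smoothstep; ring).
  exact HL.
Qed.

Lemma dist_ortho al be sg x y : isortho al be sg ->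
  dist m (ortho al be sg x) (ortho al be sg y) = dist m x y.
Proof.
  intros H. apply Rle_antisym; [now apply dist_ortho_le|].
  rewrite <- (ortho_cancel al be sg x H), <- (ortho_cancel al be sg y H) at 1.
  apply dist_ortho_le. now apply isortho_inv.
Qed.

End Warped.

(** * Crossing times, points in polar form, and first bounds on the distance *)

Lemma intermediate_value (f : R -> R) (a b y : R) : a <= b ->
  (forall x, a <= x <= b -> continuous f x) -> f a <= y <= f b ->
  exists x, a <= x <= b /\ f x = y.
Proof.
  intros Hab Hc Hy.
  destruct (IVT_gen_consistent (fun t => f (clip a b t)) a b y) as [x [Hx E]].
  - intros x. now apply clip_comp_continuous.
  - rewrite !clip_id by lra. rewrite Rmin_left, Rmax_right by lra. exact Hy.
  - rewrite Rmin_left, Rmax_right in Hx by lra. exists x. split; [easy|].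
    now rewrite clip_id in E by lra.
Qed.

Lemma last_crossing (f : R -> R) (a : R) :
  (forall x, 0 <= x <= 1 -> continuous f x) -> f 0 <= a <= f 1 ->
  exists t, 0 <= t <= 1 /\ f t = a /\ forall s, t <= s <= 1 -> a <= f s.
Proof.
  intros Hc Ha.
  set (E := fun t => 0 <= t <= 1 /\ f t <= a).
  destruct (completeness E) as [t [Hub Hl]].
  - exists 1. intros x [Hx _]. lra.
  - exists 0. split; lra.
  - assert (Ht : 0 <= t <= 1).
    { split; [apply Hub; split; lra|]. apply Hl. intros x [Hx _]; lra. }
    assert (Hge : forall s, t < s <= 1 -> a < f s).
    { intros s Hs. apply Rnot_le_lt. intros Hn. assert (s <= t); [|lra]. apply Hub. split; lra. }
    assert (Hft : f t = a).
    { apply Rle_antisym.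
      - apply Rnot_lt_le. intros Hlt.
        destruct (proj1 (continuous_eps f t) (Hc t Ht) (f t - a) ltac:(lra)) as [d [Hd1 Hd2]].
        assert (t <= t - d); [|lra]. apply Hl. intros x [Hx1 Hx2].
        apply Rnot_lt_le. intros Hn.
        assert (x <= t) by (apply Hub; split; lra).
        assert (Rabs (x - t) < d) by (apply Rabs_def1; lra).
        specialize (Hd2 x H0). apply Rabs_def2 in Hd2. lra.
      - apply Rnot_lt_le. intros Hlt. assert (t < 1).
        { destruct (Req_dec t 1) as [->|]; lra. }
        destruct (proj1 (continuous_eps f t) (Hc t Ht) (a - f t) ltac:(lra)) as [d [Hd1 Hd2]].
        set (s := Rmin 1 (t + d / 2)).
        assert (Hs : t < s <= 1 /\ s < t + d).
        { unfold s, Rmin. destruct Rle_dec; lra. }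
        specialize (Hge s ltac:(lra)).
        assert (Rabs (s - t) < d) by (apply Rabs_def1; lra).
        specialize (Hd2 s H0). apply Rabs_def2 in Hd2. lra. }
    exists t. repeat split; try easy. intros s Hs.
    destruct (Req_dec s t) as [->|]; [lra|]. apply Rlt_le, Hge. lra.
Qed.

Lemma RInt_le_increment (s G dG : R -> R) (a b : R) :
  a <= b -> (forall t, a <= t <= b -> continuous G t) ->
  (forall t, a < t < b -> is_derive G t (dG t)) ->
  (forall t, a <= t <= b -> continuous s t) ->
  (forall t, a < t < b -> s t <= dG t) -> RInt s a b <= G b - G a.
Proof.
  intros Hab HG HdG Hs Hle.
  assert (E : RInt s a b = - RInt (fun t => - s t) a b).
  { rewrite (RInt_opp s) by (now apply ex_RInt_cont). symmetry. exact (Ropp_involutive (RInt s a b)). }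
  pose proof (increment_le_RInt (fun t => - G t) (fun t => - dG t) (fun t => - s t) a b Hab) as H.
  cbv beta in H. rewrite E. assert (- G b - - G a <= RInt (fun t => - s t) a b); [|lra]. apply H.
  - intros. now apply cont_opp, HG.
  - intros t Ht. apply (is_derive_opp G). now apply HdG.
  - intros. now apply cont_opp, Hs.
  - intros t Ht. specialize (Hle t Ht). lra.
Qed.

Definition pol (r th : R) : pt := (r * cos th, r * sin th).

Lemma nrm_pol r th : 0 <= r -> nrm (pol r th) = r.
Proof.
  intros H. unfold nrm, dot, pol; simpl.
  replace (r * cos th * (r * cos th) + r * sin th * (r * sin th)) with (Rsqr r).
  - now apply sqrt_Rsqr.
  - pose proof (sin2_cos2 th) as E. unfold Rsqr in *.
    transitivity (r * r * (sin th * sin th + cos th * cos th)); [rewrite E|]; ring.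
Qed.

Lemma dot_pol r a s b : dot (pol r a) (pol s b) = r * s * cos (a - b).
Proof. unfold dot, pol; simpl. rewrite cos_minus. ring. Qed.

Lemma pol_surj (x : pt) : exists th, x = pol (nrm x) th.
Proof.
  destruct (Req_dec (nrm x) 0) as [H|H].
  - exists 0. rewrite H. unfold pol. rewrite (nrm0 x H). f_equal; ring.
  - assert (Hp : 0 < nrm x) by (pose proof (nrm_ge0 x); lra).
    set (c := fst x / nrm x). set (s := snd x / nrm x).
    assert (E : c * c + s * s = 1).
    { pose proof (nrm_sq x) as E. unfold dot in E. unfold c, s.
      transitivity ((fst x * fst x + snd x * snd x) / (nrm x * nrm x)); [field; lra|].
      rewrite <- E. field. lra. }
    assert (Hc : -1 <= c <= 1) by nra.
    assert (Hcs : cos (acos c) = c) by now apply cos_acos.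
    pose proof (acos_bound c) as HB.
    assert (Hs : sin (acos c) = Rabs s).
    { assert (0 <= sin (acos c)) by (apply sin_ge_0; lra).
      pose proof (sin2_cos2 (acos c)) as E2. rewrite Hcs in E2. unfold Rsqr in E2.
      assert (Rsqr (sin (acos c)) = Rsqr (Rabs s)).
      { rewrite <- Rsqr_abs. unfold Rsqr. lra. }
      apply Rsqr_inj; [lra|apply Rabs_pos|easy]. }
    destruct (Rle_dec 0 s) as [Hs0|Hs0].
    + exists (acos c). unfold pol. rewrite Hcs, Hs, Rabs_pos_eq by lra.
      destruct x as [a b]. unfold c, s. simpl fst; simpl snd. f_equal; field; lra.
    + exists (- acos c). unfold pol. rewrite cos_neg, sin_neg, Hcs, Hs, Rabs_left by lra.
      destruct x as [a b]. unfold c, s. simpl fst; simpl snd. f_equal; field; lra.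
Qed.

Lemma angle_in_0_PI (a : R) : exists b, 0 <= b <= PI /\ cos b = cos a /\ (sin b = sin a \/ sin b = - sin a).
Proof.
  exists (acos (cos a)). pose proof (COS_bound a). pose proof (acos_bound (cos a)) as HB.
  assert (Hc : cos (acos (cos a)) = cos a) by (apply cos_acos; lra).
  repeat split; try lra.
  pose proof (sin2_cos2 (acos (cos a))) as E. pose proof (sin2_cos2 a) as E2. rewrite Hc in E.
  apply Rsqr_eq. lra.
Qed.

Section Warped.
Context (m : R -> R) (W : warp m).

Lemma dist_split (c : R -> pt) (t : R) : C1curve c -> 0 <= t <= 1 ->
  dist m (c 0) (c t) + dist m (c t) (c 1) <= glength m c.
Proof.
  intros HC Ht.
  assert (HS : forall u, 0 <= u <= 1 -> continuous (speed m c) u) by now apply speed_continuous_on.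
  unfold glength. change (fun t => sqrt (gmet m (c t) (vel c t) (vel c t))) with (speed m c).
  rewrite <- (RInt_Chasles (speed m c) 0 t 1).
  2,3: apply ex_RInt_cont; [lra|]; intros; apply HS; lra.
  apply (Rplus_le_compat (dist m (c 0) (c t)) (RInt (speed m c) 0 t)).
  - apply dist_le_RInt_speed; [exact W|lra|]. intros u Hu. apply HC. lra.
  - apply dist_le_RInt_speed; [exact W|lra|]. intros u Hu. apply HC. lra.
Qed.

Lemma dist_le_edist (x y : pt) : dist m x y <= edist x y.
Proof.
  set (c := fun t : R => (fst x + t * (fst y - fst x), snd x + t * (snd y - snd x))).
  assert (Dx : forall t, is_derive (cx c) t (fst y - fst x)).
  { intros t. unfold cx, c; simpl. auto_derive; auto. ring. }
  assert (Dy : forall t, is_derive (cy c) t (snd y - snd x)).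
  { intros t. unfold cy, c; simpl. auto_derive; auto. ring. }
  assert (HC : C1curve c).
  { intros t _. split; [eexists; apply Dx|]. split; [eexists; apply Dy|]. split.
    - apply (continuous_ext (fun _ => fst y - fst x)); [|apply cont_const].
      intros s. symmetry. apply is_derive_unique, Dx.
    - apply (continuous_ext (fun _ => snd y - snd x)); [|apply cont_const].
      intros s. symmetry. apply is_derive_unique, Dy. }
  pose proof (dist_le_glength m W c HC) as HL.
  replace (c 0) with x in HL by (unfold c; destruct x; simpl; f_equal; ring).
  replace (c 1) with y in HL by (unfold c; destruct y; simpl; f_equal; ring).
  apply Rle_trans with (1 := HL).
  replace (edist x y) with (1 * edist x y - 0 * edist x y) by ring.
  apply (RInt_le_increment (speed m c) (fun t => t * edist x y) (fun _ => edist x y)); [lra| | | |].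
  - intros; cont.
  - intros. auto_derive; auto; ring.
  - now apply speed_continuous_on.
  - intros t _. unfold speed, edist. apply sqrt_le_1_alt.
    apply Rle_trans with (1 := gmet_le_dot m W _ _). rewrite (vel_of _ _ _ _ (Dx t) (Dy t)).
    unfold dot; simpl. apply Req_le. ring.
Qed.

Lemma dist_refl (x : pt) : dist m x x = 0.
Proof.
  apply Rle_antisym; [|apply dist_ge0, W]. apply Rle_trans with (1 := dist_le_edist x x).
  unfold edist. rewrite !Rminus_diag. replace (0 ^ 2 + 0 ^ 2) with 0 by ring. rewrite sqrt_0. lra.
Qed.

Lemma dot_le_speed (q v : pt) : Rabs (dot q v) <= nrm q * sqrt (gmet m q v v).
Proof.
  assert (H : (dot q v) ^ 2 <= nrm q ^ 2 * gmet m q v v).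
  { destruct (Req_dec (nrm q) 0) as [H|H].
    - rewrite (nrm0 q H). unfold dot; simpl. replace (nrm (0, 0)) with 0; [lra|]. unfold nrm, dot; simpl. now rewrite Rmult_0_l, Rplus_0_l, sqrt_0.
    - rewrite gmet_polar by easy. assert (0 < nrm q) by (pose proof (nrm_ge0 q); lra).
      replace (nrm q ^ 2 * (dot q v * dot q v / nrm q ^ 2 + m (nrm q) ^ 2 * (cross q v * cross q v) / nrm q ^ 4))
        with (dot q v ^ 2 + (m (nrm q) * cross q v / nrm q) ^ 2) by (field; lra).
      pose proof (pow2_ge_0 (m (nrm q) * cross q v / nrm q)). lra. }
  rewrite <- (sqrt_pow2 (nrm q)) by apply nrm_ge0.
  rewrite <- sqrt_mult by (apply pow2_ge_0 || apply gmet_ge0).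
  rewrite <- sqrt_Rsqr_abs. apply sqrt_le_1_alt. rewrite Rsqr_pow2. exact H.
Qed.

Lemma nrm_diff_le_dist (x y : pt) : nrm y - nrm x <= dist m x y.
Proof.
  apply dist_ge; [exact W|]. intros c HC <- <-.
  apply le_epsilon. intros d Hd.
  (* The norm is not differentiable at the pole, so it is smoothed by [d ^ 2], with [d] arbitrarily
     small. *)
  set (G := fun t => sqrt (dot (c t) (c t) + d ^ 2)).
  assert (HP : forall t, 0 < dot (c t) (c t) + d ^ 2).
  { intros t. pose proof (dot_self_ge0 (c t)). nra. }
  assert (DG : forall t, 0 <= t <= 1 -> is_derive G t (dot (c t) (vel c t) / G t)).
  { intros t Ht. destruct (HC t Ht) as (X & Y & _ & _).
    apply Derive_correct in X. apply Derive_correct in Y.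
    pose proof (HP t) as HPt. unfold G, dot in *. fold (cx c t) in *. fold (cy c t) in *.
    change (fun t => sqrt (fst (c t) * fst (c t) + snd (c t) * snd (c t) + d ^ 2))
      with (fun t => sqrt (cx c t * cx c t + cy c t * cy c t + d ^ 2)).
    change (fst (c t)) with (cx c t) in *. change (snd (c t)) with (cy c t) in *.
    assert (DD : is_derive (fun t => cx c t * cx c t + cy c t * cy c t + d ^ 2) t
       (2 * (cx c t * Derive (cx c) t + cy c t * Derive (cy c) t))).
    { auto_derive; [repeat split; eexists; eassumption|].
      change (Derive (fun x => cx c x) t) with (Derive (cx c) t).
      change (Derive (fun x => cy c x) t) with (Derive (cy c) t). ring. }
    evar_last; [apply (is_derive_comp sqrt (fun t => cx c t * cx c t + cy c t * cy c t + d ^ 2));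
      [apply is_derive_Reals, derivable_pt_lim_sqrt; exact HPt|exact DD]|].
    unfold scal, vel; simpl; unfold mult; simpl. field.
    apply Rgt_not_eq, sqrt_lt_R0. exact HPt. }
  assert (HL : G 1 - G 0 <= glength m c).
  { apply (increment_le_RInt G (fun t => dot (c t) (vel c t) / G t) (speed m c) 0 1); [lra| | | |].
    - intros t Ht. eapply is_derive_continuous, DG, Ht.
    - intros t Ht. apply DG. lra.
    - now apply speed_continuous_on.
    - intros t Ht. assert (0 < G t) by (apply sqrt_lt_R0, HP). apply Rle_div_l; [easy|].
      apply Rle_trans with (1 := Rle_abs _). apply Rle_trans with (1 := dot_le_speed _ _).
      rewrite Rmult_comm. apply Rmult_le_compat_l; [apply sqrt_pos|].
      unfold nrm, G. apply sqrt_le_1_alt. nra. }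
  assert (H1 : nrm (c 1) <= G 1) by (unfold nrm, G; apply sqrt_le_1_alt; nra).
  assert (H0 : G 0 <= nrm (c 0) + d).
  { pose proof (nrm_ge0 (c 0)). unfold G. rewrite <- (nrm_sq (c 0)).
    rewrite <- (sqrt_pow2 (nrm (c 0) + d)) by lra. apply sqrt_le_1_alt. nra. }
  lra.
Qed.

Lemma nrm_dist (x y : pt) : Rabs (nrm x - nrm y) <= dist m x y.
Proof.
  pose proof (nrm_diff_le_dist x y). pose proof (nrm_diff_le_dist y x).
  rewrite (dist_sym m W y x) in *. apply Rabs_le. lra.
Qed.

End Warped.

(** * Polar coordinates and calibration *)

Lemma cauchy_schwarz_unit (a b x y : R) : a ^ 2 + b ^ 2 = 1 -> a * x + b * y <= sqrt (x ^ 2 + y ^ 2).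
Proof.
  intros H. apply Rle_trans with (1 := Rle_abs _). rewrite <- sqrt_Rsqr_abs.
  apply sqrt_le_1_alt. unfold Rsqr.
  replace (x ^ 2 + y ^ 2) with ((a ^ 2 + b ^ 2) * (x ^ 2 + y ^ 2)) by (rewrite H; ring).
  pose proof (pow2_ge_0 (a * y - b * x)). nra.
Qed.

Lemma locally_pos (x : R) : 0 < x -> locally x (fun t => 0 < t).
Proof.
  intros H. generalize (locally_interval 0 (x + 1) x ltac:(lra)). apply filter_imp. intros; lra.
Qed.

Lemma is_derive_RInt_pos (f : R -> R) (a x : R) :
  (forall y, 0 < y -> continuous f y) -> 0 < a -> 0 < x -> is_derive (fun t => RInt f a t) x (f x).
Proof.
  intros H Ha Hx. apply (is_derive_RInt f (fun t => RInt f a t) a x); [|now apply H].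
  generalize (locally_pos x Hx). apply filter_imp. intros y Hy. apply (RInt_correct f).
  apply (ex_RInt_continuous f). intros z Hz. apply H.
  unfold Rmin in Hz. destruct Rle_dec; lra.
Qed.

Section Warped.
Context (m : R -> R) (W : warp m).

(** [dr/ds] along a geodesic with Clairaut constant [k]. *)
Definition jc (k x : R) : R := sqrt (1 - (k / m x) ^ 2).
Definition J (k a b : R) : R := RInt (jc k) a b.

Lemma jc_0 x : jc 0 x = 1.
Proof. unfold jc, Rdiv. rewrite Rmult_0_l. replace (1 - 0 ^ 2) with 1 by ring. apply sqrt_1. Qed.

Lemma J_0 a b : J 0 a b = b - a.
Proof.
  unfold J. rewrite (RInt_ext _ (fun _ => 1)) by (intros; apply jc_0).
  rewrite RInt_const. unfold scal; simpl; unfold mult; simpl. ring.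
Qed.

Lemma jc_continuous k x : 0 < x -> continuous (jc k) x.
Proof.
  intros H. unfold jc. apply cont_sqrt, cont_minus; [apply cont_const|]. apply cont_pow.
  apply cont_div; [apply cont_const|now apply m_continuous|]. pose proof (warp_pos m W x H). lra.
Qed.

Lemma jc_ge0 k x : 0 <= jc k x.
Proof. apply sqrt_pos. Qed.

Lemma jc_le1 k x : jc k x <= 1.
Proof.
  unfold jc. rewrite <- sqrt_1 at 2. apply sqrt_le_1_alt. pose proof (pow2_ge_0 (k / m x)). lra.
Qed.

Lemma is_derive_J k a x : 0 < a -> 0 < x -> is_derive (J k a) x (jc k x).
Proof. intros. apply is_derive_RInt_pos; auto. intros; now apply jc_continuous. Qed.

Lemma ex_RInt_jc k a b : 0 < a -> 0 < b -> ex_RInt (jc k) a b.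
Proof.
  intros Ha Hb. apply (ex_RInt_continuous (jc k)). intros z Hz. apply jc_continuous.
  unfold Rmin in Hz. destruct Rle_dec; lra.
Qed.

Lemma J_point k a : J k a a = 0.
Proof. apply (RInt_point a (jc k)). Qed.

Lemma J_chasles k a b c : 0 < a -> 0 < b -> 0 < c -> J k a b + J k b c = J k a c.
Proof. intros. apply (RInt_Chasles (jc k) a b c); now apply ex_RInt_jc. Qed.

Lemma J_ge0 k a b : 0 < a <= b -> 0 <= J k a b.
Proof. intros H. apply RInt_ge_0; [lra|apply ex_RInt_jc; lra|intros; apply jc_ge0]. Qed.

(** The tool for upper bounds: a function [s] growing at least as fast as the arc length replaces
    the evaluation of a length integral. *)
Lemma polar_path_le (rr drr th dth s ds : R -> R) (a b : R) : a <= b ->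
  (forall t, a <= t <= b ->
     locally t (fun u => 0 < rr u /\ is_derive rr u (drr u) /\ is_derive th u (dth u))) ->
  (forall t, a <= t <= b -> continuous drr t /\ continuous dth t) ->
  (forall t, a <= t <= b -> continuous s t) ->
  (forall t, a < t < b -> is_derive s t (ds t)) ->
  (forall t, a < t < b -> sqrt (drr t ^ 2 + (m (rr t) * dth t) ^ 2) <= ds t) ->
  dist m (pol (rr a) (th a)) (pol (rr b) (th b)) <= s b - s a.
Proof.
  intros Hab HL HC Hs Hds Hle.
  set (c := fun t => pol (rr t) (th t)).
  set (dx := fun t => drr t * cos (th t) - rr t * dth t * sin (th t)).
  set (dy := fun t => drr t * sin (th t) + rr t * dth t * cos (th t)).
  assert (D : forall t, is_derive rr t (drr t) -> is_derive th t (dth t) ->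
    is_derive (cx c) t (dx t) /\ is_derive (cy c) t (dy t)).
  { intros t H1 H2. split.
    - evar_last; [apply (is_derive_mult rr (fun t => cos (th t)));
        [exact H1|apply (is_derive_comp cos th); [apply is_derive_cos|exact H2]|intros; apply Rmult_comm]|].
      unfold dx, plus, mult, scal; simpl; unfold mult; simpl. ring.
    - evar_last; [apply (is_derive_mult rr (fun t => sin (th t)));
        [exact H1|apply (is_derive_comp sin th); [apply is_derive_sin|exact H2]|intros; apply Rmult_comm]|].
      unfold dy, plus, mult, scal; simpl; unfold mult; simpl. ring. }
  assert (HP : forall t, a <= t <= b -> 0 < rr t /\ is_derive rr t (drr t) /\ is_derive th t (dth t)).
  { intros t Ht. exact (locally_singleton _ _ (HL t Ht)). }
  assert (C : C1on c a b).
  { intros t Ht. destruct (HP t Ht) as (P & H1 & H2). destruct (HC t Ht) as [H3 H4].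
    destruct (D t H1 H2) as [Dx Dy].
    assert (Hrc : continuous rr t) by (eapply is_derive_continuous, H1).
    assert (Htc : continuous th t) by (eapply is_derive_continuous, H2).
    assert (Hcos : continuous (fun t => cos (th t)) t) by (apply (cont_comp th cos); [exact Htc|apply cont_cos]).
    assert (Hsin : continuous (fun t => sin (th t)) t) by (apply (cont_comp th sin); [exact Htc|apply cont_sin]).
    repeat split; [eexists; exact Dx|eexists; exact Dy| |].
    - apply (continuous_ext_loc _ dx).
      + generalize (HL t Ht). apply filter_imp. intros u (_ & Hu1 & Hu2). symmetry.
        apply is_derive_unique, D; assumption.
      + unfold dx. cont.
    - apply (continuous_ext_loc _ dy).
      + generalize (HL t Ht). apply filter_imp. intros u (_ & Hu1 & Hu2). symmetry.
        apply is_derive_unique, D; assumption.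
      + unfold dy. cont. }
  apply Rle_trans with (RInt (speed m c) a b).
  { apply (dist_le_RInt_speed m W c a b Hab C). }
  apply (RInt_le_increment (speed m c) s ds a b Hab Hs Hds).
  - now apply speed_continuous_on.
  - intros t Ht. apply Rle_trans with (2 := Hle t Ht). apply Req_le. unfold speed. f_equal.
    destruct (HP t ltac:(lra)) as (P & H1 & H2). destruct (D t H1 H2) as [Dx Dy].
    assert (EN : nrm (c t) = rr t) by (unfold c; apply nrm_pol; lra).
    rewrite (vel_of _ _ _ _ Dx Dy). rewrite gmet_polar by (rewrite EN; lra).
    assert (E1 : dot (c t) (dx t, dy t) = rr t * drr t).
    { unfold dot, c, pol, dx, dy; simpl. pose proof (sin2_cos2 (th t)) as E. unfold Rsqr in E.
      transitivity (rr t * drr t * (sin (th t) * sin (th t) + cos (th t) * cos (th t))); [ring|rewrite E; ring]. }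
    assert (E2 : cross (c t) (dx t, dy t) = rr t ^ 2 * dth t).
    { unfold cross, c, pol, dx, dy; simpl. pose proof (sin2_cos2 (th t)) as E. unfold Rsqr in E.
      transitivity (rr t ^ 2 * dth t * (sin (th t) * sin (th t) + cos (th t) * cos (th t))); [ring|rewrite E; ring]. }
    rewrite E1, E2, EN. field. lra.
Qed.

Lemma dist_arc (r a b : R) : 0 <= r -> dist m (pol r a) (pol r b) <= m r * Rabs (a - b).
Proof.
  intros Hr.
  assert (H : forall a b, a <= b -> dist m (pol r a) (pol r b) <= m r * b - m r * a).
  { intros a' b' Hab. destruct (Req_dec r 0) as [->|Hn].
    - rewrite (warp_0 m W). unfold pol. rewrite !Rmult_0_l. rewrite dist_refl by exact W. lra.
    - apply (polar_path_le (fun _ => r) (fun _ => 0) (fun t => t) (fun _ => 1)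
        (fun t => m r * t) (fun _ => m r)); auto.
      + intros t _. apply filter_forall. intros u. split; [lra|]. split; [apply @is_derive_const|apply @is_derive_id].
      + intros t _. split; apply cont_const.
      + intros t _. cont.
      + intros t _. auto_derive; auto. ring.
      + intros t _. replace (0 ^ 2 + (m r * 1) ^ 2) with (Rsqr (m r)) by (unfold Rsqr; ring).
        rewrite sqrt_Rsqr; [lra|]. apply (m_ge0 m W); lra. }
  destruct (Rle_dec a b).
  - rewrite Rabs_left1 by lra. specialize (H a b r0). lra.
  - rewrite (dist_sym m W), Rabs_right by lra. specialize (H b a ltac:(lra)). lra.
Qed.

Definition ang_vel (c : R -> pt) (t : R) : R := cross (c t) (vel c t) / nrm (c t) ^ 2.
Definition rad_vel (c : R -> pt) (t : R) : R := dot (c t) (vel c t) / nrm (c t).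

Lemma C1on_cont c a b t : C1on c a b -> a <= t <= b ->
  continuous (cx c) t /\ continuous (cy c) t /\ continuous (fun s => nrm (c s)) t.
Proof.
  intros HC Ht. destruct (HC t Ht) as (X & Y & _ & _).
  apply (ex_derive_continuous (cx c)) in X. apply (ex_derive_continuous (cy c)) in Y.
  repeat split; auto. now apply nrm_curve_continuous.
Qed.

Lemma ang_vel_continuous c a b t : C1on c a b -> a <= t <= b -> nrm (c t) <> 0 ->
  continuous (ang_vel c) t.
Proof.
  intros HC Ht Hn. destruct (C1on_cont c a b t HC Ht) as (X & Y & N).
  destruct (HC t Ht) as (_ & _ & U & V).
  apply cont_div; [|now apply cont_pow|now apply pow_nonzero].
  unfold cross, vel; simpl. apply cont_minus; apply cont_mult; assumption.
Qed.

Lemma is_derive_nrm c a b t : C1on c a b -> a <= t <= b -> nrm (c t) <> 0 ->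
  is_derive (fun s => nrm (c s)) t (rad_vel c t).
Proof.
  intros HC Ht Hn. destruct (HC t Ht) as (X & Y & _ & _).
  assert (Hp : 0 < nrm (c t)) by (pose proof (nrm_ge0 (c t)); lra).
  assert (Hq : 0 < dot (c t) (c t)) by (rewrite <- nrm_sq; nra).
  change (fun s => nrm (c s)) with (fun s => sqrt (cx c s * cx c s + cy c s * cy c s)).
  assert (DD : is_derive (fun t => cx c t * cx c t + cy c t * cy c t) t
       (2 * (cx c t * Derive (cx c) t + cy c t * Derive (cy c) t))).
  { auto_derive; [repeat split; eassumption|].
    change (Derive (fun x => cx c x) t) with (Derive (cx c) t).
    change (Derive (fun x => cy c x) t) with (Derive (cy c) t). ring. }
  evar_last; [apply (is_derive_comp sqrt (fun t => cx c t * cx c t + cy c t * cy c t));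
      [apply is_derive_Reals, derivable_pt_lim_sqrt; exact Hq|exact DD]|].
  unfold scal, rad_vel, dot, vel; simpl; unfold mult; simpl.
  change (sqrt (cx c t * cx c t + cy c t * cy c t)) with (nrm (c t)).
  change (fst (c t)) with (cx c t). change (snd (c t)) with (cy c t). field. lra.
Qed.

(** A continuous choice of the angle along a curve avoiding the pole. It may leave [- PI, PI], so
    only its cosine is tied to the endpoints. *)
Lemma angular_lift c a b : a <= b -> C1on c a b -> (forall t, a <= t <= b -> nrm (c t) <> 0) ->
  exists L, L a = 0 /\ (forall t, a <= t <= b -> is_derive L t (ang_vel c t)) /\
    forall t, a <= t <= b -> dot (c a) (c t) = nrm (c a) * nrm (c t) * cos (L t).
Proof.
  intros Hab HC Hn.
  set (w := fun t => ang_vel c (clip a b t)).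
  assert (Hw : forall t, continuous w t).
  { intros t. apply clip_comp_continuous; [easy|]. intros x Hx. apply (ang_vel_continuous c a b); auto. }
  set (L := fun t => RInt w a t).
  assert (DL : forall t, a <= t <= b -> is_derive L t (ang_vel c t)).
  { intros t Ht. replace (ang_vel c t) with (w t) by (unfold w; now rewrite clip_id).
    now apply is_derive_RInt_cont. }
  exists L. split; [apply (RInt_point a w)|]. split; [exact DL|].
  (* (X, Y) is the direction of [c t] rotated back by the angle [L t]; its derivative vanishes. *)
  set (X := fun t => (cx c t * cos (L t) + cy c t * sin (L t)) / nrm (c t)).
  set (Y := fun t => (cy c t * cos (L t) - cx c t * sin (L t)) / nrm (c t)).
  assert (DXY : forall t, a <= t <= b -> is_derive X t 0 /\ is_derive Y t 0).
  { intros t Ht. destruct (HC t Ht) as (Hx & Hy & _ & _).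
    apply Derive_correct in Hx. apply Derive_correct in Hy.
    specialize (Hn t Ht). specialize (DL t Ht).
    pose proof (is_derive_nrm c a b t HC Ht Hn) as DN.
    assert (Dc : is_derive (fun t => cos (L t)) t (ang_vel c t * - sin (L t)))
      by (apply (is_derive_comp cos L); [apply is_derive_cos|exact DL]).
    assert (Ds : is_derive (fun t => sin (L t)) t (ang_vel c t * cos (L t)))
      by (apply (is_derive_comp sin L); [apply is_derive_sin|exact DL]).
    assert (NN : nrm (c t) * nrm (c t) = cx c t * cx c t + cy c t * cy c t) by apply nrm_sq.
    assert (N2 : cx c t * cx c t + cy c t * cy c t <> 0) by (rewrite <- NN; now apply Rmult_integral_contrapositive).
    assert (EA : ang_vel c t = (cx c t * Derive (cy c) t - cy c t * Derive (cx c) t) / (cx c t * cx c t + cy c t * cy c t)).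
    { unfold ang_vel. replace (nrm (c t) ^ 2) with (nrm (c t) * nrm (c t)) by ring. rewrite NN. reflexivity. }
    assert (ER : rad_vel c t / nrm (c t) = (cx c t * Derive (cx c) t + cy c t * Derive (cy c) t) / (cx c t * cx c t + cy c t * cy c t)).
    { rewrite <- NN. unfold rad_vel. change (dot (c t) (vel c t)) with (cx c t * Derive (cx c) t + cy c t * Derive (cy c) t).
      field. easy. }
    pose proof (is_derive_mult _ _ _ _ _ Hx Dc Rmult_comm) as D1.
    pose proof (is_derive_mult _ _ _ _ _ Hy Ds Rmult_comm) as D2.
    pose proof (is_derive_mult _ _ _ _ _ Hy Dc Rmult_comm) as D3.
    pose proof (is_derive_mult _ _ _ _ _ Hx Ds Rmult_comm) as D4.
    split.
    - evar_last; [apply (is_derive_div _ _ _ _ _ (is_derive_plus _ _ _ _ _ D1 D2) DN Hn)|].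
      unfold plus, mult; simpl.
      transitivity (((Derive (cx c) t + cy c t * ang_vel c t - cx c t * (rad_vel c t / nrm (c t))) * cos (L t)
        + (Derive (cy c) t - cx c t * ang_vel c t - cy c t * (rad_vel c t / nrm (c t))) * sin (L t)) / nrm (c t)).
      { field. easy. }
      rewrite EA, ER. field. split; easy.
    - evar_last; [apply (is_derive_div _ _ _ _ _ (is_derive_minus _ _ _ _ _ D3 D4) DN Hn)|].
      unfold plus, mult, minus, opp; simpl.
      transitivity (((Derive (cy c) t - cx c t * ang_vel c t - cy c t * (rad_vel c t / nrm (c t))) * cos (L t)
        - (Derive (cx c) t + cy c t * ang_vel c t - cx c t * (rad_vel c t / nrm (c t))) * sin (L t)) / nrm (c t)).
      { unfold plus, opp; simpl. field. easy. }
      rewrite EA, ER. field. split; easy. }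
  assert (L0 : L a = 0) by apply (RInt_point a w).
  assert (HXY : forall t, a <= t <= b -> X t = X a /\ Y t = Y a).
  { intros t Ht.
    assert (HH : forall F, (forall t, a <= t <= b -> is_derive F t 0) -> F t = F a).
    { intros F HF. apply Rle_antisym.
      - assert (- F a <= - F t); [|lra].
        apply (monotone_of_derive (fun t => - F t) (fun _ => 0)); [lra| | |intros; lra].
        + intros x Hx. apply cont_opp. eapply is_derive_continuous, HF. lra.
        + intros x Hx. replace 0 with (- 0) by ring. apply (is_derive_opp F), HF. lra.
      - apply (monotone_of_derive F (fun _ => 0)); [lra| | |intros; lra].
        + intros x Hx. eapply is_derive_continuous, HF. lra.
        + intros x Hx. apply HF. lra. }
    split; apply HH; intros; now apply DXY. }
  intros t Ht. destruct (HXY t Ht) as [EX EY].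
  assert (Xa : X a = cx c a / nrm (c a)) by (unfold X; rewrite L0, cos_0, sin_0; f_equal; ring).
  assert (Ya : Y a = cy c a / nrm (c a)) by (unfold Y; rewrite L0, cos_0, sin_0; f_equal; ring).
  pose proof (Hn a ltac:(lra)) as Na. pose proof (Hn t Ht) as Nt.
  assert (E1 : cx c a = nrm (c a) * X t) by (rewrite EX, Xa; field; easy).
  assert (E2 : cy c a = nrm (c a) * Y t) by (rewrite EY, Ya; field; easy).
  assert (NN : nrm (c t) * nrm (c t) = cx c t * cx c t + cy c t * cy c t) by apply nrm_sq.
  unfold dot. change (fst (c a)) with (cx c a). change (snd (c a)) with (cy c a).
  change (fst (c t)) with (cx c t). change (snd (c t)) with (cy c t).
  rewrite E1, E2. unfold X, Y.
  transitivity (nrm (c a) * ((cx c t * cx c t + cy c t * cy c t) / nrm (c t)) * cos (L t)).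
  - field. easy.
  - rewrite <- NN. field. easy.
Qed.

(** The form e1 k dtheta + e2 [jc k] dr is closed and has norm 1 where [k <= m], so its integral is
    a boundary term bounded by the length. The signs adapt it to the sense of rotation and to inward
    or outward motion. *)
Lemma calibration (c : R -> pt) (a b r0 k e1 e2 : R) (L : R -> R) : a <= b -> C1on c a b ->
  0 < r0 -> (forall t, a <= t <= b -> r0 <= nrm (c t)) -> 0 <= k <= m r0 ->
  e1 ^ 2 = 1 -> e2 ^ 2 = 1 -> (forall t, a <= t <= b -> is_derive L t (ang_vel c t)) ->
  e1 * k * (L b - L a) + e2 * (J k r0 (nrm (c b)) - J k r0 (nrm (c a))) <= RInt (speed m c) a b.
Proof.
  intros Hab HC Hr0 Hr Hk He1 He2 HL.
  set (G := fun t => e1 * k * L t + e2 * J k r0 (nrm (c t))).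
  replace (e1 * k * (L b - L a) + e2 * (J k r0 (nrm (c b)) - J k r0 (nrm (c a)))) with (G b - G a)
    by (unfold G; ring).
  assert (DG : forall t, a <= t <= b -> is_derive G t (e1 * k * ang_vel c t + e2 * (rad_vel c t * jc k (nrm (c t))))).
  { intros t Ht. pose proof (Hr t Ht).
    apply (is_derive_plus (fun t => e1 * k * L t) (fun t => e2 * J k r0 (nrm (c t)))).
    - apply (is_derive_scal L), HL, Ht.
    - apply (is_derive_scal (fun t => J k r0 (nrm (c t)))).
      apply (is_derive_comp (J k r0) (fun t => nrm (c t))); [apply is_derive_J; lra|].
      apply (is_derive_nrm c a b t HC Ht). lra. }
  apply (increment_le_RInt G (fun t => e1 * k * ang_vel c t + e2 * (rad_vel c t * jc k (nrm (c t)))) (speed m c) a b Hab).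
  - intros t Ht. eapply is_derive_continuous, DG, Ht.
  - intros t Ht. apply DG. lra.
  - now apply speed_continuous_on.
  - intros t Ht. pose proof (Hr t ltac:(lra)) as Hrt. unfold speed.
    set (r := nrm (c t)) in *.
    assert (Hm : k <= m r) by (pose proof (m_mono m W r0 r ltac:(lra)); lra).
    assert (Hmp : 0 < m r) by (apply (warp_pos m W); lra).
    assert (Hkm : 0 <= k / m r <= 1).
    { split; [apply Rdiv_le_0_compat; lra|]. apply Rle_div_l; lra. }
    rewrite gmet_polar by (fold r; lra). fold r.
    replace (dot (c t) (vel c t) * dot (c t) (vel c t) / r ^ 2 +
       m r ^ 2 * (cross (c t) (vel c t) * cross (c t) (vel c t)) / r ^ 4)
      with ((m r * ang_vel c t) ^ 2 + rad_vel c t ^ 2).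
    2:{ unfold ang_vel, rad_vel. fold r. field. lra. }
    replace (e1 * k * ang_vel c t + e2 * (rad_vel c t * jc k r)) with
      ((e1 * (k / m r)) * (m r * ang_vel c t) + (e2 * jc k r) * rad_vel c t) by (field; lra).
    apply cauchy_schwarz_unit.
    replace ((e1 * (k / m r)) ^ 2 + (e2 * jc k r) ^ 2) with (e1 ^ 2 * (k / m r) ^ 2 + e2 ^ 2 * (jc k r * jc k r)) by ring.
    rewrite He1, He2. unfold jc. rewrite sqrt_sqrt; [ring|]. nra.
Qed.

(** A curve of minimal radius [r0] is calibrated by the form [k dtheta + sqrt(1 - k^2/m^2) dr] for every
    [k <= m r0]. *)
Lemma dist_ge_calibrated (X Y : pt) (th l : R) : 0 < nrm X -> 0 < nrm Y -> 0 <= th <= PI ->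
  dot X Y = nrm X * nrm Y * cos th ->
  (forall r0, 0 <= r0 <= nrm X -> r0 <= nrm Y -> exists k, 0 <= k <= m r0 /\
     l <= k * th + J k r0 (nrm X) + J k r0 (nrm Y)) ->
  l <= dist m X Y.
Proof.
  intros HX HY Hth Hdot Hl. apply dist_ge; [exact W|]. intros c HC <- <-.
  assert (Hnc : forall t, 0 <= t <= 1 -> continuous (fun s => nrm (c s)) t).
  { intros t Ht. apply (C1on_cont c 0 1 t HC Ht). }
  destruct (continuity_ab_min (fun t => nrm (c t)) 0 1 ltac:(lra)) as [t0 [Hmin Ht0]].
  { intros t Ht. apply continuity_pt_filterlim. now apply Hnc. }
  set (r0 := nrm (c t0)) in *.
  destruct (Hl r0) as [k [Hk Hlk]].
  { split; [apply nrm_ge0|apply Hmin; lra]. }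
  { apply Hmin; lra. }
  apply Rle_trans with (1 := Hlk).
  destruct (Req_dec r0 0) as [E0|E0].
  (* No angle can be followed through the pole, but then [k] is 0 and the two radial distances
     suffice. *)
  - rewrite E0, (warp_0 m W) in Hk. replace k with 0 by lra. rewrite !J_0, E0.
    pose proof (dist_split m W c t0 HC Ht0).
    pose proof (nrm_diff_le_dist m W (c t0) (c 0)). pose proof (nrm_diff_le_dist m W (c t0) (c 1)).
    rewrite (dist_sym m W (c t0) (c 0)) in *. fold r0 in H0, H1. rewrite E0 in *. lra.
  - assert (Hr0 : 0 < r0) by (pose proof (nrm_ge0 (c t0)); unfold r0 in *; lra).
    destruct (angular_lift c 0 1 ltac:(lra) HC) as [L (L0 & DL & HL)].
    { intros t Ht. specialize (Hmin t Ht). lra. }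
    specialize (HL 1 ltac:(lra)). rewrite Hdot in HL.
    assert (Hcos : cos (L 1) = cos th).
    { apply Rmult_eq_reg_l with (nrm (c 0) * nrm (c 1)); [easy|]. nra. }
    (* The curve may wind around the pole, but [th] is the smallest absolute angle with its
       cosine. *)
    assert (HLth : th <= Rabs (L 1)).
    { apply Rnot_lt_le. intros Hlt. pose proof (Rabs_pos (L 1)).
      pose proof (cos_decreasing_1 (Rabs (L 1)) th ltac:(lra) ltac:(lra) ltac:(lra) ltac:(lra) Hlt).
      rewrite <- Hcos in H0. unfold Rabs in H0. destruct Rcase_abs; [rewrite cos_neg in H0|]; lra. }
    set (e := if Rle_dec 0 (L 1) then 1 else -1).
    assert (He : e ^ 2 = 1) by (unfold e; destruct Rle_dec; ring).
    assert (HeL : e * L 1 = Rabs (L 1)).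
    { unfold e. destruct Rle_dec; [rewrite Rabs_right|rewrite Rabs_left]; lra. }
    assert (C1 : C1on c 0 t0) by (intros t Ht; apply HC; lra).
    assert (C2 : C1on c t0 1) by (intros t Ht; apply HC; lra).
    (* The radial sign changes at the time [t0] of minimal radius: inward before it, outward after
       it. Hence both [J] terms enter with a plus. *)
    pose proof (calibration c 0 t0 r0 k e (-1) L ltac:(lra) C1 Hr0
      ltac:(intros; apply Hmin; lra) Hk He ltac:(ring) ltac:(intros; apply DL; lra)) as H1.
    pose proof (calibration c t0 1 r0 k e 1 L ltac:(lra) C2 Hr0
      ltac:(intros; apply Hmin; lra) Hk He ltac:(ring) ltac:(intros; apply DL; lra)) as H2.
    fold r0 in H1, H2. rewrite J_point in H1, H2.
    unfold glength. change (fun t => sqrt (gmet m (c t) (vel c t) (vel c t))) with (speed m c).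
    assert (HS : forall u, 0 <= u <= 1 -> continuous (speed m c) u) by now apply speed_continuous_on.
    rewrite <- (RInt_Chasles (speed m c) 0 t0 1).
    2,3: apply ex_RInt_cont; [lra|]; intros; apply HS; lra.
    assert (k * th <= k * (e * L 1)) by (rewrite HeL; apply Rmult_le_compat_l; lra).
    change (k * th + J k r0 (nrm (c 0)) + J k r0 (nrm (c 1)) <= RInt (speed m c) 0 t0 + RInt (speed m c) t0 1).
    rewrite L0 in H1. lra.
Qed.

End Warped.

(** * Symmetries, and monotonicity of the distance in the angle *)

Definition rotate (phi : R) : pt -> pt := ortho (cos phi) (sin phi) 1.
Definition reflect (phi : R) : pt -> pt := ortho (cos (2 * phi)) (sin (2 * phi)) (-1).

Lemma rotate_iso phi : isortho (cos phi) (sin phi) 1.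
Proof. split; [|ring]. pose proof (sin2_cos2 phi) as E. unfold Rsqr in E. lra. Qed.

Lemma reflect_iso phi : isortho (cos (2 * phi)) (sin (2 * phi)) (-1).
Proof. split; [|ring]. pose proof (sin2_cos2 (2 * phi)) as E. unfold Rsqr in E. lra. Qed.

Lemma rotate_pol phi r a : rotate phi (pol r a) = pol r (a + phi).
Proof. unfold rotate, ortho, pol; simpl. rewrite cos_plus, sin_plus. f_equal; ring. Qed.

Lemma reflect_pol phi r a : reflect phi (pol r a) = pol r (2 * phi - a).
Proof. unfold reflect, ortho, pol; simpl. rewrite cos_minus, sin_minus. f_equal; ring. Qed.

Lemma fst_le_nrm (x : pt) : fst x <= nrm x.
Proof.
  destruct (pol_surj x) as [a Ha]. rewrite Ha at 1. unfold pol; simpl.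
  pose proof (COS_bound a). pose proof (nrm_ge0 x). nra.
Qed.

Lemma pol_cos_eq r a b : cos a = cos b -> pol r a = pol r b \/ pol r a = pol r (- b).
Proof.
  intros H. assert (Hs : Rsqr (sin a) = Rsqr (sin b)).
  { pose proof (sin2_cos2 a). pose proof (sin2_cos2 b). rewrite H in H0. lra. }
  apply Rsqr_eq in Hs. unfold pol. rewrite cos_neg, sin_neg.
  destruct Hs as [-> | ->]; [left|right]; now rewrite H.
Qed.

Section Warped.
Context (m : R -> R) (W : warp m).

Lemma dist_rotate phi x y : dist m (rotate phi x) (rotate phi y) = dist m x y.
Proof. apply (dist_ortho m W), rotate_iso. Qed.

Lemma dist_reflect phi x y : dist m (reflect phi x) (reflect phi y) = dist m x y.
Proof. apply (dist_ortho m W), reflect_iso. Qed.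

Lemma dist_pol_shift phi r a s b :
  dist m (pol r (a + phi)) (pol s (b + phi)) = dist m (pol r a) (pol s b).
Proof. now rewrite <- !rotate_pol, dist_rotate. Qed.

Lemma dist_pol_flip r a s b : dist m (pol r (- a)) (pol s (- b)) = dist m (pol r a) (pol s b).
Proof.
  rewrite <- (dist_reflect 0 (pol r a) (pol s b)), !reflect_pol. do 2 f_equal; ring.
Qed.

Lemma dist_pol_diff r a s b : dist m (pol r a) (pol s b) = dist m (pol r 0) (pol s (b - a)).
Proof. rewrite <- (dist_pol_shift (- a) r a s b). f_equal; f_equal; ring. Qed.

Lemma dist_pol_cos r s a b : cos a = cos b -> dist m (pol r 0) (pol s a) = dist m (pol r 0) (pol s b).
Proof.
  intros H. destruct (pol_cos_eq s a b H) as [-> | ->]; [easy|].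
  rewrite <- (dist_pol_flip r 0 s b). now rewrite Ropp_0.
Qed.

(** With angles [a <= b] in [0, PI], a curve to the farther point crosses the line of direction (a +
    b) / 2. Reflecting the rest of it in that line leads to the nearer point at the same length. *)
Lemma dist_pol_mono r s a b : 0 <= r -> 0 <= s -> cos b <= cos a ->
  dist m (pol r 0) (pol s a) <= dist m (pol r 0) (pol s b).
Proof.
  intros Hr Hs Hab.
  destruct (angle_in_0_PI a) as [a' (Ha' & Ca & _)]. destruct (angle_in_0_PI b) as [b' (Hb' & Cb & _)].
  rewrite <- (dist_pol_cos r s a' a Ca), <- (dist_pol_cos r s b' b Cb).
  assert (Hle : a' <= b').
  { apply Rnot_lt_le. intros Hlt. pose proof (cos_decreasing_1 b' a' ltac:(lra) ltac:(lra) ltac:(lra) ltac:(lra) Hlt). lra. }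
  clear a b Hab Ca Cb. rename a' into a. rename b' into b.
  apply dist_ge; [exact W|]. intros c HC H0 H1.
  set (be := (a + b) / 2).
  set (h := fun t => cos be * cy c t - sin be * cx c t).
  destruct (intermediate_value h 0 1 0) as [t [Ht Eh]]; [lra| | |].
  - intros x Hx. destruct (C1on_cont c 0 1 x HC Hx) as (X & Y & _). unfold h. cont.
  - unfold h, cx, cy. rewrite H0, H1. unfold pol; simpl. rewrite cos_0, sin_0.
    assert (0 <= sin be) by (apply sin_ge_0; unfold be; lra).
    assert (0 <= sin (b - be)) by (apply sin_ge_0; unfold be; lra).
    rewrite sin_minus in *. split; nra.
  - pose proof (dist_split m W c t HC Ht) as HS. rewrite H0, H1 in HS.
    apply Rle_trans with (2 := HS). apply Rle_trans with (1 := dist_triangle m W _ (c t) _).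
    apply Rplus_le_compat_l.
    rewrite <- (dist_reflect be (c t) (pol s b)).
    rewrite reflect_pol. replace (2 * be - b) with a by (unfold be; field).
    apply Req_le. f_equal.
    unfold reflect, ortho. unfold h, cx, cy in Eh. destruct (c t) as [x y]; simpl in *.
    pose proof (sin2_cos2 be) as E. unfold Rsqr in E.
    rewrite cos_2a, sin_2a. f_equal.
    + transitivity (x * (sin be * sin be + cos be * cos be) + 2 * sin be * (cos be * y - sin be * x));
        [rewrite E, Eh; ring|ring].
    + transitivity (y * (sin be * sin be + cos be * cos be) - 2 * cos be * (cos be * y - sin be * x));
        [rewrite E, Eh; ring|ring].
Qed.

(** Every curve from [pol r 0] to a point beyond the barrier [x |-> pol x (S x)] meets the barrier or its
    mirror image. *)
Lemma barrier (S : R -> R) (rho r R th k : R) : 0 < rho -> 0 <= r <= rho -> rho <= R ->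
  (forall x, rho <= x -> continuous S x) -> S rho = 0 ->
  (forall x, rho <= x -> dist m (pol rho 0) (pol x (S x)) + k <= dist m (pol r 0) (pol x (S x))) ->
  cos (S R) <= cos th ->
  dist m (pol rho 0) (pol R th) + k <= dist m (pol r 0) (pol R th).
Proof.
  intros Hrho Hr HR HS S0 Hk Hth. apply dist_ge; [exact W|]. intros c HC H0 H1.
  assert (Hnc : forall t, 0 <= t <= 1 -> continuous (fun s => nrm (c s)) t).
  { intros t Ht. apply (C1on_cont c 0 1 t HC Ht). }
  (* After its last visit to the circle of radius [rho] the curve stays where the barrier is
     defined. *)
  destruct (last_crossing (fun t => nrm (c t)) rho Hnc) as [t0 (Ht0 & E0 & Hge)].
  { rewrite H0, H1, !nrm_pol by lra. lra. }
  (* A zero of [h] says that the angle has the cosine of the barrier angle at that radius: the point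
     lies on the barrier or on its mirror image. *)
  set (h := fun t => cx c t - nrm (c t) * cos (S (nrm (c t)))).
  destruct (intermediate_value h t0 1 0) as [t [Ht Eh]]; [lra| | |].
  - intros x Hx. destruct (C1on_cont c 0 1 x HC ltac:(lra)) as (X & _ & N).
    unfold h. apply cont_minus; [exact X|]. apply cont_mult; [exact N|].
    apply (cont_comp (fun t => S (nrm (c t))) cos); [|apply cont_cos].
    apply (cont_comp (fun t => nrm (c t)) S); [exact N|]. apply HS, Hge. lra.
  - unfold h. rewrite E0, S0, cos_0, H1, nrm_pol by lra.
    split.
    + unfold cx. pose proof (fst_le_nrm (c t0)). rewrite E0 in H. lra.
    + unfold cx. rewrite H1. unfold pol; simpl. assert (0 <= R * (cos th - cos (S R))) by (apply Rmult_le_pos; lra). lra.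
  - pose proof (dist_split m W c t HC ltac:(lra)) as HSp. rewrite H0, H1 in HSp.
    apply Rle_trans with (2 := HSp). specialize (Hge t Ht).
    set (x := nrm (c t)) in *.
    assert (Hz : forall r, dist m (pol r 0) (c t) = dist m (pol r 0) (pol x (S x))).
    { intros r'. destruct (pol_surj (c t)) as [a Ha]. fold x in Ha. rewrite Ha.
      apply dist_pol_cos. unfold h, cx in Eh. rewrite Ha in Eh. rewrite <- Ha in Eh. fold x in Eh.
      rewrite Ha in Eh. unfold pol in Eh; simpl in Eh.
      apply Rmult_eq_reg_l with x; lra. }
    specialize (Hk x Hge). rewrite Hz.
    pose proof (dist_triangle m W (pol rho 0) (c t) (pol R th)). rewrite Hz in H. lra.
Qed.

End Warped.

(** * Geodesics of given Clairaut constant *)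

Lemma atan_nonneg_le (x : R) : 0 <= x -> 0 <= atan x <= x.
Proof.
  intros Hx. split.
  - rewrite <- atan_0. destruct (Req_dec x 0) as [->|]; [lra|]. apply Rlt_le, atan_increasing. lra.
  - assert (0 - atan 0 <= x - atan x); [|rewrite atan_0 in H; lra].
    apply (monotone_of_derive (fun t => t - atan t) (fun t => 1 - / (1 + t²))); [lra| | |].
    + intros t _. apply cont_minus; [apply cont_id|apply cont_atan].
    + intros t _. auto_derive; auto. unfold Rsqr. field. nra.
    + intros t _. assert (/ (1 + t²) <= 1); [|lra]. rewrite <- Rinv_1. apply Rinv_le_contravar; [lra|].
      unfold Rsqr. nra.
Qed.

Section Warped.
Context (m : R -> R) (W : warp m).

(** If [m' = a] is constant, then [Af c / a] and [La c / a] are antiderivatives of the angle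
    [c / (m * qf c)] and of [jc c]. *)
Definition qf (c x : R) : R := sqrt (m x ^ 2 - c ^ 2).
Definition Af (c x : R) : R := atan (qf c x / c).
Definition La (c x : R) : R := qf c x - c * Af c x.
(** The gap between [Af] and its limit PI / 2, in the form that shows its decay like c / [qf]. *)
Definition xi (c x : R) : R := atan (c / qf c x).

Lemma qf_ge0 c x : 0 <= qf c x.
Proof. apply sqrt_pos. Qed.

Lemma qf_sq c x : 0 <= c <= m x -> qf c x * qf c x = m x ^ 2 - c ^ 2.
Proof. intros H. apply sqrt_sqrt. nra. Qed.

Lemma qf_pos c x : 0 <= c < m x -> 0 < qf c x.
Proof. intros H. apply sqrt_lt_R0. nra. Qed.

Lemma qf_le c x : 0 <= c <= m x -> qf c x <= m x.
Proof.
  intros H. rewrite <- (sqrt_pow2 (m x)) by lra. apply sqrt_le_1_alt. nra.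
Qed.

Lemma qf_mono_c c c' x : 0 <= c <= c' -> qf c' x <= qf c x.
Proof. intros H. apply sqrt_le_1_alt. nra. Qed.

Lemma qf_mono c x y : 0 <= x <= y -> qf c x <= qf c y.
Proof.
  intros H. apply sqrt_le_1_alt. pose proof (m_mono m W x y H). pose proof (m_ge0 m W x ltac:(lra)). nra.
Qed.

Lemma qf_eq0 c x : m x = c -> qf c x = 0.
Proof. intros <-. unfold qf. rewrite Rminus_diag. apply sqrt_0. Qed.

Lemma qf_continuous c x : continuous (qf c) x.
Proof. unfold qf. apply cont_sqrt, cont_minus; [apply cont_pow, m_continuous, W|apply cont_const]. Qed.

Lemma Af_continuous c x : continuous (Af c) x.
Proof.
  unfold Af. apply (cont_comp (fun x => qf c x / c) atan); [|apply cont_atan].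
  apply cont_mult; [apply qf_continuous|apply cont_const].
Qed.

Lemma La_continuous c x : continuous (La c) x.
Proof. unfold La. pose proof (qf_continuous c x). pose proof (Af_continuous c x). cont. Qed.

Lemma jc_qf c x : 0 < m x -> 0 <= c <= m x -> jc m c x = qf c x / m x.
Proof.
  intros H Hc. unfold jc, qf.
  replace (1 - (c / m x) ^ 2) with ((m x ^ 2 - c ^ 2) / m x ^ 2) by (field; lra).
  rewrite sqrt_div_alt by nra. f_equal. apply sqrt_pow2. lra.
Qed.

Lemma is_derive_qf c x : 0 <= c < m x -> is_derive (qf c) x (m x * Derive m x / qf c x).
Proof.
  intros H. unfold qf at 1.
  assert (D : is_derive (fun x => m x ^ 2 - c ^ 2) x (2 * m x * Derive m x)).
  { pose proof (warp_derive m W x) as Dm. auto_derive; [now exists (Derive m x)|].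
    change (Derive (fun x => m x) x) with (Derive m x). ring. }
  evar_last; [apply (is_derive_comp sqrt (fun x => m x ^ 2 - c ^ 2));
    [apply is_derive_Reals, derivable_pt_lim_sqrt; nra|exact D]|].
  unfold scal; simpl; unfold mult; simpl.
  change (sqrt (m x * (m x * 1) - c * (c * 1))) with (qf c x). field.
  pose proof (qf_pos c x H). lra.
Qed.

Lemma is_derive_Af c x : 0 <= c < m x -> is_derive (Af c) x (c * Derive m x / (m x * qf c x)).
Proof.
  intros H. pose proof (qf_pos c x H) as Hq. pose proof (qf_sq c x ltac:(lra)) as E.
  destruct (Req_dec c 0) as [->|Hc].
  - apply (is_derive_ext (fun _ => 0)).
    { intros t. unfold Af, Rdiv. now rewrite Rinv_0, Rmult_0_r, atan_0. }
    replace (0 * Derive m x / (m x * qf 0 x)) with 0 by (unfold Rdiv; ring). apply @is_derive_const.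
  - assert (D : is_derive (fun x => qf c x / c) x (m x * Derive m x / qf c x / c)).
    { apply (is_derive_ext (fun x => / c * qf c x)); [intros; apply Rmult_comm|].
      replace (m x * Derive m x / qf c x / c) with (/ c * (m x * Derive m x / qf c x)) by (unfold Rdiv; ring).
      now apply (is_derive_scal (qf c)), is_derive_qf. }
    evar_last; [apply (is_derive_comp atan (fun x => qf c x / c)); [apply is_derive_atan|exact D]|].
    unfold scal, Rsqr; simpl; unfold mult; simpl.
    replace (1 + qf c x / c * (qf c x / c)) with ((c ^ 2 + qf c x * qf c x) / c ^ 2) by (field; lra).
    rewrite E. replace (c ^ 2 + (m x ^ 2 - c ^ 2)) with (m x ^ 2) by ring. field. lra.
Qed.

Lemma is_derive_La c x : 0 <= c < m x -> is_derive (La c) x (Derive m x * jc m c x).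
Proof.
  intros H. pose proof (qf_pos c x H) as Hq. pose proof (qf_sq c x ltac:(lra)) as E.
  evar_last; [apply (is_derive_minus (qf c) (fun x => c * Af c x));
    [now apply is_derive_qf|now apply (is_derive_scal (Af c)), is_derive_Af]|].
  rewrite jc_qf by lra. unfold minus, plus, opp; simpl.
  transitivity (Derive m x * ((m x ^ 2 - c ^ 2) / (m x * qf c x))); [field; lra|].
  rewrite <- E. field. lra.
Qed.

Lemma Af_range c x : 0 <= c -> 0 <= Af c x <= PI / 2.
Proof.
  intros H. unfold Af. pose proof (atan_bound (qf c x / c)). split; [|lra].
  apply atan_nonneg_le. destruct (Req_dec c 0) as [->|].
  - unfold Rdiv. rewrite Rinv_0. lra.
  - apply Rdiv_le_0_compat; [apply qf_ge0|lra].
Qed.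

Lemma Af_xi c x : 0 < c < m x -> Af c x = PI / 2 - xi c x.
Proof.
  intros H. pose proof (qf_pos c x ltac:(lra)). unfold Af, xi.
  replace (qf c x / c) with (/ (c / qf c x)) by (field; lra).
  apply atan_inv. apply Rdiv_lt_0_compat; lra.
Qed.

Lemma xi_range c x : 0 <= c < m x -> 0 <= xi c x <= c / qf c x.
Proof.
  intros H. pose proof (qf_pos c x H). apply atan_nonneg_le. apply Rdiv_le_0_compat; lra.
Qed.

Lemma La_ge0 c x : 0 <= c -> 0 <= La c x.
Proof.
  intros H. unfold La, Af. destruct (Req_dec c 0) as [->|].
  - rewrite Rmult_0_l, Rminus_0_r. apply qf_ge0.
  - assert (0 <= qf c x / c) by (apply Rdiv_le_0_compat; [apply qf_ge0|lra]).
    pose proof (atan_nonneg_le (qf c x / c) ltac:(easy)).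
    assert (c * atan (qf c x / c) <= c * (qf c x / c)) by (apply Rmult_le_compat_l; lra).
    replace (c * (qf c x / c)) with (qf c x) in * by (field; lra). lra.
Qed.

Lemma La_eq0 c x : m x = c -> La c x = 0.
Proof.
  intros H. unfold La, Af. rewrite qf_eq0 by easy. unfold Rdiv. rewrite Rmult_0_l, atan_0. ring.
Qed.

(** A concave nondecreasing function that is constant on an interval is constant from there on. *)
Lemma m_strict x y z : 0 <= x < y -> y <= z -> m x < m z -> m x < m y.
Proof.
  intros Hxy Hyz Hlt. pose proof (m_mono m W x y ltac:(lra)) as Hm.
  destruct (Req_dec (m x) (m y)) as [E|]; [exfalso|lra].
  destruct (MVT_gen m x y (Derive m)) as [t [Ht E2]].
  - intros; apply (warp_derive m W).
  - intros; apply continuity_pt_filterlim, m_continuous, W.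
  - rewrite Rmin_left, Rmax_right in Ht by lra.
    assert (Derive m t = 0).
    { apply Rmult_eq_reg_r with (y - x); [|lra]. rewrite <- E2. lra. }
    pose proof (m_tangent_le m W t z ltac:(lra)). pose proof (m_mono m W x t ltac:(lra)).
    pose proof (m_mono m W t y ltac:(lra)). rewrite H in H0. lra.
Qed.

(** [Th] is the angle swept, as a function of the radius, by the geodesic with Clairaut constant [c]
    that leaves the circle of radius [rho] outwards (tangentially if [c = m rho]). *)
Definition ang (c rho : R) (Th : R -> R) : Prop :=
  (forall x, rho <= x -> continuous Th x) /\
  (forall x, rho < x -> is_derive Th x (c / (m x * qf c x))) /\ Th rho = 0.

Definition outgoing (c rho : R) : Prop :=
  0 < rho /\ 0 <= c <= m rho /\ forall x, rho < x -> c < m x.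

Lemma ang_mono c rho Th x y : outgoing c rho -> ang c rho Th -> rho <= x <= y -> Th x <= Th y.
Proof.
  intros (Hr & Hc & Hm) (HC & HD & H0) Hxy.
  apply (monotone_of_derive Th (fun x => c / (m x * qf c x))); [lra| | |].
  - intros t Ht. apply HC. lra.
  - intros t Ht. apply HD. lra.
  - intros t Ht. specialize (Hm t ltac:(lra)). pose proof (qf_pos c t ltac:(lra)).
    apply Rdiv_le_0_compat; [lra|]. apply Rmult_lt_0_compat; lra.
Qed.

Lemma ang_ge0 c rho Th x : outgoing c rho -> ang c rho Th -> rho <= x -> 0 <= Th x.
Proof.
  intros Ho Ha Hx. destruct Ha as (HC & HD & H0). rewrite <- H0.
  apply (ang_mono c rho Th); auto; [split; auto|lra].
Qed.

(** The ratio [(jc c0 - jc c) / ((c - c0) Th')], an increasing function of the radius with values in [0, 1]. *)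
Definition lf (c0 c x : R) : R := (c + c0) * qf c x / (c * (qf c0 x + qf c x)).

Lemma lf_spec c0 c x : 0 <= c0 < c -> c < m x ->
  jc m c0 x - jc m c x = (c - c0) * (c / (m x * qf c x)) * lf c0 c x.
Proof.
  intros H Hx. rewrite !jc_qf by lra.
  pose proof (qf_pos c x ltac:(lra)) as Hq. pose proof (qf_pos c0 x ltac:(lra)) as Hq0.
  unfold lf.
  transitivity ((qf c0 x * qf c0 x - qf c x * qf c x) / (m x * (qf c0 x + qf c x))).
  - field. lra.
  - rewrite !qf_sq by lra. field. lra.
Qed.

Lemma lf_range c0 c x : 0 <= c0 < c -> c < m x -> 0 <= lf c0 c x <= 1.
Proof.
  intros H Hx. pose proof (qf_pos c x ltac:(lra)) as Hq.
  pose proof (qf_mono_c c0 c x ltac:(lra)) as Hm. unfold lf. split.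
  - apply Rdiv_le_0_compat; [apply Rmult_le_pos; lra|]. apply Rmult_lt_0_compat; lra.
  - apply Rle_div_l; [apply Rmult_lt_0_compat; lra|].
    assert (c0 * qf c x <= c * qf c x) by (apply Rmult_le_compat_r; lra).
    assert (c * qf c x <= c * qf c0 x) by (apply Rmult_le_compat_l; lra). lra.
Qed.

Lemma lf_mono c0 c x y : 0 <= c0 < c -> 0 <= x <= y -> c < m x -> lf c0 c x <= lf c0 c y.
Proof.
  intros H Hxy Hx. pose proof (m_mono m W x y ltac:(lra)) as Hm.
  pose proof (qf_pos c x ltac:(lra)) as Hq. pose proof (qf_pos c0 x ltac:(lra)) as Hq0.
  pose proof (qf_pos c y ltac:(lra)) as Hqy. pose proof (qf_pos c0 y ltac:(lra)) as Hq0y.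
  assert (HH : qf c x * qf c0 y <= qf c y * qf c0 x).
  { apply Rsqr_incr_0_var; [|nra]. unfold Rsqr.
    replace (qf c x * qf c0 y * (qf c x * qf c0 y)) with ((qf c x * qf c x) * (qf c0 y * qf c0 y)) by ring.
    replace (qf c y * qf c0 x * (qf c y * qf c0 x)) with ((qf c y * qf c y) * (qf c0 x * qf c0 x)) by ring.
    rewrite !qf_sq by lra.
    assert (0 <= (c ^ 2 - c0 ^ 2) * (m y ^ 2 - m x ^ 2)) by (apply Rmult_le_pos; nra). nra. }
  assert (0 <= lf c0 c y - lf c0 c x); [|lra]. unfold lf.
  replace ((c + c0) * qf c y / (c * (qf c0 y + qf c y)) - (c + c0) * qf c x / (c * (qf c0 x + qf c x)))
    with ((c + c0) * (qf c y * qf c0 x - qf c x * qf c0 y) / (c * (qf c0 y + qf c y) * (qf c0 x + qf c x)))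
    by (field; lra).
  apply Rdiv_le_0_compat; [apply Rmult_le_pos; lra|].
  repeat apply Rmult_lt_0_compat; lra.
Qed.

(** The difference 1 - 2 m' changes sign at most once, from minus to plus, and [lf] increases.
    Taking for [l] the value of [lf] at the sign change makes the product nonnegative everywhere;
    without a sign change, 0 or 1 will do. *)
Lemma lf_threshold c0 c rho R : 0 <= c0 < c -> outgoing c rho -> rho < R ->
  exists l, 0 <= l <= 1 /\
    forall x, rho < x < R -> 0 <= (1 - 2 * Derive m x) * (lf c0 c x - l).
Proof.
  intros H (Hr & Hc & Hm) HR.
  destruct (Rle_dec (Derive m rho) (1/2)) as [H1|H1].
  { exists 0. split; [lra|]. intros x Hx. pose proof (lf_range c0 c x H (Hm x ltac:(lra))).
    pose proof (warp_dec m W rho x ltac:(lra)). apply Rmult_le_pos; lra. }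
  destruct (Rle_dec (1/2) (Derive m R)) as [H2|H2].
  { exists 1. split; [lra|]. intros x Hx. pose proof (lf_range c0 c x H (Hm x ltac:(lra))).
    pose proof (warp_dec m W x R ltac:(lra)).
    replace ((1 - 2 * Derive m x) * (lf c0 c x - 1)) with ((2 * Derive m x - 1) * (1 - lf c0 c x)) by ring.
    apply Rmult_le_pos; lra. }
  destruct (intermediate_value (fun x => - Derive m x) rho R (-(1/2))) as [r [Hrr Er]]; [lra| |lra|].
  { intros x _. apply cont_opp, (warp_C1 m W). }
  assert (Hlt : rho < r).
  { destruct (Req_dec rho r) as [E|]; [|lra]. rewrite <- E in Er. lra. }
  exists (lf c0 c r). split; [apply lf_range; auto|].
  intros x Hx. destruct (Rle_dec x r).
  - pose proof (lf_mono c0 c x r H ltac:(lra) (Hm x ltac:(lra))). pose proof (warp_dec m W x r ltac:(lra)).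
    replace ((1 - 2 * Derive m x) * (lf c0 c x - lf c0 c r)) with
      ((2 * Derive m x - 1) * (lf c0 c r - lf c0 c x)) by ring.
    apply Rmult_le_pos; lra.
  - pose proof (lf_mono c0 c r x H ltac:(lra) (Hm r ltac:(lra))). pose proof (warp_dec m W r x ltac:(lra)).
    apply Rmult_le_pos; lra.
Qed.

(** The derivative of [La] is m' times that of [J], and m' is at most 1. *)
Lemma J_ge_La r0 rho : 0 <= r0 < rho -> m r0 < m rho -> La (m r0) rho <= J m (m r0) r0 rho.
Proof.
  intros H Hlt. destruct (Req_dec r0 0) as [->|Hn].
  - rewrite (warp_0 m W), J_0. unfold La. rewrite Rmult_0_l, !Rminus_0_r.
    pose proof (m_le m W rho ltac:(lra)). rewrite (warp_0 m W) in Hlt.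
    pose proof (qf_le 0 rho ltac:(lra)). lra.
  - assert (J m (m r0) r0 r0 - La (m r0) r0 <= J m (m r0) r0 rho - La (m r0) rho).
    2:{ rewrite J_point, La_eq0 in H0 by easy. lra. }
    pose proof (m_ge0 m W r0 ltac:(lra)) as Hm0.
    apply (monotone_of_derive (fun x => J m (m r0) r0 x - La (m r0) x)
      (fun x => jc m (m r0) x - Derive m x * jc m (m r0) x)); [lra| | |].
    + intros x Hx. apply cont_minus; [|apply La_continuous].
      eapply is_derive_continuous, is_derive_J; [exact W|lra|lra].
    + intros x Hx. apply (is_derive_minus (J m (m r0) r0) (La (m r0))).
      * apply is_derive_J; [exact W|lra|lra].
      * apply is_derive_La. pose proof (m_strict r0 x rho ltac:(lra) ltac:(lra) Hlt). lra.
    + intros x Hx. pose proof (jc_ge0 m (m r0) x). pose proof (dm_le1 m W x ltac:(lra)). nra.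
Qed.

(** Comparison with the cone of total angle [PI] ([m' = 1/2]): since [m'] is nonincreasing, the
    discrepancy is controlled by the swept angle alone. *)
Lemma dip_is_longer c rho R r0 th Th : 0 <= r0 -> m r0 < c -> outgoing c rho -> ang c rho Th -> rho < R ->
  0 <= th <= PI -> th <= Th R ->
  c * th + J m c rho R - 2 * c * xi c R <= m r0 * th + J m (m r0) r0 rho + J m (m r0) r0 R.
Proof.
  intros Hr0 Hlt Ho Ha HR Hth HthR. pose proof Ho as (Hr & Hc & Hm). destruct Ha as (TC & TD & T0).
  set (c0 := m r0) in *.
  assert (Hc0 : 0 <= c0 < c) by (split; [apply (m_ge0 m W); lra|easy]).
  assert (Hr0rho : r0 < rho).
  { apply Rnot_le_lt. intros Hn. pose proof (m_mono m W rho r0 ltac:(lra)). unfold c0 in *. lra. }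
  destruct (lf_threshold c0 c rho R Hc0 Ho HR) as [l [Hl Hthr]].
  (* The [J] difference minus its value in the cone of slope 1/2, corrected by [l] times the
     discrepancy of the swept angles. By [lf_spec] its derivative is the product of [lf_threshold]
     times a positive factor. *)
  set (K := fun x => J m c0 rho x - J m c rho x - 2 * (La c0 x - La c x) - (c - c0) * l * (Th x - 2 * Af c x)).
  assert (HK : K rho <= K R).
  { apply (monotone_of_derive K (fun x => (1 - 2 * Derive m x) * (lf c0 c x - l) * ((c - c0) * (c / (m x * qf c x))))).
    - lra.
    - intros x Hx. unfold K.
      assert (continuous (J m c0 rho) x) by (eapply is_derive_continuous, is_derive_J; [exact W|lra|lra]).
      assert (continuous (J m c rho) x) by (eapply is_derive_continuous, is_derive_J; [exact W|lra|lra]).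
      pose proof (La_continuous c0 x). pose proof (La_continuous c x). pose proof (Af_continuous c x).
      pose proof (TC x ltac:(lra)). cont.
    - intros x Hx. specialize (Hm x ltac:(lra)).
      pose proof (qf_pos c x ltac:(lra)) as Hq.
      evar_last.
      + apply (is_derive_minus (fun x => J m c0 rho x - J m c rho x - 2 * (La c0 x - La c x))
          (fun x => (c - c0) * l * (Th x - 2 * Af c x))).
        * apply (is_derive_minus (fun x => J m c0 rho x - J m c rho x) (fun x => 2 * (La c0 x - La c x))).
          -- apply (is_derive_minus (J m c0 rho) (J m c rho)); apply is_derive_J; auto; lra.
          -- apply (is_derive_scal (fun x => La c0 x - La c x)).
             apply (is_derive_minus (La c0) (La c)); apply is_derive_La; lra.
        * apply (is_derive_scal (fun x => Th x - 2 * Af c x)).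
          apply (is_derive_minus Th (fun x => 2 * Af c x)); [apply TD; lra|].
          apply (is_derive_scal (Af c)), is_derive_Af. lra.
      + unfold minus, plus, opp; simpl.
        pose proof (lf_spec c0 c x Hc0 Hm) as E.
        transitivity ((1 - 2 * Derive m x) * (jc m c0 x - jc m c x)
          - (c - c0) * l * (c / (m x * qf c x)) * (1 - 2 * Derive m x)); [field; lra|].
        rewrite E. ring.
    - intros x Hx. specialize (Hm x ltac:(lra)). pose proof (qf_pos c x ltac:(lra)) as Hq.
      apply Rmult_le_pos; [now apply Hthr|]. apply Rmult_le_pos; [lra|].
      apply Rdiv_le_0_compat; [lra|]. apply Rmult_lt_0_compat; lra. }
  unfold K in HK. rewrite !J_point, T0 in HK.
  assert (HJ : J m c0 r0 R = J m c0 r0 rho + J m c0 rho R).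
  { destruct (Req_dec r0 0) as [E|E].
    - assert (c0 = 0) as -> by (unfold c0; now rewrite E, (warp_0 m W)). rewrite !J_0. ring.
    - symmetry. apply J_chasles; auto; lra. }
  pose proof (J_ge_La r0 rho ltac:(lra) ltac:(unfold c0 in *; lra)) as HI. fold c0 in HI.
  pose proof (La_ge0 c rho ltac:(lra)) as HLc.
  assert (HmR : c < m R) by (apply Hm; lra).
  (* In the cone, lowering the constant lengthens the radial part by (c - c0) PI / 2 on each side of
     the dip, up to [xi]; this pays for the lost angular term. *)
  assert (HLR : (c - c0) * (PI / 2) - c * xi c R <= La c0 R - La c R).
  { unfold La. rewrite (Af_xi c R) by lra. pose proof (Af_range c0 R ltac:(lra)).
    pose proof (qf_mono_c c0 c R ltac:(lra)).
    assert (c0 * Af c0 R <= c0 * (PI / 2)) by (apply Rmult_le_compat_l; lra). lra. }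
  pose proof (Af_range c rho ltac:(lra)) as HA1. pose proof (Af_range c R ltac:(lra)) as HA2.
  (* Here the bound [PI] on the angle is used: if [Th R] is below [PI], then [PI - th] dominates
     [PI - Th R], and [l] is at most 1. *)
  assert (HT : 0 <= (c - c0) * ((PI - th) + l * (Th R - PI))).
  { apply Rmult_le_pos; [lra|]. destruct (Rle_dec PI (Th R)); [nra|]. nra. }
  assert (HA : (c - c0) * (l * (Th R - PI)) <= (c - c0) * (l * (Th R - 2 * Af c R + 2 * Af c rho))).
  { apply Rmult_le_compat_l; [lra|]. apply Rmult_le_compat_l; lra. }
  rewrite HJ. nra.
Qed.

(** Curves whose minimal radius has [m] at least [c] are calibrated by [c], deeper ones by
    [dip_is_longer]. For [th = Th R] the bound is the length of the geodesic up to an error that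
    vanishes at infinity when [m] is unbounded. *)
Lemma dist_lower c rho R th Th : outgoing c rho -> ang c rho Th -> rho < R ->
  0 <= th <= PI -> th <= Th R ->
  c * th + J m c rho R - 2 * c * xi c R <= dist m (pol rho 0) (pol R th).
Proof.
  intros Ho Ha HR Hth HthR. pose proof Ho as (Hr & Hc & Hm).
  apply (dist_ge_calibrated m W _ _ th); rewrite ?nrm_pol by lra; auto; [lra| |].
  - rewrite dot_pol. replace (0 - th) with (- th) by ring. now rewrite cos_neg.
  - intros r0 Hr0 Hr0R. destruct (Rle_dec c (m r0)) as [Hle|Hlt].
    + exists c. split; [lra|].
      assert (0 <= 2 * c * xi c R).
      { pose proof (xi_range c R ltac:(split; [lra|apply Hm; lra])). apply Rmult_le_pos; lra. }
      destruct (Req_dec r0 0) as [E|E].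
      * rewrite E, (warp_0 m W) in Hle. assert (c = 0) as -> by lra. rewrite !J_0. lra.
      * rewrite <- (J_chasles m W c r0 rho R) by lra.
        pose proof (J_ge0 m W c r0 rho ltac:(lra)). lra.
    + exists (m r0). split; [pose proof (m_ge0 m W r0 ltac:(lra)); lra|].
      apply dip_is_longer with Th; auto; lra.
Qed.

End Warped.

(** * Outgoing geodesics as curves, and when they are rays *)

Section Warped.
Context (m : R -> R) (W : warp m).

Lemma dist_radial a b t : 0 <= a -> 0 <= b -> dist m (pol a t) (pol b t) = Rabs (a - b).
Proof.
  intros Ha Hb. apply Rle_antisym.
  - apply Rle_trans with (1 := dist_le_edist m W _ _). unfold edist, pol; simpl.
    rewrite <- sqrt_Rsqr_abs. apply sqrt_le_1_alt. pose proof (sin2_cos2 t) as E. unfold Rsqr in *.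
    apply Req_le. transitivity ((a - b) * (a - b) * (sin t * sin t + cos t * cos t)); [ring|rewrite E; ring].
  - pose proof (nrm_dist m W (pol a t) (pol b t)). now rewrite !nrm_pol in H by easy.
Qed.

Lemma dist_pol_le a b s t : 0 <= a -> 0 <= b ->
  dist m (pol a s) (pol b t) <= Rabs (a - b) + m a * Rabs (s - t).
Proof.
  intros Ha Hb. apply Rle_trans with (1 := dist_triangle m W _ (pol a t) _).
  rewrite (dist_radial a b t Ha Hb). pose proof (dist_arc m W a s t Ha). lra.
Qed.

(** Arc length from [pol rho 0] along the geodesic of Clairaut constant [c]. *)
Definition arc (c rho : R) (Th : R -> R) (x : R) : R := c * Th x + J m c rho x.

Lemma outgoing_qf c rho x : outgoing m c rho -> rho < x -> 0 < qf m c x.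
Proof. intros (Hr & Hc & Hm) Hx. apply qf_pos. split; [lra|now apply Hm]. Qed.

Lemma is_derive_arc c rho Th x : outgoing m c rho -> ang m c rho Th -> rho < x ->
  is_derive (arc c rho Th) x (m x / qf m c x).
Proof.
  intros Ho (TC & TD & T0) Hx. pose proof (outgoing_qf c rho x Ho Hx) as Hq.
  destruct Ho as (Hr & Hc & Hm). specialize (Hm x Hx).
  evar_last; [apply (is_derive_plus (fun x => c * Th x) (J m c rho));
    [apply (is_derive_scal Th), TD, Hx|apply is_derive_J; auto; lra]|].
  unfold plus; simpl. rewrite jc_qf by lra.
  transitivity ((c ^ 2 + qf m c x * qf m c x) / (m x * qf m c x)); [field; lra|].
  rewrite qf_sq by lra. field. lra.
Qed.

Lemma arc_continuous c rho Th x : outgoing m c rho -> ang m c rho Th -> rho <= x ->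
  continuous (arc c rho Th) x.
Proof.
  intros (Hr & Hc & Hm) (TC & _ & _) Hx. specialize (TC x Hx).
  apply cont_plus; [cont|]. eapply is_derive_continuous, is_derive_J; [exact W|lra|lra].
Qed.

Lemma arc_0 c rho Th : ang m c rho Th -> arc c rho Th rho = 0.
Proof. intros (_ & _ & H). unfold arc. rewrite H, J_point. ring. Qed.

Lemma arc_expand c rho Th x y : outgoing m c rho -> ang m c rho Th -> rho <= x <= y ->
  y - x <= arc c rho Th y - arc c rho Th x.
Proof.
  intros Ho Ha Hxy.
  assert (arc c rho Th x - x <= arc c rho Th y - y); [|lra].
  apply (monotone_of_derive (fun t => arc c rho Th t - t) (fun t => m t / qf m c t - 1)); [lra| | |].
  - intros t Ht. apply cont_minus; [apply arc_continuous; auto; lra|apply cont_id].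
  - intros t Ht. apply (is_derive_minus (arc c rho Th) (fun t => t)); [apply is_derive_arc; auto; lra|].
    apply @is_derive_id.
  - intros t Ht. pose proof (outgoing_qf c rho t Ho ltac:(lra)) as Hq. destruct Ho as (Hr & Hc & Hm).
    specialize (Hm t ltac:(lra)). pose proof (qf_le m c t ltac:(lra)).
    assert (1 <= m t / qf m c t) by (apply Rle_div_r; lra). lra.
Qed.

Lemma geodesic_le_open c rho Th a b : outgoing m c rho -> ang m c rho Th -> rho < a <= b ->
  dist m (pol a (Th a)) (pol b (Th b)) <= arc c rho Th b - arc c rho Th a.
Proof.
  intros Ho Ha Hab. pose proof Ho as (Hr & Hc & Hm). pose proof Ha as (TC & TD & T0).
  apply (polar_path_le m W (fun t => t) (fun _ => 1) Th (fun x => c / (m x * qf m c x))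
    (arc c rho Th) (fun t => m t / qf m c t)); [lra| | | | |].
  - intros t Ht. generalize (locally_interval rho (t + 1) t ltac:(lra)). apply filter_imp. intros u Hu.
    split; [lra|]. split; [apply @is_derive_id|apply TD; lra].
  - intros t Ht. split; [apply cont_const|]. pose proof (outgoing_qf c rho t Ho ltac:(lra)).
    specialize (Hm t ltac:(lra)).
    apply cont_div; [apply cont_const| |apply Rmult_integral_contrapositive; lra].
    apply cont_mult; [now apply m_continuous|now apply qf_continuous].
  - intros t Ht. apply arc_continuous; auto; lra.
  - intros t Ht. apply is_derive_arc; auto; lra.
  - intros t Ht. pose proof (outgoing_qf c rho t Ho ltac:(lra)) as Hq. specialize (Hm t ltac:(lra)).
    apply Req_le. replace (1 ^ 2 + (m t * (c / (m t * qf m c t))) ^ 2) with (Rsqr (m t / qf m c t)).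
    + apply sqrt_Rsqr. apply Rdiv_le_0_compat; lra.
    + unfold Rsqr. transitivity ((qf m c t * qf m c t + c ^ 2) / (qf m c t * qf m c t)); [|field; lra].
      rewrite qf_sq at 1 by lra. field. lra.
Qed.

(** The slope of a tangential [Th] is infinite at [rho], so the initial point is reached by
    continuity, replacing a short first piece by an arc and a radial segment. *)
Lemma geodesic_le c rho Th a b : outgoing m c rho -> ang m c rho Th -> rho <= a <= b ->
  dist m (pol a (Th a)) (pol b (Th b)) <= arc c rho Th b - arc c rho Th a.
Proof.
  intros Ho Ha Hab. destruct (Req_dec a b) as [->|Hne]; [rewrite dist_refl by exact W; lra|].
  destruct (Req_dec a rho) as [->|Hn]; [|apply geodesic_le_open; auto; lra].
  pose proof Ho as (Hr & Hc & Hm). pose proof Ha as (TC & TD & T0).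
  rewrite (arc_0 c rho Th Ha). apply le_epsilon. intros e He.
  set (k := m rho + 1). assert (Hk : 0 < k) by (unfold k; pose proof (m_ge0 m W rho ltac:(lra)); lra).
  destruct (proj1 (continuous_eps Th rho) (TC rho ltac:(lra)) (e / (2 * k))) as [d [Hd1 Hd2]].
  { apply Rdiv_lt_0_compat; lra. }
  set (x := Rmin b (rho + Rmin (d / 2) (e / 2))).
  assert (Hx : rho < x <= b /\ x - rho < d /\ x - rho <= e / 2).
  { unfold x, Rmin. repeat destruct Rle_dec; lra. }
  specialize (Hd2 x ltac:(rewrite Rabs_right; lra)).
  pose proof (geodesic_le_open c rho Th x b Ho Ha ltac:(lra)) as H1.
  pose proof (dist_triangle m W (pol rho (Th rho)) (pol x (Th x)) (pol b (Th b))) as H2.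
  pose proof (dist_pol_le rho x (Th rho) (Th x) ltac:(lra) ltac:(lra)) as H3.
  rewrite (Rabs_minus_sym (Th rho)), (Rabs_left1 (rho - x)) in H3 by lra.
  pose proof (arc_expand c rho Th rho x Ho Ha ltac:(lra)) as H4. rewrite (arc_0 c rho Th Ha) in H4.
  assert (m rho * Rabs (Th x - Th rho) <= k * (e / (2 * k))).
  { apply Rmult_le_compat; [apply (m_ge0 m W); lra|apply Rabs_pos|unfold k; lra|lra]. }
  replace (k * (e / (2 * k))) with (e / 2) in H by (field; lra). lra.
Qed.

(** The geodesic is rotated so as to end at the target; the rotated initial point is joined to
    [pol rho 0] along the circle. *)
Lemma dist_upper c rho Th R th : outgoing m c rho -> ang m c rho Th -> rho <= R ->
  dist m (pol rho 0) (pol R th) <= arc c rho Th R + m rho * Rabs (th - Th R).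
Proof.
  intros Ho Ha HR. pose proof Ho as (Hr & _). pose proof Ha as (_ & _ & T0).
  pose proof (geodesic_le c rho Th rho R Ho Ha ltac:(lra)) as H. rewrite T0, (arc_0 c rho Th Ha) in H.
  apply Rle_trans with (1 := dist_triangle m W _ (pol rho (th - Th R)) _).
  pose proof (dist_arc m W rho 0 (th - Th R) ltac:(lra)) as H1.
  rewrite (Rabs_minus_sym 0), (Rminus_0_r (th - Th R)) in H1.
  rewrite <- (dist_pol_shift m W (th - Th R) rho 0 R (Th R)) in H.
  replace (Th R + (th - Th R)) with th in H by ring. rewrite Rplus_0_l in H. lra.
Qed.

Definition unbounded : Prop := forall V, exists R0, forall R, R0 <= R -> V <= m R.

Lemma xi_vanishes c : unbounded -> 0 <= c -> forall e, 0 < e ->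
  exists R0, forall R, R0 <= R -> c < m R /\ 2 * c * xi m c R <= e.
Proof.
  intros HU Hc e He. destruct (HU (c + 1 + 2 * c ^ 2 / e)) as [R0 HR]. exists R0. intros R HR0.
  specialize (HR R HR0). assert (0 <= 2 * c ^ 2 / e) by (apply Rdiv_le_0_compat; nra).
  split; [lra|]. pose proof (xi_range m c R ltac:(lra)) as Hxi. pose proof (qf_pos m c R ltac:(lra)) as Hq.
  assert (Hqm : m R - c <= qf m c R).
  { unfold qf. rewrite <- (sqrt_pow2 (m R - c)) by lra. apply sqrt_le_1_alt. nra. }
  apply Rle_trans with (2 * c * (c / qf m c R)); [apply Rmult_le_compat_l; lra|].
  replace (2 * c * (c / qf m c R)) with (2 * c ^ 2 / qf m c R) by (field; lra).
  apply Rle_div_l; [lra|]. apply Rle_trans with (e * (2 * c ^ 2 / e)); [apply Req_le; field; lra|].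
  apply Rmult_le_compat_l; lra.
Qed.

Lemma outgoing_ray c rho Th : outgoing m c rho -> ang m c rho Th -> unbounded ->
  (forall R, rho <= R -> Th R <= PI) ->
  exists sigma, ray m (pol rho 0) sigma /\ forall R, rho <= R -> sigma (arc c rho Th R) = pol R (Th R).
Proof.
  intros Ho Ha HU HPI. pose proof Ho as (Hr & Hc & Hm). pose proof Ha as (TC & TD & T0).
  assert (Hinj : forall x y, rho <= x -> rho <= y -> arc c rho Th x = arc c rho Th y -> x = y).
  { intros x y Hx Hy E. destruct (Rle_dec x y).
    - pose proof (arc_expand c rho Th x y Ho Ha ltac:(lra)). lra.
    - pose proof (arc_expand c rho Th y x Ho Ha ltac:(lra)). lra. }
  destruct (functional_choice (fun t x => 0 <= t -> rho <= x /\ arc c rho Th x = t)) as [X HX].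
  { intros t. destruct (Rle_dec 0 t) as [Ht|Ht]; [|exists 0; intros; lra].
    pose proof (arc_expand c rho Th rho (rho + t) Ho Ha ltac:(lra)) as HE. rewrite (arc_0 c rho Th Ha) in HE.
    destruct (intermediate_value (arc c rho Th) rho (rho + t) t) as [x [Hx E]]; [lra| | |].
    - intros x Hx. apply arc_continuous; auto; lra.
    - rewrite (arc_0 c rho Th Ha). lra.
    - exists x. intros _. split; [lra|easy]. }
  exists (fun t => pol (X t) (Th (X t))).
  assert (HS : forall R, rho <= R -> X (arc c rho Th R) = R).
  { intros R HR. pose proof (arc_expand c rho Th rho R Ho Ha ltac:(lra)) as HE. rewrite (arc_0 c rho Th Ha) in HE.
    destruct (HX (arc c rho Th R) ltac:(lra)) as [H1 H2]. now apply Hinj. }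
  (* The lower bound is exact only in the limit: it is applied at a much larger radius and pulled
     back to [R] by the triangle inequality. *)
  assert (Hlow : forall R, rho <= R -> arc c rho Th R <= dist m (pol rho 0) (pol R (Th R))).
  { intros R HR. apply le_epsilon. intros e He.
    destruct (xi_vanishes c HU ltac:(lra) e He) as [R0 HR0].
    set (R' := Rmax (R + 1) R0).
    assert (HR' : R < R' /\ R0 <= R') by (unfold R', Rmax; destruct Rle_dec; lra).
    destruct (HR0 R' ltac:(lra)) as [_ Hxi].
    pose proof (dist_lower m W c rho R' (Th R') Th Ho Ha ltac:(lra)
      ltac:(split; [apply (ang_ge0 m c rho Th R' Ho Ha); lra|apply HPI; lra]) ltac:(lra)) as H1.
    pose proof (geodesic_le c rho Th R R' Ho Ha ltac:(lra)) as H2.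
    pose proof (dist_triangle m W (pol rho 0) (pol R (Th R)) (pol R' (Th R'))) as H3.
    unfold arc in *. lra. }
  assert (Hmono : forall x y, rho <= x <= y ->
    dist m (pol x (Th x)) (pol y (Th y)) = arc c rho Th y - arc c rho Th x).
  { intros x y Hxy. apply Rle_antisym; [now apply geodesic_le|].
    pose proof (Hlow y ltac:(lra)). pose proof (geodesic_le c rho Th rho x Ho Ha ltac:(lra)) as H1.
    rewrite T0, (arc_0 c rho Th Ha) in H1.
    pose proof (dist_triangle m W (pol rho 0) (pol x (Th x)) (pol y (Th y))). lra. }
  split; [split|].
  - pose proof (HS rho ltac:(lra)) as E. rewrite (arc_0 c rho Th Ha) in E. now rewrite E, T0.
  - intros s t Hs Ht. destruct (HX s Hs) as [Hxs Es]. destruct (HX t Ht) as [Hxt Et].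
    destruct (Rle_dec (X s) (X t)).
    + rewrite Hmono by lra. rewrite Es, Et.
      pose proof (arc_expand c rho Th (X s) (X t) Ho Ha ltac:(lra)). rewrite Rabs_left1; lra.
    + rewrite (dist_sym m W), Hmono by lra. rewrite Es, Et.
      pose proof (arc_expand c rho Th (X t) (X s) Ho Ha ltac:(lra)). rewrite Rabs_right; lra.
  - intros R HR. now rewrite HS.
Qed.

(** [Rmax] only serves to make the integrand continuous on all of [R]. *)
Definition swept (c rho x : R) : R :=
  RInt (fun u => c / (m (Rmax rho u) * qf m c (Rmax rho u))) rho x.

Lemma transverse_outgoing c rho : 0 < rho -> 0 <= c < m rho -> outgoing m c rho.
Proof.
  intros Hr Hc. split; [easy|]. split; [lra|]. intros x Hx.
  pose proof (m_mono m W rho x ltac:(lra)). lra.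
Qed.

Lemma swept_integrand_continuous c rho u : 0 < rho -> 0 <= c < m rho ->
  continuous (fun u => c / (m (Rmax rho u) * qf m c (Rmax rho u))) u.
Proof.
  intros Hr Hc. assert (HM : rho <= Rmax rho u) by apply Rmax_l.
  pose proof (m_mono m W rho (Rmax rho u) ltac:(lra)).
  pose proof (qf_pos m c (Rmax rho u) ltac:(lra)).
  assert (HC : continuous (Rmax rho) u).
  { apply lipschitz_continuous with 1. intros y. unfold Rmax, Rabs.
    repeat destruct Rle_dec; repeat destruct Rcase_abs; lra. }
  apply cont_div; [apply cont_const| |apply Rmult_integral_contrapositive; lra].
  apply cont_mult; [apply (cont_comp (Rmax rho) m)|apply (cont_comp (Rmax rho) (qf m c))];
    auto; [now apply m_continuous|now apply qf_continuous].
Qed.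

Lemma swept_ang c rho : 0 < rho -> 0 <= c < m rho -> ang m c rho (swept c rho).
Proof.
  intros Hr Hc.
  assert (D : forall x, is_derive (swept c rho) x (c / (m (Rmax rho x) * qf m c (Rmax rho x)))).
  { intros x. apply (is_derive_RInt_cont (fun u => c / (m (Rmax rho u) * qf m c (Rmax rho u)))).
    intros y. now apply swept_integrand_continuous. }
  split; [|split].
  - intros x _. eapply is_derive_continuous, D.
  - intros x Hx. specialize (D x). now rewrite Rmax_right in D by lra.
  - unfold swept. now rewrite RInt_point.
Qed.

Lemma tangent_outgoing rho : 0 < rho -> 0 < Derive m rho -> outgoing m (m rho) rho.
Proof.
  intros Hr Hd. pose proof (warp_pos m W rho Hr). split; [easy|]. split; [lra|]. intros x Hx.
  assert (Hm : exists z, x <= z /\ m rho < m z \/ rho < z < x /\ m rho < m z).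
  { pose proof (warp_derive m W rho) as D. apply is_derive_Reals in D.
    destruct (D (Derive m rho / 2) ltac:(lra)) as [d Hd'].
    set (h := Rmin (d / 2) ((x - rho) / 2)).
    pose proof (cond_pos d).
    assert (Hh : 0 < h < d /\ h < x - rho) by (unfold h, Rmin; destruct Rle_dec; lra).
    specialize (Hd' h ltac:(lra) ltac:(rewrite Rabs_right; lra)). apply Rabs_def2 in Hd'.
    assert (0 < (m (rho + h) - m rho) / h) by lra.
    exists (rho + h). right. split; [lra|].
    apply (Rmult_lt_compat_r h) in H1; [|lra].
    unfold Rdiv in H1. rewrite Rmult_0_l, Rmult_assoc, Rinv_l, Rmult_1_r in H1 by lra. lra. }
  destruct Hm as [z [[Hz1 Hz2]|[Hz1 Hz2]]].
  - apply (m_strict m W rho x z); lra.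
  - pose proof (m_mono m W z x ltac:(lra)). lra.
Qed.

(** In the variable [sqrt (r - rho)] the integrand of the tangential swept angle is continuous. *)
Lemma tangent_ang rho : 0 < rho -> 0 < Derive m rho -> exists Th, ang m (m rho) rho Th.
Proof.
  intros Hr Hd. pose proof (tangent_outgoing rho Hr Hd) as (_ & HM & Hm).
  set (M := m rho) in *. assert (HMp : 0 < M) by (apply (warp_pos m W); lra).
  set (F := fun u => m (rho + u) ^ 2 - M ^ 2).
  assert (HFp : forall u, 0 < u -> 0 < F u) by (intros u Hu; specialize (Hm (rho + u) ltac:(lra)); unfold F; nra).
  set (q := fun u => if Req_EM_T u 0 then 2 * M * Derive m rho else F u / u).
  assert (Hqp : forall u, 0 <= u -> 0 < q u).
  { intros u Hu. unfold q. destruct Req_EM_T; [repeat apply Rmult_lt_0_compat; lra|].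
    apply Rdiv_lt_0_compat; [apply HFp|]; lra. }
  assert (HFc : forall u, continuous F u).
  { intros u. unfold F. apply cont_minus; [|apply cont_const]. apply cont_pow.
    apply (cont_comp (fun u => rho + u) m); [cont|now apply m_continuous]. }
  assert (Hqc : forall u, continuous q u).
  { intros u. destruct (Req_dec u 0) as [->|Hu].
    - assert (DF : is_derive F 0 (2 * M * Derive m rho)).
      { unfold F. auto_derive; [exists (Derive m (rho + 0)); apply (warp_derive m W)|].
        change (Derive (fun x => m x) (rho + 0)) with (Derive m (rho + 0)).
        rewrite Rplus_0_r. fold M. ring. }
      apply is_derive_Reals in DF. apply continuous_eps. intros e He.
      destruct (DF e He) as [d Hdd]. exists d. split; [apply cond_pos|]. intros y Hy.
      unfold q. destruct (Req_EM_T 0 0); [|lra]. destruct Req_EM_T; [rewrite Rminus_diag, Rabs_R0; lra|].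
      specialize (Hdd y n ltac:(now rewrite Rminus_0_r in Hy)).
      replace (F 0) with 0 in Hdd by (unfold F; rewrite Rplus_0_r; fold M; ring).
      now rewrite Rplus_0_l, Rminus_0_r in Hdd.
    - apply (continuous_ext_loc _ (fun u => F u / u)).
      + generalize (cont_loc_ne (fun t => t) u (cont_id u) Hu). apply filter_imp. intros t Ht.
        unfold q. destruct Req_EM_T; easy.
      + apply cont_div; [apply HFc|apply cont_id|easy]. }
  (* Substituting r = rho + z^2, the factor 2 z of dr cancels the factor z of [qf]; the remaining
     factor sqrt (q (z^2)) stays away from 0 because m' rho > 0. *)
  set (h := fun z => 2 * M / (m (rho + z ^ 2) * sqrt (q (z ^ 2)))).
  assert (Hh : forall z, continuous h z).
  { intros z. unfold h.
    assert (0 <= z ^ 2) by apply pow2_ge_0.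
    apply cont_div; [apply cont_const| |].
    - apply cont_mult.
      + apply (cont_comp (fun z => rho + z ^ 2) m); [cont|now apply m_continuous].
      + apply cont_sqrt. apply (cont_comp (fun z => z ^ 2) q); [cont|apply Hqc].
    - pose proof (warp_pos m W (rho + z ^ 2) ltac:(lra)). pose proof (sqrt_lt_R0 _ (Hqp (z ^ 2) H)).
      apply Rmult_integral_contrapositive; lra. }
  exists (fun r => RInt h 0 (sqrt (r - rho))).
  assert (DH : forall z, is_derive (fun z => RInt h 0 z) z (h z)) by (intros; now apply is_derive_RInt_cont).
  split; [|split].
  - intros x _. apply (cont_comp (fun r => sqrt (r - rho)) (fun z => RInt h 0 z)).
    + apply cont_sqrt. cont.
    + eapply is_derive_continuous, DH.
  - intros x Hx. set (u := x - rho). assert (Hu : 0 < u) by (unfold u; lra).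
    pose proof (sqrt_lt_R0 u Hu) as Hsu. pose proof (sqrt_sqrt u ltac:(lra)) as Ess.
    evar_last; [apply (is_derive_comp (fun z => RInt h 0 z) (fun r => sqrt (r - rho)));
      [apply DH|]|].
    + apply (is_derive_comp sqrt (fun r => r - rho));
        [apply is_derive_Reals, derivable_pt_lim_sqrt; fold u; exact Hu|auto_derive; [auto|reflexivity]].
    + fold u. unfold scal; simpl; unfold mult; simpl. unfold h.
      replace (sqrt u ^ 2) with u by (simpl; lra). replace (rho + u) with x by (unfold u; ring).
      assert (EF : qf m M x = sqrt (q u) * sqrt u).
      { rewrite <- sqrt_mult by (try apply Rlt_le, Hqp; lra). unfold qf. f_equal.
        unfold q. destruct Req_EM_T; [lra|]. unfold F. replace (rho + u) with x by (unfold u; ring). field. lra. }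
      rewrite EF. pose proof (Hm x Hx). pose proof (sqrt_lt_R0 _ (Hqp u ltac:(lra))). field. lra.
  - rewrite Rminus_diag, sqrt_0. apply (RInt_point 0 h).
Qed.

End Warped.

(** * Bent radii *)

Lemma is_derive_lin (k x : R) : is_derive (fun t => k * t) x k.
Proof. auto_derive; auto. ring. Qed.

Section Warped.
Context (m : R -> R) (W : warp m).

Lemma slope_diff c' c Q M0 x : 0 <= c' <= c -> c < m x -> 0 < Q <= qf m c x -> 0 < M0 <= m x ->
  0 <= c / (m x * qf m c x) - c' / (m x * qf m c' x) <= (c - c') * ((c ^ 2 / Q ^ 3 + / Q) / M0).
Proof.
  intros Hc Hm HQ HM. set (q := qf m c x) in *. set (q' := qf m c' x).
  assert (Hqq : q <= q') by (apply qf_mono_c; lra).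
  assert (E : q' * q' - q * q = c ^ 2 - c' ^ 2).
  { unfold q, q'. rewrite !qf_sq by lra. ring. }
  assert (Hd : 0 <= q' - q <= (c - c') * (c / q)).
  { split; [lra|]. replace ((c - c') * (c / q)) with ((c - c') * c / q) by (field; lra).
    apply Rle_div_r; [lra|]. nra. }
  replace (c / (m x * q) - c' / (m x * q')) with ((c * (q' - q) + (c - c') * q) / (m x * q * q')) by (field; lra).
  split.
  - apply Rdiv_le_0_compat; [nra|]. repeat apply Rmult_lt_0_compat; lra.
  - apply Rle_trans with ((c - c') * ((c ^ 2 / q + q) / (m x * q * q))).
    + apply Rle_trans with ((c * (q' - q) + (c - c') * q) / (m x * q * q)).
      * apply Rmult_le_compat_l; [nra|]. apply Rinv_le_contravar; [repeat apply Rmult_lt_0_compat; lra|].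
        apply Rmult_le_compat_l; [apply Rmult_le_pos; lra|lra].
      * replace ((c - c') * ((c ^ 2 / q + q) / (m x * q * q))) with
          ((c * ((c - c') * (c / q)) + (c - c') * q) / (m x * q * q)) by (field; lra).
        apply Rmult_le_compat_r; [apply Rlt_le, Rinv_0_lt_compat; repeat apply Rmult_lt_0_compat; lra|].
        apply Rplus_le_compat_r. apply Rmult_le_compat_l; lra.
    + apply Rmult_le_compat_l; [lra|].
      replace ((c ^ 2 / q + q) / (m x * q * q)) with ((c ^ 2 / q ^ 3 + / q) / m x) by (field; lra).
      assert (HQ3 : 0 < Q ^ 3) by (apply pow_lt; lra).
      assert (H3 : Q ^ 3 <= q ^ 3) by (apply pow_incr; lra).
      apply Rmult_le_compat; [| | |].
      * apply Rplus_le_le_0_compat; [apply Rdiv_le_0_compat; [apply pow2_ge_0|lra]|apply Rlt_le, Rinv_0_lt_compat; lra].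
      * apply Rlt_le, Rinv_0_lt_compat; lra.
      * apply Rplus_le_compat; [|apply Rinv_le_contravar; lra].
        apply Rmult_le_compat_l; [apply pow2_ge_0|]. apply Rinv_le_contravar; lra.
      * apply Rinv_le_contravar; lra.
Qed.

(** Monotone and Lipschitz dependence of the swept angle on the constant, on intervals where [qf] is
    bounded away from 0. *)
Lemma ang_diff c' c rho Th' Th Q a b : outgoing m c' rho -> outgoing m c rho -> c' <= c ->
  ang m c' rho Th' -> ang m c rho Th -> rho <= a <= b -> 0 < Q ->
  (forall x, a < x < b -> Q <= qf m c x) ->
  Th' b - Th' a <= Th b - Th a /\
  (Th b - Th a) - (Th' b - Th' a) <= (c - c') * ((c ^ 2 / Q ^ 3 + / Q) / m rho) * (b - a).
Proof.
  intros Ho' Ho Hcc (TC' & TD' & T0') (TC & TD & T0) Hab HQ HQx.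
  destruct Ho' as (Hr & Hc' & Hm'). destruct Ho as (_ & Hc & Hm).
  pose proof (warp_pos m W rho Hr) as HM0.
  set (B := (c ^ 2 / Q ^ 3 + / Q) / m rho).
  assert (HS : forall x, a < x < b -> 0 <= c / (m x * qf m c x) - c' / (m x * qf m c' x) <= (c - c') * B).
  { intros x Hx. apply slope_diff; [lra|apply Hm; lra|split; [easy|now apply HQx]|].
    split; [lra|]. apply (m_mono m W). lra. }
  assert (C1 : forall x, a <= x <= b -> continuous (fun x => Th x - Th' x) x).
  { intros x Hx. apply cont_minus; [apply TC|apply TC']; lra. }
  assert (D1 : forall x, a < x < b -> is_derive (fun x => Th x - Th' x) x
      (c / (m x * qf m c x) - c' / (m x * qf m c' x))).
  { intros x Hx. apply (is_derive_minus Th Th'); [apply TD|apply TD']; lra. }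
  split.
  - assert (Th a - Th' a <= Th b - Th' b); [|lra].
    apply (monotone_of_derive (fun x => Th x - Th' x) _ a b ltac:(lra) C1 D1).
    intros x Hx. now apply HS.
  - assert ((c - c') * B * a - (Th a - Th' a) <= (c - c') * B * b - (Th b - Th' b)); [|lra].
    apply (monotone_of_derive (fun x => (c - c') * B * x - (Th x - Th' x))
      (fun x => (c - c') * B - (c / (m x * qf m c x) - c' / (m x * qf m c' x)))); [lra| | |].
    + intros x Hx. apply cont_minus; [cont|now apply C1].
    + intros x Hx. apply (is_derive_minus (fun x => (c - c') * B * x) (fun x => Th x - Th' x)); [|now apply D1].
      auto_derive; auto. ring.
    + intros x Hx. specialize (HS x Hx). lra.
Qed.

(** For fixed radii the swept angle depends continuously on the constant and vanishes for the
    meridian, so intermediate values apply. *)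
Lemma swept_attains c rho R a : 0 < rho -> 0 <= c < m rho -> rho <= R -> 0 <= a <= swept m c rho R ->
  exists c', 0 <= c' <= c /\ swept m c' rho R = a.
Proof.
  intros Hr Hc HR Ha.
  set (Q := qf m c rho). assert (HQ : 0 < Q) by (apply qf_pos; lra).
  assert (HQx : forall c' x, 0 <= c' <= c -> rho < x < R -> Q <= qf m c' x).
  { intros c' x Hc' Hx. apply Rle_trans with (qf m c x).
    - apply (qf_mono m W). lra.
    - apply qf_mono_c. lra. }
  set (B := (c ^ 2 / Q ^ 3 + / Q) / m rho * (R - rho)).
  assert (HL : forall c1 c2, 0 <= c1 <= c2 -> c2 <= c ->
     0 <= swept m c2 rho R - swept m c1 rho R <= B * (c2 - c1)).
  { intros c1 c2 H1 H2.
    destruct (ang_diff c1 c2 rho (swept m c1 rho) (swept m c2 rho) Q rho R) as [X Y];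
      try (apply transverse_outgoing; auto; lra); try (apply swept_ang; auto; lra); try lra.
    { intros x Hx. apply HQx; lra. }
    assert (E : forall c, swept m c rho rho = 0) by (intros; unfold swept; now rewrite RInt_point).
    rewrite !E in X, Y. split; [lra|].
    assert ((c2 - c1) * ((c2 ^ 2 / Q ^ 3 + / Q) / m rho) * (R - rho) <= B * (c2 - c1)); [|lra].
    unfold B. replace (((c ^ 2 / Q ^ 3 + / Q) / m rho) * (R - rho) * (c2 - c1))
      with ((c2 - c1) * ((c ^ 2 / Q ^ 3 + / Q) / m rho) * (R - rho)) by ring.
    apply Rmult_le_compat_r; [lra|]. apply Rmult_le_compat_l; [lra|].
    apply Rmult_le_compat_r; [apply Rlt_le, Rinv_0_lt_compat; lra|]. apply Rplus_le_compat_r.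
    apply Rmult_le_compat_r; [apply Rlt_le, Rinv_0_lt_compat, pow_lt; lra|]. apply pow_incr; lra. }
  assert (H0 : swept m 0 rho R = 0).
  { unfold swept. rewrite (RInt_ext _ (fun _ => 0)).
    - rewrite RInt_const. unfold scal; simpl; unfold mult; simpl. ring.
    - intros u _. apply Rmult_0_l. }
  destruct (intermediate_value (fun t => swept m (clip 0 c t) rho R) 0 c a) as [t [Ht E]]; [lra| | |].
  - intros x _. apply lipschitz_continuous with B. intros y.
    pose proof (clip_range 0 c x ltac:(lra)) as H1. pose proof (clip_range 0 c y ltac:(lra)) as H2.
    assert (HB : 0 <= B).
    { apply Rmult_le_pos; [|lra]. apply Rdiv_le_0_compat; [|lra]. apply Rplus_le_le_0_compat.
      - apply Rdiv_le_0_compat; [apply pow2_ge_0|now apply pow_lt].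
      - apply Rlt_le, Rinv_0_lt_compat, HQ. }
    assert (HC : Rabs (clip 0 c y - clip 0 c x) <= Rabs (y - x)).
    { unfold clip, Rmax, Rmin, Rabs. repeat destruct Rle_dec; repeat destruct Rcase_abs; lra. }
    apply Rle_trans with (B * Rabs (clip 0 c y - clip 0 c x)); [|now apply Rmult_le_compat_l].
    destruct (Rle_dec (clip 0 c x) (clip 0 c y)).
    + pose proof (HL _ _ (conj (proj1 H1) r) ltac:(lra)). rewrite !Rabs_pos_eq by lra. lra.
    + pose proof (HL (clip 0 c y) (clip 0 c x) ltac:(lra) ltac:(lra)). rewrite !Rabs_left1 by lra. lra.
  - rewrite (clip_id 0 c 0), (clip_id 0 c c), H0 by lra. lra.
  - rewrite clip_id in E by lra. exists t. split; [lra|easy].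
Qed.

(** The excess of [Th R] over [a] is cut into thirds: one bounds what the tangential geodesic sweeps
    before a radius [r1] near [rho], one bounds the change beyond [r1] when the constant drops by
    [tau], and one remains. *)
Lemma tangent_swept_limit rho Th R a : 0 < rho -> 0 < Derive m rho -> ang m (m rho) rho Th ->
  rho < R -> 0 <= a < Th R -> exists c, 0 <= c < m rho /\ a < swept m c rho R.
Proof.
  intros Hr Hd Ha HR Hlt. pose proof (tangent_outgoing m W rho Hr Hd) as Ho.
  pose proof Ha as (TC & TD & T0). set (M := m rho) in *. pose proof (warp_pos m W rho Hr) as HM. fold M in HM.
  set (e := (Th R - a) / 3).
  destruct (proj1 (continuous_eps Th rho) (TC rho ltac:(lra)) e ltac:(unfold e; lra)) as [d [Hd1 Hd2]].
  set (r1 := Rmin ((rho + R) / 2) (rho + d / 2)).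
  assert (Hr1 : rho < r1 < R /\ r1 - rho < d) by (unfold r1, Rmin; destruct Rle_dec; lra).
  specialize (Hd2 r1 ltac:(rewrite Rabs_right; lra)). apply Rabs_def2 in Hd2. rewrite T0 in Hd2.
  set (Q := qf m M r1). assert (HQ : 0 < Q) by (apply (outgoing_qf m M rho); auto; lra).
  set (B := (M ^ 2 / Q ^ 3 + / Q) / M * (R - r1)).
  assert (HB : 0 < B).
  { apply Rmult_lt_0_compat; [|lra]. apply Rdiv_lt_0_compat; [|lra]. apply Rplus_lt_0_compat.
    - apply Rdiv_lt_0_compat; [apply pow_lt; lra|now apply pow_lt].
    - now apply Rinv_0_lt_compat. }
  set (tau := Rmin (M / 2) (e / B)).
  assert (He : 0 < e / B) by (apply Rdiv_lt_0_compat; unfold e in *; lra).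
  assert (Ht : 0 < tau <= M / 2 /\ tau <= e / B) by (unfold tau, Rmin; destruct Rle_dec; lra).
  exists (M - tau). split; [lra|].
  assert (Ho' : outgoing m (M - tau) rho) by (apply transverse_outgoing; auto; unfold M; fold M; lra).
  assert (Ha' : ang m (M - tau) rho (swept m (M - tau) rho)) by (apply swept_ang; auto; fold M; lra).
  destruct (ang_diff (M - tau) M rho _ Th Q r1 R Ho' Ho ltac:(lra) Ha' Ha ltac:(lra) HQ) as [_ H2].
  { intros x Hx. apply (qf_mono m W). lra. }
  fold M in H2. replace (M - (M - tau)) with tau in H2 by ring. rewrite Rmult_assoc in H2. fold B in H2.
  assert (tau * B <= e).
  { apply Rle_trans with (e / B * B); [apply Rmult_le_compat_r; lra|apply Req_le; field; lra]. }
  pose proof (ang_ge0 m (M - tau) rho _ r1 Ho' Ha' ltac:(lra)). unfold e in *. lra.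
Qed.

(** Only transversal geodesics are named, since [swept] is then an integral of a continuous
    function; [straight_tangent] recovers the tangential ones as a limit. *)
Definition bent (rho : R) : Prop :=
  exists c R, 0 <= c < m rho /\ rho <= R /\ PI < swept m c rho R.

Lemma swept_ge c rho R : 0 < rho -> 0 <= c < m rho -> rho <= R -> c / m R ^ 2 * (R - rho) <= swept m c rho R.
Proof.
  intros Hr Hc HR. destruct (swept_ang m W c rho Hr Hc) as (TC & TD & T0).
  assert (swept m c rho rho - c / m R ^ 2 * rho <= swept m c rho R - c / m R ^ 2 * R); [|lra].
  apply (monotone_of_derive (fun x => swept m c rho x - c / m R ^ 2 * x)
    (fun x => c / (m x * qf m c x) - c / m R ^ 2)); [lra| | |].
  - intros x Hx. apply cont_minus; [apply TC; lra|cont].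
  - intros x Hx. apply (is_derive_minus (swept m c rho) (fun x => c / m R ^ 2 * x)); [apply TD; lra|].
    apply is_derive_lin.
  - intros x Hx. pose proof (m_mono m W rho x ltac:(lra)). pose proof (m_mono m W x R ltac:(lra)).
    pose proof (qf_pos m c x ltac:(lra)). pose proof (qf_le m c x ltac:(lra)).
    assert (c / m R ^ 2 <= c / (m x * qf m c x)); [|lra].
    apply Rmult_le_compat_l; [lra|]. apply Rinv_le_contravar; [apply Rmult_lt_0_compat; lra|].
    simpl. rewrite Rmult_1_r. apply Rmult_le_compat; lra.
Qed.

(** If [m] stayed below V, the angular slope would be at least c / V^2, and the swept angle would
    exceed [PI]. *)
Lemma straight_unbounded rho : 0 < rho -> ~ bent rho -> unbounded m.
Proof.
  intros Hr Hn V. pose proof (warp_pos m W rho Hr) as HM. set (c := m rho / 2).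
  assert (Hc : 0 < c < m rho) by (unfold c; lra).
  exists (rho + 1 + PI * V ^ 2 / c). intros R HR.
  assert (HPV : 0 <= PI * V ^ 2 / c).
  { apply Rdiv_le_0_compat; [|lra]. apply Rmult_le_pos; [pose proof PI_RGT_0; lra|apply pow2_ge_0]. }
  apply Rnot_lt_le. intros HV. pose proof (m_mono m W rho R ltac:(lra)).
  apply Hn. exists c, R. repeat split; try lra.
  apply Rlt_le_trans with (2 := swept_ge c rho R Hr ltac:(lra) ltac:(lra)).
  apply Rlt_le_trans with (c / V ^ 2 * (R - rho)).
  - replace PI with (c / V ^ 2 * (PI * V ^ 2 / c)) at 1 by (field; lra).
    apply Rmult_lt_compat_l; [|lra]. apply Rdiv_lt_0_compat; [lra|apply pow_lt; lra].
  - apply Rmult_le_compat_r; [lra|]. apply Rmult_le_compat_l; [lra|].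
    apply Rinv_le_contravar; [apply pow_lt; lra|]. apply pow_incr; lra.
Qed.

Lemma unbounded_dm_pos rho : 0 <= rho -> unbounded m -> 0 < Derive m rho.
Proof.
  intros Hr HU. pose proof (dm_ge0 m W rho Hr). destruct (Req_dec (Derive m rho) 0) as [E|]; [|lra].
  destruct (HU (m rho + 1)) as [R0 HR]. set (R := Rmax R0 rho).
  pose proof (Rmax_l R0 rho). pose proof (Rmax_r R0 rho). fold R in H0, H1.
  specialize (HR R H0). pose proof (m_tangent_le m W rho R ltac:(lra)). rewrite E in H2. lra.
Qed.

Lemma straight_tangent rho Th R : 0 < rho -> ~ bent rho -> ang m (m rho) rho Th -> rho <= R -> Th R <= PI.
Proof.
  intros Hr Hn Ha HR. apply Rnot_lt_le. intros Hlt.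
  pose proof (unbounded_dm_pos rho ltac:(lra) (straight_unbounded rho Hr Hn)) as Hd.
  assert (rho < R).
  { destruct (Req_dec rho R) as [E|]; [|lra]. destruct Ha as (_ & _ & T0). rewrite <- E, T0 in Hlt.
    pose proof PI_RGT_0. lra. }
  pose proof PI_RGT_0.
  destruct (tangent_swept_limit rho Th R PI Hr Hd Ha H ltac:(lra)) as [c [Hc Hs]].
  apply Hn. exists c, R. repeat split; lra.
Qed.

(** At a bent radius some geodesic reaches the opposite meridian exactly at radius [x]. With the
    same constant, the geodesic from [rho - e] turns even more, so [dist_lower] applies to it, and
    it has to cover the radii from [rho - e] to [rho] in addition. *)
Lemma bent_opposite rho : 0 < rho -> bent rho ->
  exists k e0, 0 < k /\ 0 < e0 < rho /\ forall e, 0 < e < e0 -> exists R0, rho <= R0 /\ forall x, R0 <= x ->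
    exists c, 0 <= c < m rho /\ swept m c rho x = PI /\
      arc m c rho (swept m c rho) x + k * e <= dist m (pol (rho - e) 0) (pol x PI).
Proof.
  intros Hr (cb & R1 & Hcb & HR1 & HPI). set (M := m rho) in *.
  pose proof (warp_pos m W rho Hr) as HM. fold M in HM.
  (* A value of [m] above [cb] that is still reached at [rho - e]; it keeps [jc] at least [2 * k]
     between [rho - e] and [rho]. *)
  set (m0 := (M + cb) / 2). assert (Hm0 : cb < m0 < M) by (unfold m0; lra).
  set (k := sqrt (1 - (cb / m0) ^ 2) / 2).
  assert (Hcm : 0 <= cb / m0 < 1).
  { split; [apply Rdiv_le_0_compat; lra|]. apply Rlt_div_l; lra. }
  assert (Hk : 0 < k) by (apply Rdiv_lt_0_compat; [apply sqrt_lt_R0; nra|lra]).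
  exists k, (Rmin (rho / 2) ((M - cb) / 2)). split; [exact Hk|]. split.
  { unfold Rmin. destruct Rle_dec; lra. }
  intros e He. assert (He' : 0 < e /\ e <= rho / 2 /\ e <= (M - cb) / 2).
  { pose proof (Rmin_l (rho / 2) ((M - cb) / 2)). pose proof (Rmin_r (rho / 2) ((M - cb) / 2)). lra. }
  assert (Hm1 : m0 <= m (rho - e)).
  { pose proof (m_diff_le m W (rho - e) rho ltac:(lra)). fold M in H. unfold m0. lra. }
  set (k0 := 1 - (cb / M) ^ 2).
  assert (Hk0 : 0 < k0).
  { assert (0 <= cb / M < 1) by (split; [apply Rdiv_le_0_compat; lra|apply Rlt_div_l; lra]). unfold k0. nra. }
  (* [m] may be bounded here, so [xi] alone need not decay. But a geodesic that needs a radial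
     distance of at least [N] to sweep [PI] has c N <= PI m(x)^2 by [swept_ge], and this [N] makes
     the error at most [k * e]. *)
  set (N := 4 * M ^ 3 * PI / (k0 * (k * e) ^ 2)).
  assert (Hke : 0 < k * e) by (apply Rmult_lt_0_compat; lra).
  assert (HN : 0 < N).
  { apply Rdiv_lt_0_compat; [|apply Rmult_lt_0_compat; [lra|apply pow_lt; lra]].
    apply Rmult_lt_0_compat; [|apply PI_RGT_0]. apply Rmult_lt_0_compat; [lra|apply pow_lt; lra]. }
  exists (Rmax R1 (rho + N)). split; [apply Rle_trans with (2 := Rmax_l _ _); lra|].
  intros x Hx. pose proof (Rmax_l R1 (rho + N)). pose proof (Rmax_r R1 (rho + N)).
  assert (HPx : PI <= swept m cb rho x).
  { apply Rle_trans with (swept m cb rho R1); [lra|].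
    apply (ang_mono m cb rho); [apply transverse_outgoing; auto|apply swept_ang; auto|lra]. }
  pose proof PI_RGT_0 as HPI0.
  destruct (swept_attains cb rho x PI Hr Hcb ltac:(lra) ltac:(lra)) as [c [Hc Es]].
  exists c. split; [fold M; lra|]. split; [exact Es|].
  assert (Hs0 : outgoing m c (rho - e)) by (apply transverse_outgoing; auto; lra).
  assert (Ha0 : ang m c (rho - e) (swept m c (rho - e))) by (apply swept_ang; auto; lra).
  assert (Ha1 : ang m c rho (swept m c rho)) by (apply swept_ang; auto; fold M; lra).
  (* The two angle functions have equal slopes beyond [rho], and the inner one is already
     nonnegative there. *)
  assert (HT : PI <= swept m c (rho - e) x).
  { rewrite <- Es. assert (swept m c (rho - e) rho - swept m c rho rho <= swept m c (rho - e) x - swept m c rho x).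
    - destruct Ha0 as (C0 & D0 & _). destruct Ha1 as (C1 & D1 & _).
      apply (monotone_of_derive (fun x => swept m c (rho - e) x - swept m c rho x) (fun _ => 0)); [lra| | |intros; lra].
      + intros t Ht. apply cont_minus; [apply C0|apply C1]; lra.
      + intros t Ht. evar_last; [apply (is_derive_minus (swept m c (rho - e)) (swept m c rho)); [apply D0|apply D1]; lra|].
        unfold minus, plus, opp; simpl. ring.
    - pose proof (ang_ge0 m c (rho - e) _ rho Hs0 Ha0 ltac:(lra)). destruct Ha1 as (_ & _ & Z). lra. }
  pose proof (dist_lower m W c (rho - e) x PI _ Hs0 Ha0 ltac:(lra) ltac:(lra) HT) as HL.
  unfold arc. rewrite Es. rewrite <- (J_chasles m W c (rho - e) rho x) in HL by lra.
  assert (HJ : 2 * k * e <= J m c (rho - e) rho).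
  { assert (2 * k * (rho - e) - J m c (rho - e) (rho - e) >= 2 * k * rho - J m c (rho - e) rho).
    2:{ rewrite J_point in H1. lra. }
    apply Rle_ge, Ropp_le_cancel.
    apply (monotone_of_derive (fun t => - (2 * k * t - J m c (rho - e) t)) (fun t => - (2 * k - jc m c t))); [lra| | |].
    - intros t Ht. apply cont_opp, cont_minus; [cont|].
      eapply is_derive_continuous, is_derive_J; [exact W|lra|lra].
    - intros t Ht. apply (is_derive_opp (fun t => 2 * k * t - J m c (rho - e) t)).
      apply (is_derive_minus (fun t => 2 * k * t) (J m c (rho - e))); [auto_derive; auto; ring|].
      apply is_derive_J; [exact W|lra|lra].
    - intros t Ht. assert (2 * k <= jc m c t); [|lra].
      unfold k, jc. replace (2 * (sqrt (1 - (cb / m0) ^ 2) / 2)) with (sqrt (1 - (cb / m0) ^ 2)) by field.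
      apply sqrt_le_1_alt. pose proof (m_mono m W (rho - e) t ltac:(lra)).
      assert (0 <= c / m t <= cb / m0).
      { split; [apply Rdiv_le_0_compat; lra|]. apply Rmult_le_compat; try lra.
        - apply Rlt_le, Rinv_0_lt_compat. lra.
        - apply Rinv_le_contravar; lra. }
      nra. }
  assert (Hxi : 2 * c * xi m c x <= k * e).
  { assert (Hmx : M <= m x) by (apply (m_mono m W); lra).
    pose proof (xi_range m c x ltac:(lra)) as Hx1. pose proof (qf_pos m c x ltac:(lra)) as Hq.
    pose proof (qf_sq m c x ltac:(lra)) as Eq.
    pose proof (swept_ge c rho x Hr ltac:(fold M; lra) ltac:(lra)) as Hsw. rewrite Es in Hsw.
    apply Rle_trans with (2 * c * (c / qf m c x)); [apply Rmult_le_compat_l; lra|].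
    apply Rsqr_incr_0_var; [|lra]. unfold Rsqr.
    assert (Hq2 : k0 * m x ^ 2 <= qf m c x * qf m c x).
    { rewrite Eq. unfold k0. assert (c ^ 2 <= (cb / M) ^ 2 * m x ^ 2); [|lra].
      replace ((cb / M) ^ 2 * m x ^ 2) with ((cb * (m x / M)) ^ 2) by (field; lra).
      apply pow_incr. split; [lra|]. assert (1 <= m x / M) by (apply Rle_div_r; lra). nra. }
    replace (2 * c * (c / qf m c x) * (2 * c * (c / qf m c x))) with (4 * c ^ 4 / (qf m c x * qf m c x)) by (field; lra).
    apply Rle_trans with (4 * c ^ 4 / (k0 * m x ^ 2)).
    { apply Rmult_le_compat_l; [pose proof (pow_le c 4 ltac:(lra)); lra|].
      apply Rinv_le_contravar; [|exact Hq2]. apply Rmult_lt_0_compat; [lra|apply pow_lt; lra]. }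
    apply Rle_div_l; [apply Rmult_lt_0_compat; [lra|apply pow_lt; lra]|].
    assert (H1 : c * N <= PI * m x ^ 2).
    { apply Rle_trans with (c * (x - rho)); [apply Rmult_le_compat_l; lra|].
      replace (c * (x - rho)) with (c / m x ^ 2 * (x - rho) * m x ^ 2) by (field; lra).
      apply Rmult_le_compat_r; [apply pow2_ge_0|exact Hsw]. }
    assert (H2 : 4 * c ^ 3 * PI <= N * (k0 * (k * e) ^ 2)).
    { unfold N. replace (4 * M ^ 3 * PI / (k0 * (k * e) ^ 2) * (k0 * (k * e) ^ 2)) with (4 * M ^ 3 * PI) by (field; lra).
      apply Rmult_le_compat_r; [lra|]. apply Rmult_le_compat_l; [lra|]. apply pow_incr; lra. }
    apply Rmult_le_reg_r with PI; [lra|].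
    replace (4 * c ^ 4 * PI) with (c * (4 * c ^ 3 * PI)) by ring.
    apply Rle_trans with (c * (N * (k0 * (k * e) ^ 2))); [apply Rmult_le_compat_l; lra|].
    replace (c * (N * (k0 * (k * e) ^ 2))) with ((c * N) * (k0 * (k * e) ^ 2)) by ring.
    apply Rle_trans with (PI * m x ^ 2 * (k0 * (k * e) ^ 2)); [|apply Req_le; ring].
    apply Rmult_le_compat_r; [|exact H1]. apply Rmult_le_pos; [lra|apply pow2_ge_0]. }
  lra.
Qed.

(** The gain at opposite points propagates to all far points: a curve from [rho - e] must cross the
    geodesic to the opposite point, or its mirror image, and every point of that barrier inherits
    the gain by the triangle inequality. *)
Lemma bent_drift rho : 0 < rho -> bent rho ->
  exists k e0, 0 < k /\ 0 < e0 < rho /\ forall e, 0 < e < e0 -> exists R0, forall phi Y, R0 <= nrm Y ->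
    dist m (pol rho phi) Y + k * e <= dist m (pol (rho - e) phi) Y.
Proof.
  intros Hr Hb. destruct (bent_opposite rho Hr Hb) as (k & e0 & Hk & He0 & H).
  exists k, e0. split; [exact Hk|]. split; [exact He0|]. intros e He.
  destruct (H e He) as (R0 & HR0 & Hx). exists R0. intros phi Y HY.
  destruct (pol_surj Y) as [b HYb]. set (R := nrm Y) in *. rewrite HYb.
  rewrite (dist_pol_diff m W rho), (dist_pol_diff m W (rho - e)). set (th := b - phi). clearbody th R.
  destruct (Hx R HY) as (c & Hc & Es & HL).
  assert (Ho : outgoing m c rho) by (apply transverse_outgoing; auto).
  assert (Ha : ang m c rho (swept m c rho)) by (apply swept_ang; auto).
  (* Beyond [R] the barrier follows the opposite meridian, whose points have geodesics of their
     own. *)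
  set (S := fun x => swept m c rho (Rmin x R)).
  assert (Hg : forall c x, 0 <= c < m rho -> rho <= x ->
    dist m (pol rho 0) (pol x (swept m c rho x)) <= arc m c rho (swept m c rho) x).
  { intros c' x Hc' Hxx.
    assert (Ho' : outgoing m c' rho) by (apply transverse_outgoing; auto).
    assert (Ha' : ang m c' rho (swept m c' rho)) by (apply swept_ang; auto).
    pose proof (geodesic_le m W c' rho _ rho x Ho' Ha' ltac:(lra)) as G.
    rewrite (arc_0 m c' rho _ Ha') in G. destruct Ha' as (_ & _ & Z). rewrite Z in G. lra. }
  apply (barrier m W S); try lra.
  - intros x Hxr. unfold S. apply (cont_comp (fun x => Rmin x R) (swept m c rho)).
    + apply lipschitz_continuous with 1. intros y. unfold Rmin, Rabs.
      repeat destruct Rle_dec; repeat destruct Rcase_abs; lra.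
    + apply Ha. apply Rmin_glb; lra.
  - unfold S. rewrite Rmin_left by lra. apply Ha.
  - intros x Hxr. unfold S. destruct (Rle_dec x R) as [Hle|Hgt].
    + rewrite Rmin_left by lra.
      pose proof (geodesic_le m W c rho _ x R Ho Ha ltac:(lra)) as G. rewrite Es in G.
      pose proof (dist_triangle m W (pol (rho - e) 0) (pol x (swept m c rho x)) (pol R PI)).
      pose proof (Hg c x Hc Hxr). lra.
    + rewrite Rmin_right by lra. rewrite Es.
      destruct (Hx x ltac:(lra)) as (c2 & Hc2 & Es2 & HL2).
      pose proof (Hg c2 x Hc2 Hxr) as G2. rewrite Es2 in G2. lra.
  - unfold S. rewrite Rmin_left, Es, cos_PI by lra. pose proof (COS_bound th). lra.
Qed.

End Warped.

(** * Rays and critical points *)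

Lemma acos_le_half_PI (y : R) : acos y <= PI / 2 <-> 0 <= y.
Proof.
  pose proof PI_RGT_0. unfold acos. destruct Rle_dec as [H1|H1]; [split; intros; lra|].
  destruct Rle_dec as [H2|H2]; [split; intros; lra|].
  assert (Hs : 0 < sqrt (1 - y²)) by (apply sqrt_lt_R0; unfold Rsqr; nra).
  split; intros H3.
  - apply Rnot_lt_le. intros Hy.
    assert (y / sqrt (1 - y²) < 0) by (apply Rlt_div_l; lra).
    pose proof (atan_increasing _ _ H0) as H4. rewrite atan_0 in H4. lra.
  - pose proof (atan_nonneg_le (y / sqrt (1 - y²)) ltac:(apply Rdiv_le_0_compat; lra)). lra.
Qed.

Lemma right_quotient_limit (f : R -> R) (a K d : R) : 0 < d ->
  (forall h, 0 < h <= d -> Rabs (f h - a * h) <= K * h ^ 2) ->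
  filterlim (fun h => f h / h) (at_right 0) (locally a).
Proof.
  intros Hd H. apply filterlim_locally. intros eps.
  assert (HK : 0 < Rabs K + 1) by (pose proof (Rabs_pos K); lra).
  assert (Hm : 0 < Rmin d (eps / (Rabs K + 1))).
  { apply Rmin_glb_lt; [easy|]. apply Rdiv_lt_0_compat; [apply cond_pos|easy]. }
  exists (mkposreal _ Hm). intros h Hh Hpos. simpl in Hh.
  apply (Rabs_def2 (h - 0)) in Hh. rewrite Rminus_0_r in Hh.
  pose proof (Rmin_l d (eps / (Rabs K + 1))). pose proof (Rmin_r d (eps / (Rabs K + 1))).
  specialize (H h ltac:(lra)). change (Rabs (f h / h - a) < eps).
  replace (f h / h - a) with ((f h - a * h) / h) by (field; lra).
  rewrite Rabs_div, (Rabs_pos_eq h) by lra. apply Rlt_div_l; [lra|].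
  apply Rle_lt_trans with (1 := H).
  assert (K * h ^ 2 <= (Rabs K + 1) * h * h).
  { pose proof (Rle_abs K). assert (0 <= h * h) by nra. simpl. nra. }
  assert ((Rabs K + 1) * h < eps).
  { apply Rlt_le_trans with ((Rabs K + 1) * (eps / (Rabs K + 1))).
    - apply Rmult_lt_compat_l; lra.
    - apply Req_le. field. lra. }
  nra.
Qed.

Lemma Rabs_sin_le (x : R) : Rabs (sin x) <= Rabs x.
Proof.
  assert (H : forall x, 0 <= x -> - x <= sin x <= x).
  { intros y Hy. split.
    - assert (sin 0 + 0 <= sin y + y); [|rewrite sin_0 in *; lra].
      apply (monotone_of_derive (fun t => sin t + t) (fun t => cos t + 1)); [lra| | |].
      + intros t _. pose proof (cont_sin t). cont.
      + intros t _. auto_derive; auto. ring.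
      + intros t _. pose proof (COS_bound t). lra.
    - destruct (Req_dec y 0) as [->|]; [rewrite sin_0; lra|]. pose proof (sin_lt_x y ltac:(lra)). lra. }
  destruct (Rle_dec 0 x).
  - rewrite (Rabs_pos_eq x) by lra. apply Rabs_le. now apply H.
  - specialize (H (- x) ltac:(lra)). rewrite sin_neg in H. rewrite (Rabs_left1 x) by lra. apply Rabs_le. lra.
Qed.

Lemma one_minus_cos_le (x : R) : 1 - cos x <= x ^ 2 / 2.
Proof.
  replace x with (2 * (x / 2)) at 1 by field. rewrite cos_2a_sin.
  pose proof (Rabs_sin_le (x / 2)) as H.
  apply Rsqr_le_abs_1 in H. unfold Rsqr in H. lra.
Qed.

Lemma sin_ge_quadratic (x : R) : 0 <= x <= 1 -> x - x ^ 2 <= sin x <= x.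
Proof.
  intros H. split.
  - assert (0 ^ 2 - 0 + sin 0 <= x ^ 2 - x + sin x); [|rewrite sin_0 in *; lra].
    apply (monotone_of_derive (fun t => t ^ 2 - t + sin t) (fun t => 2 * t - 1 + cos t)); [lra| | |].
    + intros t _. pose proof (cont_sin t). cont.
    + intros t _. auto_derive; auto. ring.
    + intros t Ht. pose proof (one_minus_cos_le t). nra.
  - destruct (Req_dec x 0) as [->|]; [rewrite sin_0; lra|]. pose proof (sin_lt_x x ltac:(lra)). lra.
Qed.

Section Warped.
Context (m : R -> R) (W : warp m).

Lemma ray_ortho al be sg q sigma : isortho al be sg -> ray m q sigma ->
  ray m (ortho al be sg q) (fun t => ortho al be sg (sigma t)).
Proof.
  intros Hi [H0 H1]. split; [now rewrite H0|]. intros s t Hs Ht.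
  rewrite (dist_ortho m W) by easy. now apply H1.
Qed.

Lemma init_vel_ortho al be sg sigma w : init_vel sigma w ->
  init_vel (fun t => ortho al be sg (sigma t)) (ortho al be sg w).
Proof.
  intros [H1 H2].
  assert (L : forall a b, filterlim
    (fun h => a * ((fst (sigma h) - fst (sigma 0)) / h) + b * ((snd (sigma h) - snd (sigma 0)) / h))
    (at_right 0) (locally (a * fst w + b * snd w))).
  { intros a b. eapply filterlim_comp_2; [| |apply (filterlim_plus (a * fst w) (b * snd w))].
    - eapply filterlim_comp; [exact H1|apply (filterlim_scal_r a (fst w))].
    - eapply filterlim_comp; [exact H2|apply (filterlim_scal_r b (snd w))]. }
  split; unfold ortho; simpl.
  - replace (al * fst w - sg * be * snd w) with (al * fst w + (- (sg * be)) * snd w) by ring.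
    eapply filterlim_ext; [|apply (L al (- (sg * be)))]. intros h. simpl. unfold Rdiv. ring.
  - eapply filterlim_ext; [|apply (L be (sg * al))]. intros h. simpl. unfold Rdiv. ring.
Qed.

Lemma arc_surj c rho Th t : outgoing m c rho -> ang m c rho Th -> 0 <= t ->
  exists x, rho <= x /\ arc m c rho Th x = t.
Proof.
  intros Ho Ha Ht.
  pose proof (arc_expand m W c rho Th rho (rho + t) Ho Ha ltac:(lra)) as HE. rewrite (arc_0 m c rho Th Ha) in HE.
  destruct (intermediate_value (arc m c rho Th) rho (rho + t) t) as [x [Hx E]]; [lra| | |].
  - intros x Hx. apply (arc_continuous m W); auto; lra.
  - rewrite (arc_0 m c rho Th Ha). lra.
  - exists x. split; [lra|easy].
Qed.

Lemma J_le c a b : 0 < a <= b -> J m c a b <= b - a.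
Proof.
  intros H. unfold J. replace (b - a) with (RInt (fun _ => 1) a b).
  - apply RInt_le; [lra|apply (ex_RInt_jc m W); lra|apply ex_RInt_const|intros; apply jc_le1].
  - rewrite RInt_const. unfold scal; simpl; unfold mult; simpl. ring.
Qed.

(** The tangential geodesic leaves the circle only quadratically in its length h: with u = x - rho,
    the angle is at least of order u / [qf] and at most h / M, while [qf] squared is of order u.
    Hence the radial part of the initial velocity is 0. *)
Lemma tangent_estimate rho Th : 0 < rho -> 0 < Derive m rho -> ang m (m rho) rho Th ->
  exists K, 0 <= K /\ forall x, rho <= x -> arc m (m rho) rho Th x <= 1 ->
    x - rho <= K * arc m (m rho) rho Th x ^ 2.
Proof.
  intros Hr Hd Ha. pose proof (tangent_outgoing m W rho Hr Hd) as Ho.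
  pose proof Ha as (TC & TD & T0). set (M := m rho) in *. pose proof (warp_pos m W rho Hr) as HM. fold M in HM.
  set (K := (M + 1) ^ 2 * (2 * M + 1) / M ^ 4).
  assert (HK : 0 < K) by (apply Rdiv_lt_0_compat; [apply Rmult_lt_0_compat; [apply pow_lt|]; lra|apply pow_lt; lra]).
  exists K. split; [lra|]. intros x Hx Hh. set (h := arc m M rho Th x) in *.
  pose proof (arc_expand m W M rho Th rho x Ho Ha ltac:(lra)) as HE. rewrite (arc_0 m M rho Th Ha) in HE. fold h in HE.
  destruct (Req_dec x rho) as [->|Hne]; [nra|].
  set (u := x - rho) in *. assert (Hu : 0 < u <= 1) by (unfold u in *; lra).
  assert (Hmx : M < m x) by (apply Ho; unfold u in *; lra).
  assert (Hmx2 : m x <= M + u) by (pose proof (m_diff_le m W rho x ltac:(lra)); unfold M, u; lra).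
  pose proof (qf_pos m M x ltac:(lra)) as Hq. pose proof (qf_sq m M x ltac:(lra)) as Eq.
  assert (Hq2 : qf m M x * qf m M x <= (2 * M + 1) * u) by (rewrite Eq; nra).
  assert (HTh : M / (m x * qf m M x) * u <= Th x).
  { assert (Th rho - M / (m x * qf m M x) * rho <= Th x - M / (m x * qf m M x) * x); [|unfold u; lra].
    apply (monotone_of_derive (fun t => Th t - M / (m x * qf m M x) * t)
      (fun t => M / (m t * qf m M t) - M / (m x * qf m M x))); [lra| | |].
    - intros t Ht. apply cont_minus; [apply TC; lra|cont].
    - intros t Ht. apply (is_derive_minus Th (fun t => M / (m x * qf m M x) * t)); [apply TD; lra|apply is_derive_lin].
    - intros t Ht. pose proof (outgoing_qf m M rho t Ho ltac:(lra)). pose proof (m_mono m W t x ltac:(lra)).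
      pose proof (m_mono m W rho t ltac:(lra)). fold M in H1. pose proof (qf_mono m W M t x ltac:(lra)).
      assert (M / (m x * qf m M x) <= M / (m t * qf m M t)); [|lra].
      apply Rmult_le_compat_l; [lra|]. apply Rinv_le_contravar; [apply Rmult_lt_0_compat; lra|].
      apply Rmult_le_compat; lra. }
  assert (HhM : M * Th x <= h).
  { unfold h, arc. pose proof (J_ge0 m W M rho x ltac:(lra)). lra. }
  assert (H1 : M ^ 2 * u <= h * (m x * qf m M x)).
  { apply Rmult_le_compat_l with (r := M) in HTh; [|lra].
    apply Rmult_le_reg_r with (/ (m x * qf m M x)).
    - apply Rinv_0_lt_compat, Rmult_lt_0_compat; lra.
    - replace (h * (m x * qf m M x) * / (m x * qf m M x)) with h by (field; lra).
      replace (M ^ 2 * u * / (m x * qf m M x)) with (M * (M / (m x * qf m M x) * u)) by (field; lra). lra. }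
  assert (H2 : (M ^ 2 * u) ^ 2 <= h ^ 2 * ((M + 1) ^ 2 * ((2 * M + 1) * u))).
  { apply Rle_trans with ((h * (m x * qf m M x)) ^ 2).
    - apply pow_incr. split; [|exact H1]. apply Rmult_le_pos; [apply pow2_ge_0|lra].
    - replace ((h * (m x * qf m M x)) ^ 2) with (h ^ 2 * ((m x) ^ 2 * (qf m M x * qf m M x))) by ring.
      apply Rmult_le_compat_l; [apply pow2_ge_0|].
      apply Rmult_le_compat; [apply pow2_ge_0|nra|apply pow_incr; lra|exact Hq2]. }
  unfold K. apply Rmult_le_reg_r with (M ^ 4 * u); [apply Rmult_lt_0_compat; [apply pow_lt|]; lra|].
  replace ((M + 1) ^ 2 * (2 * M + 1) / M ^ 4 * h ^ 2 * (M ^ 4 * u)) with (h ^ 2 * ((M + 1) ^ 2 * ((2 * M + 1) * u)))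
    by (field; lra).
  apply Rle_trans with (2 := H2). apply Req_le. ring.
Qed.

(** (0, rho / m rho) is the unit vector tangent to the circle; the velocity is obtained from error
    terms of second order in the time. *)
Lemma tangent_ray rho : 0 < rho -> ~ bent m rho ->
  exists sigma, ray m (pol rho 0) sigma /\ init_vel sigma (0, rho / m rho).
Proof.
  intros Hr Hn. pose proof (straight_unbounded m W rho Hr Hn) as HU.
  pose proof (unbounded_dm_pos m W rho ltac:(lra) HU) as Hd.
  destruct (tangent_ang m W rho Hr Hd) as [Th Ha]. pose proof (tangent_outgoing m W rho Hr Hd) as Ho.
  destruct (outgoing_ray m W (m rho) rho Th Ho Ha HU) as [sigma [Hs HsR]].
  { intros R HR. now apply (straight_tangent m W rho). }
  exists sigma. split; [exact Hs|].
  set (M := m rho) in *. pose proof (warp_pos m W rho Hr) as HM. fold M in HM.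
  destruct (tangent_estimate rho Th Hr Hd Ha) as [K [HK HKx]]. fold M in HKx.
  destruct Hs as [Hs0 _].
  assert (Hest : forall h, 0 < h <= Rmin 1 M -> exists x th, sigma h = pol x th /\ 0 <= x - rho <= K * h ^ 2 /\
     0 <= th <= 1 /\ M * th <= h /\ h - M * th <= K * h ^ 2).
  { intros h Hh. pose proof (Rmin_l 1 M). pose proof (Rmin_r 1 M).
    destruct (arc_surj M rho Th h Ho Ha ltac:(lra)) as [x [Hx Ex]].
    exists x, (Th x). rewrite <- Ex at 1. split; [now apply HsR|].
    specialize (HKx x Hx ltac:(lra)). rewrite Ex in HKx.
    pose proof (ang_ge0 m M rho Th x Ho Ha Hx).
    assert (HJ : 0 <= J m M rho x <= x - rho) by (split; [apply (J_ge0 m W)|apply J_le]; lra).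
    assert (HMT : M * Th x <= h) by (unfold arc in Ex; lra).
    repeat split; try lra; [nra|]. unfold arc in Ex. lra. }
  pose proof (Rmin_l 1 M). pose proof (Rmin_r 1 M).
  assert (Hd0 : 0 < Rmin 1 M) by (apply Rmin_glb_lt; lra).
  unfold init_vel. rewrite Hs0. unfold pol; simpl. rewrite cos_0, sin_0, Rmult_1_r, Rmult_0_r. split.
  - apply (right_quotient_limit (fun h => fst (sigma h) - rho) 0 (K + rho / M ^ 2) (Rmin 1 M) Hd0).
    intros h Hh. destruct (Hest h Hh) as (x & th & -> & Hx & Hth & H1 & H2). unfold pol; simpl fst.
    pose proof (one_minus_cos_le th). pose proof (COS_bound th).
    assert (Ht2 : th ^ 2 <= h ^ 2 / M ^ 2).
    { replace (h ^ 2 / M ^ 2) with ((h / M) ^ 2) by (field; lra).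
      apply pow_incr. split; [lra|]. apply (Rle_div_r th h M); lra. }
    replace (x * cos th - rho - 0 * h) with ((x - rho) * cos th - rho * (1 - cos th)) by ring.
    apply Rle_trans with (1 := Rabs_triang _ _). rewrite Rabs_Ropp, !Rabs_mult.
    rewrite (Rabs_pos_eq (x - rho)), (Rabs_pos_eq rho), (Rabs_pos_eq (1 - cos th)) by lra.
    assert (Rabs (cos th) <= 1) by (apply Rabs_le; lra).
    assert ((x - rho) * Rabs (cos th) <= K * h ^ 2).
    { apply Rle_trans with ((x - rho) * 1); [apply Rmult_le_compat_l; lra|lra]. }
    assert (rho * (1 - cos th) <= rho * (h ^ 2 / M ^ 2)).
    { apply Rmult_le_compat_l; [lra|]. pose proof (pow2_ge_0 th). lra. }
    replace ((K + rho / M ^ 2) * h ^ 2) with (K * h ^ 2 + rho * (h ^ 2 / M ^ 2)) by (field; lra). lra.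
  - apply (filterlim_ext (fun h => snd (sigma h) / h)); [intros h; now rewrite Rminus_0_r|].
    apply (right_quotient_limit (fun h => snd (sigma h)) (rho / M) (K + rho / M ^ 2 + rho * K / M) (Rmin 1 M) Hd0).
    intros h Hh. destruct (Hest h Hh) as (x & th & -> & Hx & Hth & H1 & H2). unfold pol; simpl snd.
    pose proof (sin_ge_quadratic th Hth) as Hsin.
    assert (Ht2 : th ^ 2 <= h ^ 2 / M ^ 2).
    { replace (h ^ 2 / M ^ 2) with ((h / M) ^ 2) by (field; lra).
      apply pow_incr. split; [lra|]. apply (Rle_div_r th h M); lra. }
    replace (x * sin th - rho / M * h) with ((x - rho) * sin th - (rho * (th - sin th) + rho / M * (h - M * th)))
      by (field; lra).
    assert (A1 : 0 <= (x - rho) * sin th <= K * h ^ 2).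
    { assert (0 <= sin th) by nra. split; [apply Rmult_le_pos; lra|].
      apply Rle_trans with ((x - rho) * 1); [apply Rmult_le_compat_l; lra|lra]. }
    assert (A2 : 0 <= rho * (th - sin th) <= rho * (h ^ 2 / M ^ 2)).
    { split; [apply Rmult_le_pos; lra|]. apply Rmult_le_compat_l; lra. }
    assert (HrM : 0 < rho / M) by (apply Rdiv_lt_0_compat; lra).
    assert (A3 : 0 <= rho / M * (h - M * th) <= rho / M * (K * h ^ 2)).
    { split; [apply Rmult_le_pos; lra|]. apply Rmult_le_compat_l; lra. }
    replace ((K + rho / M ^ 2 + rho * K / M) * h ^ 2) with (K * h ^ 2 + rho * (h ^ 2 / M ^ 2) + rho / M * (K * h ^ 2))
      by (field; lra).
    apply Rabs_le. lra.
Qed.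

Lemma angle_le_half_PI q u v : 0 <= gmet m q u v -> angle m q u v <= PI / 2.
Proof.
  intros H. unfold angle. apply acos_le_half_PI. unfold Rdiv. apply Rmult_le_pos; [exact H|].
  assert (Hg : 0 <= gnorm m q u * gnorm m q v) by (apply Rmult_le_pos; apply sqrt_pos).
  destruct (Req_dec (gnorm m q u * gnorm m q v) 0) as [->|]; [rewrite Rinv_0; lra|].
  apply Rlt_le, Rinv_0_lt_compat. lra.
Qed.

Lemma meridian_ray a : ray m (0, 0) (fun t => pol t a).
Proof.
  split; [unfold pol; f_equal; ring|]. intros s t Hs Ht. now apply (dist_radial m W).
Qed.

Lemma frakC_origin : frakC m (0, 0).
Proof.
  intros v Hv. assert (N0 : nrm (0, 0) = 0).
  { unfold nrm, dot; simpl. now rewrite Rmult_0_l, Rplus_0_l, sqrt_0. }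
  rewrite gmet_origin in Hv by exact N0.
  destruct (pol_surj v) as [a Ha]. assert (Hn : nrm v = 1) by (unfold nrm; rewrite Hv; apply sqrt_1).
  rewrite Hn in Ha. exists (fun t => pol t a), v. split; [apply meridian_ray|]. split.
  - split.
    + apply (filterlim_ext_loc (fun _ => fst v)); [|apply filterlim_const].
      exists (mkposreal 1 Rlt_0_1). intros h _ Hh. rewrite Ha. unfold pol; simpl. field. lra.
    + apply (filterlim_ext_loc (fun _ => snd v)); [|apply filterlim_const].
      exists (mkposreal 1 Rlt_0_1). intros h _ Hh. rewrite Ha. unfold pol; simpl. field. lra.
  - apply angle_le_half_PI. rewrite gmet_origin by exact N0. apply dot_self_ge0.
Qed.

(** Every direction makes an angle at most [PI/2] with one of the two unit vectors tangent to the parallel. *)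
Lemma frakC_of_straight rho phi : 0 < rho -> ~ bent m rho -> frakC m (pol rho phi).
Proof.
  intros Hr Hn v Hv. destruct (tangent_ray rho Hr Hn) as [sigma [Hs Hw]].
  pose proof (warp_pos m W rho Hr) as HM.
  set (q := pol rho phi) in *.
  assert (Nq : nrm q = rho) by (apply nrm_pol; lra).
  assert (H : forall be sg, isortho (cos phi) be sg -> ortho (cos phi) be sg (pol rho 0) = q ->
    0 <= gmet m q v (ortho (cos phi) be sg (0, rho / m rho)) ->
    exists sigma w, ray m q sigma /\ init_vel sigma w /\ angle m q v w <= PI / 2).
  { intros be sg Hi E Hg. exists (fun t => ortho (cos phi) be sg (sigma t)), (ortho (cos phi) be sg (0, rho / m rho)).
    rewrite <- E at 1. split; [now apply ray_ortho|]. split; [now apply init_vel_ortho|].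
    now apply angle_le_half_PI. }
  assert (G : forall e, gmet m q v (e * (rho / m rho) * - sin phi, e * (rho / m rho) * cos phi)
    = e * m rho * cross q v / rho ^ 2).
  { intros e. rewrite gmet_polar by lra. rewrite Nq.
    replace (dot q (e * (rho / m rho) * - sin phi, e * (rho / m rho) * cos phi)) with 0
      by (unfold dot, q, pol; simpl; ring).
    replace (cross q (e * (rho / m rho) * - sin phi, e * (rho / m rho) * cos phi)) with (e * rho ^ 2 / m rho).
    - field. lra.
    - unfold cross, q, pol; simpl. pose proof (sin2_cos2 phi) as E. unfold Rsqr in E.
      transitivity (e * rho ^ 2 / m rho * (sin phi * sin phi + cos phi * cos phi)); [rewrite E; field; lra|field; lra]. }
  assert (Hr2 : 0 < rho ^ 2) by (apply pow_lt; lra).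
  destruct (Rle_dec 0 (cross q v)) as [Hc|Hc].
  - apply (H (sin phi) 1).
    + apply rotate_iso.
    + unfold ortho, q, pol; simpl. rewrite cos_0, sin_0. f_equal; ring.
    + replace (ortho (cos phi) (sin phi) 1 (0, rho / m rho)) with
        (1 * (rho / m rho) * - sin phi, 1 * (rho / m rho) * cos phi) by (apply injective_projections; simpl; ring).
      rewrite G. apply Rdiv_le_0_compat; [|easy]. repeat apply Rmult_le_pos; lra.
  - apply (H (sin phi) (-1)).
    + split; [apply rotate_iso|ring].
    + unfold ortho, q, pol; simpl. rewrite cos_0, sin_0. f_equal; ring.
    + replace (ortho (cos phi) (sin phi) (-1) (0, rho / m rho)) with
        (-1 * (rho / m rho) * - sin phi, -1 * (rho / m rho) * cos phi) by (apply injective_projections; simpl; ring).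
      rewrite G. apply Rdiv_le_0_compat; [|easy].
      replace (-1 * m rho * cross q v) with (m rho * - cross q v) by ring. apply Rmult_le_pos; lra.
Qed.

End Warped.

(** * Initial velocities of rays; no ray leaves a bent radius inwards or tangentially *)

Lemma lim_eventually_lt (u : nat -> R) (l a : R) : is_lim_seq u l -> l < a -> eventually (fun n => u n < a).
Proof.
  intros H Hl. apply is_lim_seq_spec in H. assert (Hp : 0 < a - l) by lra.
  destruct (H (mkposreal _ Hp)) as [N HN]. exists N. intros n Hn. specialize (HN n Hn). simpl in HN.
  apply Rabs_def2 in HN. lra.
Qed.

Lemma lim_eventually_gt (u : nat -> R) (l a : R) : is_lim_seq u l -> a < l -> eventually (fun n => a < u n).
Proof.
  intros H Hl. apply is_lim_seq_spec in H. assert (Hp : 0 < l - a) by lra.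
  destruct (H (mkposreal _ Hp)) as [N HN]. exists N. intros n Hn. specialize (HN n Hn). simpl in HN.
  apply Rabs_def2 in HN. lra.
Qed.

Lemma lim_le (u v : nat -> R) (l l' : R) : is_lim_seq u l -> is_lim_seq v l' ->
  eventually (fun n => u n <= v n) -> l <= l'.
Proof. intros Hu Hv He. exact (is_lim_seq_le_loc u v l l' He Hu Hv). Qed.

Lemma lim_continuous (f : R -> R) (u : nat -> R) (l : R) : continuous f l -> is_lim_seq u l ->
  is_lim_seq (fun n => f (u n)) (f l).
Proof. intros Hf Hu. apply is_lim_seq_continuous; [now apply continuity_pt_filterlim|easy]. Qed.

Lemma lim_div (u v : nat -> R) (l k : R) : is_lim_seq u l -> is_lim_seq v k -> k <> 0 ->
  is_lim_seq (fun n => u n / v n) (l / k).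
Proof.
  intros Hu Hv Hk. apply is_lim_seq_mult'; [easy|].
  apply (lim_continuous Rinv v k); [|easy]. apply cont_inv; [apply cont_id|easy].
Qed.

Lemma lim_Rabs (u : nat -> R) (l : R) : is_lim_seq u l -> is_lim_seq (fun n => Rabs (u n)) (Rabs l).
Proof.
  apply lim_continuous. apply lipschitz_continuous with 1. intros. rewrite Rmult_1_l. apply Rabs_triang_inv2.
Qed.

Lemma cont_loc_pos (f : R -> R) x : continuous f x -> 0 < f x -> locally x (fun t => 0 < f t).
Proof.
  intros H Hx. destruct (proj1 (continuous_eps f x) H (f x) Hx) as [d [Hd1 Hd2]].
  exists (mkposreal d Hd1). intros y Hy. specialize (Hd2 y Hy). apply Rabs_def2 in Hd2. lra.
Qed.

Section Warped.
Context (m : R -> R) (W : warp m).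

Lemma polar_chord r1 r2 th : 0 < r1 -> 0 < r2 ->
  dist m (pol r1 0) (pol r2 th) <= sqrt ((r2 - r1) ^ 2 + (m (Rmax r1 r2) * th) ^ 2).
Proof.
  intros H1 H2. set (K := sqrt ((r2 - r1) ^ 2 + (m (Rmax r1 r2) * th) ^ 2)).
  assert (Hrr : forall t, 0 <= t <= 1 -> 0 < r1 + (r2 - r1) * t <= Rmax r1 r2).
  { intros t Ht. unfold Rmax. destruct Rle_dec; nra. }
  assert (HP : dist m (pol (r1 + (r2 - r1) * 0) (th * 0)) (pol (r1 + (r2 - r1) * 1) (th * 1)) <= K * 1 - K * 0).
  2:{ replace (r1 + (r2 - r1) * 0) with r1 in HP by ring. replace (r1 + (r2 - r1) * 1) with r2 in HP by ring.
      rewrite Rmult_0_r, Rmult_1_r in HP. lra. }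
  apply (polar_path_le m W (fun t => r1 + (r2 - r1) * t) (fun _ => r2 - r1) (fun t => th * t) (fun _ => th)
    (fun t => K * t) (fun _ => K)); [lra| | | | |].
  - intros t Ht. assert (L : locally t (fun u => 0 < r1 + (r2 - r1) * u)).
    { apply (cont_loc_pos (fun u => r1 + (r2 - r1) * u)); [cont|now apply Hrr]. }
    revert L. apply filter_imp. intros u Hu. split; [easy|].
    split; [auto_derive; auto; ring|apply is_derive_lin].
  - intros t _. split; apply cont_const.
  - intros t _. cont.
  - intros t _. apply is_derive_lin.
  - intros t Ht. specialize (Hrr t ltac:(lra)). apply sqrt_le_1_alt. apply Rplus_le_compat_l.
    rewrite !Rpow_mult_distr. apply Rmult_le_compat_r; [apply pow2_ge_0|].
    apply pow_incr. split; [apply (m_ge0 m W); lra|apply (m_mono m W); lra].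
Qed.

Lemma J_ge_const c a0 a b : 0 < a0 <= a -> a <= b -> 0 <= c <= m a0 ->
  sqrt (1 - (c / m a0) ^ 2) * (b - a) <= J m c a b.
Proof.
  intros H1 H2 Hc. pose proof (warp_pos m W a0 ltac:(lra)) as HM.
  set (k := sqrt (1 - (c / m a0) ^ 2)).
  replace (k * (b - a)) with (RInt (fun _ => k) a b).
  2:{ rewrite RInt_const. unfold scal; simpl; unfold mult; simpl. ring. }
  apply RInt_le; [lra|apply ex_RInt_const|apply (ex_RInt_jc m W); lra|].
  intros x Hx. unfold k, jc. apply sqrt_le_1_alt.
  pose proof (m_mono m W a0 x ltac:(lra)).
  assert (0 <= c / m x <= c / m a0).
  { split; [apply Rdiv_le_0_compat; lra|]. apply Rmult_le_compat_l; [lra|]. apply Rinv_le_contravar; lra. }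
  nra.
Qed.

(** A curve dipping below [rho - d] is longer than [d] already; any other curve is calibrated with
    constant [c]. *)
Lemma local_lower rho r th be c d : 0 < d < rho -> 0 < r -> 0 <= c <= m (rho - d) ->
  0 <= be <= PI -> cos be = cos th -> c * be + Rabs (r - rho) <= d ->
  c * be + sqrt (1 - (c / m (rho - d)) ^ 2) * Rabs (r - rho) <= dist m (pol rho 0) (pol r th).
Proof.
  intros Hd Hr Hc Hbe Hcos Hsmall. set (k := sqrt (1 - (c / m (rho - d)) ^ 2)).
  pose proof (warp_pos m W (rho - d) ltac:(lra)) as HM.
  assert (Hk : 0 <= k <= 1).
  { split; [apply sqrt_pos|]. unfold k. rewrite <- sqrt_1 at 2. apply sqrt_le_1_alt.
    pose proof (pow2_ge_0 (c / m (rho - d))). lra. }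
  apply (dist_ge_calibrated m W _ _ be); rewrite ?nrm_pol by lra; try lra.
  - rewrite dot_pol. replace (0 - th) with (- th) by ring. now rewrite cos_neg, Hcos.
  - intros r0 Hr0 Hr0r. destruct (Rle_dec (rho - d) r0) as [Hge|Hlt].
    + exists c. split; [pose proof (m_mono m W (rho - d) r0 ltac:(lra)); lra|].
      assert (k * Rabs (r - rho) <= J m c r0 rho + J m c r0 r); [|lra].
      destruct (Rle_dec rho r).
      * rewrite Rabs_pos_eq by lra. rewrite <- (J_chasles m W c r0 rho r) by lra.
        pose proof (J_ge0 m W c r0 rho ltac:(lra)).
        pose proof (J_ge_const c (rho - d) rho r ltac:(lra) ltac:(lra) ltac:(lra)). fold k in H0. lra.
      * rewrite Rabs_left1 by lra. rewrite <- (J_chasles m W c r0 r rho) by lra.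
        pose proof (J_ge0 m W c r0 r ltac:(lra)).
        pose proof (J_ge_const c (rho - d) r rho ltac:(lra) ltac:(lra) ltac:(lra)). fold k in H0. lra.
    + exists 0. split; [pose proof (m_ge0 m W r0 ltac:(lra)); lra|]. rewrite !J_0.
      pose proof (Rabs_pos (r - rho)). nra.
Qed.

(** Polar coordinates along a ray with an initial velocity, sampled at the times [1 / (n + 1)]. *)
Lemma ray_samples rho sigma w : 0 < rho -> ray m (pol rho 0) sigma -> init_vel sigma w ->
  exists s g u v : nat -> R,
    is_lim_seq s 0 /\ (forall n, 0 < s n) /\
    is_lim_seq g (fst w) /\ is_lim_seq u (Rabs (snd w) / rho) /\ is_lim_seq v (Rabs (snd w) / rho) /\
    eventually (fun n => exists t, - (PI / 2) < t < PI / 2 /\ 0 < rho + g n * s n /\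
       sigma (s n) = pol (rho + g n * s n) t /\
       u n * s n <= Rabs t <= v n * s n).
Proof.
  intros Hr [Hs0 _] [Hx Hy]. rewrite Hs0 in Hx, Hy. unfold pol in Hx, Hy; simpl in Hx, Hy.
  rewrite cos_0, Rmult_1_r in Hx. rewrite sin_0, Rmult_0_r in Hy.
  set (s := fun n => / (INR n + 1)).
  assert (Hsp : forall n, 0 < s n) by (intros n; apply Rinv_0_lt_compat; pose proof (pos_INR n); lra).
  assert (Hs : is_lim_seq s 0).
  { apply (is_lim_seq_ext (fun n => / INR (S n))); [intros n; unfold s; now rewrite S_INR|].
    apply (is_lim_seq_incr_1 (fun n => / INR n)).
    apply (is_lim_seq_inv INR p_infty); [apply is_lim_seq_INR|easy]. }
  assert (Hsr : filterlim s eventually (at_right 0)).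
  { intros P [d Hd]. apply is_lim_seq_spec in Hs. destruct (Hs d) as [N HN]. exists N. intros n Hn.
    apply Hd; [exact (HN n Hn)|apply Hsp]. }
  set (x := fun n => fst (sigma (s n))). set (y := fun n => snd (sigma (s n))).
  set (a := fun n => (x n - rho) / s n). set (b := fun n => y n / s n).
  assert (La : is_lim_seq a (fst w)) by exact (filterlim_comp _ _ _ s _ _ _ _ Hsr Hx).
  assert (Lb : is_lim_seq b (snd w)).
  { apply (is_lim_seq_ext (fun n => (y n - 0) / s n)); [intros n; unfold b; now rewrite Rminus_0_r|].
    exact (filterlim_comp _ _ _ s _ _ _ _ Hsr Hy). }
  assert (Lx : is_lim_seq x rho).
  { apply (is_lim_seq_ext (fun n => rho + a n * s n)).
    - intros n. unfold a. pose proof (Hsp n). field. lra.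
    - replace (Finite rho) with (Finite (rho + fst w * 0)) by (f_equal; ring).
      apply is_lim_seq_plus'; [apply is_lim_seq_const|now apply is_lim_seq_mult']. }
  assert (Ly : is_lim_seq y 0).
  { apply (is_lim_seq_ext (fun n => b n * s n)).
    - intros n. unfold b. pose proof (Hsp n). field. lra.
    - replace (Finite 0) with (Finite (snd w * 0)) by (f_equal; ring). now apply is_lim_seq_mult'. }
  set (r := fun n => nrm (sigma (s n))).
  assert (Er : forall n, r n = sqrt (x n * x n + y n * y n)) by reflexivity.
  assert (Lr : is_lim_seq r rho).
  { apply (is_lim_seq_ext (fun n => sqrt (x n * x n + y n * y n))); [intros n; now rewrite Er|].
    replace (Finite rho) with (Finite (sqrt (rho * rho + 0 * 0))).
    - apply (lim_continuous sqrt); [apply continuous_sqrt|].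
      apply is_lim_seq_plus'; now apply is_lim_seq_mult'.
    - f_equal. rewrite Rmult_0_l, Rplus_0_r. apply sqrt_square. lra. }
  assert (Hr0 : forall n, 0 <= r n) by (intros; apply nrm_ge0).
  assert (Err : forall n, r n * r n = x n * x n + y n * y n) by (intros; apply nrm_sq).
  set (g := fun n => (a n * (x n + rho) + b n * y n) / (r n + rho)).
  assert (Eg : forall n, rho + g n * s n = r n).
  { intros n. unfold g, a, b. pose proof (Hsp n). pose proof (Hr0 n). specialize (Err n).
    apply Rmult_eq_reg_r with (r n + rho); [|lra].
    transitivity (rho * (r n + rho) + ((x n * x n + y n * y n) - rho * rho)); [field; lra|].
    rewrite <- Err. ring. }
  exists s, g, (fun n => Rabs (b n) / r n), (fun n => Rabs (b n) / x n).
  split; [exact Hs|]. split; [exact Hsp|]. split; [|split; [|split]].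
  - replace (fst w) with ((fst w * (rho + rho) + snd w * 0) / (rho + rho)) by (field; lra).
    apply lim_div; [|apply is_lim_seq_plus'; [easy|apply is_lim_seq_const]|lra].
    apply is_lim_seq_plus'; apply is_lim_seq_mult'; auto. apply is_lim_seq_plus'; [easy|apply is_lim_seq_const].
  - apply lim_div; [now apply lim_Rabs|easy|lra].
  - apply lim_div; [now apply lim_Rabs|easy|lra].
  - apply filter_imp with (2 := lim_eventually_gt x rho 0 Lx Hr). intros n Hxn.
    exists (atan (y n / x n)). pose proof (atan_bound (y n / x n)). split; [lra|]. rewrite Eg.
    assert (Hrn : 0 < r n).
    { specialize (Hr0 n). specialize (Err n). destruct (Req_dec (r n) 0) as [E|]; [|lra]. rewrite E in Err. nra. }
    split; [exact Hrn|].
    assert (Esq : sqrt (1 + (y n / x n)²) = r n / x n).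
    { rewrite <- (sqrt_Rsqr (r n / x n)) by (apply Rdiv_le_0_compat; lra). f_equal. unfold Rsqr.
      transitivity ((x n * x n + y n * y n) / (x n * x n)); [field; lra|]. rewrite <- Err. field. lra. }
    assert (Esin : sin (atan (y n / x n)) = y n / r n) by (rewrite sin_atan, Esq; field; lra).
    assert (Ecos : cos (atan (y n / x n)) = x n / r n) by (rewrite cos_atan, Esq; field; lra).
    split.
    + unfold pol. rewrite Esin, Ecos. apply injective_projections; simpl; [unfold x|unfold y]; field; lra.
    + pose proof (Hsp n). split.
      * apply Rle_trans with (2 := Rabs_sin_le _). rewrite Esin. apply Req_le.
        unfold b. rewrite Rabs_div, Rabs_div by lra.
        rewrite (Rabs_pos_eq (s n)), (Rabs_pos_eq (r n)) by lra. field. lra.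
      * assert (HA : forall z, Rabs (atan z) <= Rabs z).
        { intros z. destruct (Rle_dec 0 z).
          - pose proof (atan_nonneg_le z r0). rewrite !Rabs_pos_eq; lra.
          - pose proof (atan_nonneg_le (- z) ltac:(lra)) as HZ. rewrite atan_opp in HZ. rewrite !Rabs_left1; lra. }
        apply Rle_trans with (1 := HA _). apply Req_le. unfold b. rewrite !Rabs_div by lra.
        rewrite (Rabs_pos_eq (s n)), (Rabs_pos_eq (x n)) by lra. field. lra.
Qed.

(** A ray is given by its distances alone. If its velocity had norm N > 1, a calibration nearly
    aligned with the velocity would make the distance covered in a short time exceed that time. *)
Lemma init_vel_norm_le rho sigma w : 0 < rho -> ray m (pol rho 0) sigma -> init_vel sigma w ->
  fst w ^ 2 + (m rho * (snd w / rho)) ^ 2 <= 1.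
Proof.
  intros Hr Hs Hw. pose proof (warp_pos m W rho Hr) as HM. set (M := m rho) in *.
  destruct (ray_samples rho sigma w Hr Hs Hw) as (s & g & u & v & Ls & Hsp & Lg & Lu & Lv & Hev).
  set (A := Rabs (fst w)). set (U := Rabs (snd w) / rho). fold U in Lu, Lv.
  assert (HA : 0 <= A) by apply Rabs_pos.
  assert (HU : 0 <= U) by (apply Rdiv_le_0_compat; [apply Rabs_pos|lra]).
  assert (Hcal : forall c d, 0 <= c -> 0 < d < rho -> c <= m (rho - d) ->
    c * U + sqrt (1 - (c / m (rho - d)) ^ 2) * A <= 1).
  { intros c d Hc Hd Hcd. set (k := sqrt (1 - (c / m (rho - d)) ^ 2)).
    apply (lim_le (fun n => c * u n + k * Rabs (g n)) (fun _ => 1)); [|apply is_lim_seq_const|].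
    - apply is_lim_seq_plus'; apply is_lim_seq_mult'; auto using is_lim_seq_const.
      now apply lim_Rabs.
    - assert (Lsm : is_lim_seq (fun n => c * (v n * s n) + Rabs (g n) * s n) 0).
      { replace (Finite 0) with (Finite (c * (U * 0) + Rabs (fst w) * 0)) by (f_equal; ring).
        apply is_lim_seq_plus'; apply is_lim_seq_mult'; auto using is_lim_seq_const, is_lim_seq_mult', lim_Rabs. }
      apply filter_imp with (2 := filter_and _ _ Hev (lim_eventually_lt _ _ d Lsm ltac:(lra))).
      intros n [(t & Ht & Hp & Es & Hu & Hv) Hsm]. specialize (Hsp n).
      destruct Hs as [Hs0 Hd0].
      pose proof (Hd0 0 (s n) ltac:(lra) ltac:(lra)) as Hdist.
      rewrite Hs0, Es, Rabs_left1 in Hdist by lra.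
      assert (Egs : Rabs (rho + g n * s n - rho) = Rabs (g n) * s n).
      { replace (rho + g n * s n - rho) with (g n * s n) by ring. rewrite Rabs_mult, (Rabs_pos_eq (s n)); lra. }
      pose proof (local_lower rho (rho + g n * s n) t (Rabs t) c d Hd Hp ltac:(lra)) as HL.
      rewrite Egs, Hdist in HL. fold k in HL.
      assert (Hct : c * (u n * s n) <= c * Rabs t <= c * (v n * s n)) by (split; apply Rmult_le_compat_l; lra).
      assert (HL' : c * Rabs t + k * (Rabs (g n) * s n) <= - (0 - s n)).
      { apply HL; [|unfold Rabs; destruct Rcase_abs; auto using cos_neg|lra].
        split; [apply Rabs_pos|]. pose proof PI_RGT_0. apply Rabs_le. lra. }
      apply Rmult_le_reg_r with (s n); [easy|]. lra. }
  set (N2 := A ^ 2 + (M * U) ^ 2).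
  assert (E : fst w ^ 2 + (M * (snd w / rho)) ^ 2 = N2).
  { unfold N2, A, U. rewrite pow2_abs. f_equal.
    replace ((M * (Rabs (snd w) / rho)) ^ 2) with ((M / rho) ^ 2 * Rabs (snd w) ^ 2) by (field; lra).
    rewrite pow2_abs. field. lra. }
  rewrite E. apply Rnot_lt_le. intros HN. set (N := sqrt N2).
  assert (HN1 : 1 < N) by (unfold N; rewrite <- sqrt_1; apply sqrt_lt_1_alt; lra).
  assert (ENN : N * N = N2) by (apply sqrt_sqrt; lra).
  set (B := M * U) in *. assert (HB : 0 <= B <= N).
  { assert (0 <= B) by (apply Rmult_le_pos; lra). split; [easy|]. unfold N2 in ENN. fold B in ENN. nra. }
  (* Strictly between 1 / N and 1, so that the resulting bound l2 N <= 1 is absurd. The factors [l]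
     pay for calibrating at the smaller radius [rho - d], where [m] is at least [l * M]. *)
  set (l2 := (1 + / N) / 2).
  assert (HiN : 0 < / N < 1) by (split; [apply Rinv_0_lt_compat; lra|rewrite <- Rinv_1; apply Rinv_lt_contravar; lra]).
  assert (Hl2 : / N < l2 < 1) by (unfold l2; lra).
  set (l := sqrt l2). assert (El : l * l = l2) by (apply sqrt_sqrt; lra).
  assert (Hl : 0 < l < 1).
  { split; [apply sqrt_lt_R0; lra|]. unfold l. rewrite <- sqrt_1. apply sqrt_lt_1_alt. lra. }
  set (d := Rmin (rho / 2) ((1 - l) * M)).
  assert (H1l : 0 < (1 - l) * M) by (apply Rmult_lt_0_compat; lra).
  assert (Hd : 0 < d < rho /\ d <= (1 - l) * M) by (unfold d, Rmin; destruct Rle_dec; lra).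
  assert (HmM : l * M <= m (rho - d)).
  { pose proof (m_diff_le m W (rho - d) rho ltac:(lra)). fold M in H. lra. }
  assert (HBN : 0 <= B / N <= 1) by (split; [apply Rdiv_le_0_compat; lra|apply Rle_div_l; lra]).
  set (c := l * l * (B / N) * M).
  assert (Hc : 0 <= c <= l * M).
  { unfold c. split; [apply Rmult_le_pos; [apply Rmult_le_pos; [rewrite El; lra|lra]|lra]|].
    replace (l * l * (B / N) * M) with (l * M * (l * (B / N))) by ring.
    rewrite <- (Rmult_1_r (l * M)) at 2. apply Rmult_le_compat_l; [apply Rmult_le_pos; lra|].
    apply Rle_trans with (1 * 1); [apply Rmult_le_compat; lra|lra]. }
  specialize (Hcal c d ltac:(lra) ltac:(lra) ltac:(lra)).
  assert (Hk : A / N <= sqrt (1 - (c / m (rho - d)) ^ 2)).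
  { assert (0 <= A / N) by (apply Rdiv_le_0_compat; lra).
    rewrite <- (sqrt_pow2 (A / N)) by easy. apply sqrt_le_1_alt.
    assert (Hcm : 0 <= c / m (rho - d) <= B / N).
    { pose proof (warp_pos m W (rho - d) ltac:(lra)). split; [apply Rdiv_le_0_compat; lra|].
      apply (Rle_div_l c (B / N) (m (rho - d))); [lra|].
      apply Rle_trans with (B / N * (l * M)); [|apply Rmult_le_compat_l; lra].
      unfold c. replace (l * l * (B / N) * M) with (B / N * (l * M) * l) by ring.
      rewrite <- (Rmult_1_r (B / N * (l * M))) at 2. apply Rmult_le_compat_l; [|lra].
      apply Rmult_le_pos; [lra|]. apply Rmult_le_pos; lra. }
    assert ((A / N) ^ 2 + (B / N) ^ 2 = 1).
    { replace ((A / N) ^ 2 + (B / N) ^ 2) with ((A ^ 2 + B ^ 2) / (N * N)) by (field; lra).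
      rewrite ENN. unfold N2. fold B. field. unfold N2 in HN. fold B in HN. lra. }
    nra. }
  assert (Hcu : c * U = l2 * (B * B / N)).
  { unfold c, B. rewrite <- El. unfold Rdiv. ring. }
  assert (HAk : A / N * A <= sqrt (1 - (c / m (rho - d)) ^ 2) * A) by (apply Rmult_le_compat_r; lra).
  assert (HA2 : l2 * (A * A / N) <= A / N * A).
  { replace (A / N * A) with (1 * (A * A / N)) by (field; lra). apply Rmult_le_compat_r; [|lra].
    apply Rdiv_le_0_compat; nra. }
  assert (HF : l2 * N <= 1).
  { replace (l2 * N) with (l2 * (A * A / N) + l2 * (B * B / N)); [lra|].
    transitivity (l2 * ((A ^ 2 + B ^ 2) / N)); [field; lra|]. change (A ^ 2 + B ^ 2) with N2. rewrite <- ENN. field. lra. }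
  assert (/ N * N < l2 * N) by (apply Rmult_lt_compat_r; lra).
  rewrite Rinv_l in H by lra. lra.
Qed.

(** By the drift, the point at [rho - k s] is at distance at least s (1 + k^2) from [sigma s].
    Comparing with a polar chord and letting s tend to 0 gives (1 + k^2)^2 <= |w|^2 + 2 k w_r + k^2
    <= 1 + k^2, with w_r <= 0 the radial velocity; this is false for k > 0. *)
Lemma inward_ray_straight rho sigma w : 0 < rho -> ray m (pol rho 0) sigma -> init_vel sigma w ->
  fst w <= 0 -> ~ bent m rho.
Proof.
  intros Hr Hs Hw Hw1 Hb. pose proof (init_vel_norm_le rho sigma w Hr Hs Hw) as Hnorm.
  destruct (bent_drift m W rho Hr Hb) as (k & e0 & Hk & He0 & Hdrift).
  (* The drift holds for far points only; it is applied far out on the ray and brought back to time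
     [s] by the triangle inequality. *)
  assert (HD : forall e s, 0 < e < e0 -> 0 <= s -> s + k * e <= dist m (pol (rho - e) 0) (sigma s)).
  { intros e s He Hs1. destruct (Hdrift e He) as [R0 HR0]. destruct Hs as [Hs0 Hd].
    set (t := s + Rabs R0 + rho). pose proof (Rabs_pos R0). pose proof (Rle_abs R0).
    assert (Ht : dist m (pol rho 0) (sigma t) = t).
    { rewrite <- Hs0, Hd by (unfold t; lra). rewrite Rabs_left1; unfold t; lra. }
    assert (Hn : R0 <= nrm (sigma t)).
    { pose proof (dist_triangle m W (pol rho 0) (pol 0 0) (sigma t)) as HT.
      rewrite dist_radial in HT by (auto; lra). rewrite Rabs_pos_eq in HT by lra.
      destruct (pol_surj (sigma t)) as [a Ha].
      assert (E : dist m (pol 0 0) (sigma t) = nrm (sigma t)).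
      { rewrite Ha at 1. replace (pol 0 0) with (pol 0 a) by (unfold pol; f_equal; ring).
        pose proof (nrm_ge0 (sigma t)). rewrite (dist_radial m W) by lra.
        rewrite Rabs_left1; lra. }
      unfold t in *. lra. }
    specialize (HR0 0 (sigma t) Hn). rewrite Ht in HR0.
    pose proof (dist_triangle m W (pol (rho - e) 0) (sigma s) (sigma t)) as HT.
    rewrite (Hd s t) in HT by (unfold t; lra). rewrite Rabs_left1 in HT by (unfold t; lra). lra. }
  destruct (ray_samples rho sigma w Hr Hs Hw) as (s & g & u & v & Ls & Hsp & Lg & Lu & Lv & Hev).
  pose proof (warp_pos m W rho Hr) as HM. set (M := m rho) in *.
  set (U := Rabs (snd w) / rho) in *.
  assert (HF : (1 + k * k) ^ 2 <= (fst w + k) ^ 2 + (M * U) ^ 2).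
  { apply (lim_le (fun _ => (1 + k * k) ^ 2) (fun n => (g n + k) ^ 2 + (m (Rmax rho (rho + g n * s n)) * v n) ^ 2)).
    - apply is_lim_seq_const.
    - assert (Lr : is_lim_seq (fun n => rho + g n * s n) rho).
      { replace (Finite rho) with (Finite (rho + fst w * 0)) by (f_equal; ring).
        apply is_lim_seq_plus'; [apply is_lim_seq_const|now apply is_lim_seq_mult']. }
      assert (LM : is_lim_seq (fun n => m (Rmax rho (rho + g n * s n))) M).
      { replace M with ((fun x => m (Rmax rho x)) rho) by (unfold M; now rewrite Rmax_left by lra).
        apply (lim_continuous (fun x => m (Rmax rho x)) (fun n => rho + g n * s n)); [|exact Lr].
        apply (cont_comp (Rmax rho) m); [|now apply m_continuous].
        apply lipschitz_continuous with 1. intros y. unfold Rmax, Rabs.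
        repeat destruct Rle_dec; repeat destruct Rcase_abs; lra. }
      assert (Lp : forall f (l : R), is_lim_seq f l -> is_lim_seq (fun n => f n ^ 2) (l ^ 2)).
      { intros f l Hf. apply (lim_continuous (fun x => x ^ 2)); [cont|exact Hf]. }
      apply is_lim_seq_plus'; apply Lp.
      + apply is_lim_seq_plus'; [easy|apply is_lim_seq_const].
      + now apply is_lim_seq_mult'.
    - assert (Lks : is_lim_seq (fun n => k * s n) 0).
      { replace (Finite 0) with (Finite (k * 0)) by (f_equal; ring). apply is_lim_seq_mult'; [apply is_lim_seq_const|easy]. }
      apply filter_imp with (2 := filter_and _ _ Hev (lim_eventually_lt _ _ e0 Lks ltac:(lra))).
      intros n [(t & Ht & Hp & Es & _ & Hv) He]. specialize (Hsp n).
      assert (He' : 0 < k * s n < e0) by (split; [apply Rmult_lt_0_compat|]; lra).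
      pose proof (HD (k * s n) (s n) He' ltac:(lra)) as H1. rewrite Es in H1.
      pose proof (polar_chord (rho - k * s n) (rho + g n * s n) t ltac:(lra) Hp) as H2.
      set (r := rho + g n * s n) in *.
      assert (H3 : (s n + k * (k * s n)) ^ 2 <= (r - (rho - k * s n)) ^ 2 + (m (Rmax (rho - k * s n) r) * t) ^ 2).
      { rewrite <- (pow2_sqrt ((r - (rho - k * s n)) ^ 2 + _)).
        - apply pow_incr. split; [nra|lra].
        - apply Rplus_le_le_0_compat; apply pow2_ge_0. }
      assert (H4 : (m (Rmax (rho - k * s n) r) * t) ^ 2 <= (m (Rmax rho r) * (v n * s n)) ^ 2).
      { rewrite <- (pow2_abs (_ * t)), Rabs_mult.
        pose proof (Rmax_r (rho - k * s n) r). pose proof (Rmax_l (rho - k * s n) r).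
        assert (0 <= m (Rmax (rho - k * s n) r)) by (apply (m_ge0 m W); lra).
        rewrite (Rabs_pos_eq (m _)) by easy.
        apply pow_incr. split; [apply Rmult_le_pos; [easy|apply Rabs_pos]|].
        apply Rmult_le_compat; [easy|apply Rabs_pos| |lra].
        apply (m_mono m W). split; [lra|]. apply Rmax_case; [apply Rle_trans with (2 := Rmax_l _ _); lra|apply Rmax_r]. }
      apply Rmult_le_reg_r with (s n ^ 2); [apply pow_lt; lra|].
      unfold r in H3.
      replace (rho + g n * s n - (rho - k * s n)) with ((g n + k) * s n) in H3 by ring.
      fold r in H3.
      replace ((1 + k * k) ^ 2 * s n ^ 2) with ((s n + k * (k * s n)) ^ 2) by ring.
      replace (((g n + k) ^ 2 + (m (Rmax rho r) * v n) ^ 2) * s n ^ 2) with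
        (((g n + k) * s n) ^ 2 + (m (Rmax rho r) * (v n * s n)) ^ 2) by ring. lra. }
  assert (HU2 : (M * U) ^ 2 = (M * (snd w / rho)) ^ 2).
  { unfold U. replace ((M * (Rabs (snd w) / rho)) ^ 2) with ((M / rho) ^ 2 * Rabs (snd w) ^ 2) by (field; lra).
    rewrite pow2_abs. field. lra. }
  nra.
Qed.

(** The condition defining the critical set is used for the inward radial vector only; it yields a
    ray that does not start outwards. *)
Lemma straight_of_frakC rho phi : 0 < rho -> frakC m (pol rho phi) -> ~ bent m rho.
Proof.
  intros Hr H. set (q := pol rho phi). assert (Nq : nrm q = rho) by (apply nrm_pol; lra).
  set (v := (- cos phi, - sin phi)).
  pose proof (sin2_cos2 phi) as E. unfold Rsqr in E.
  assert (Eqv : dot q v = - rho).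
  { unfold dot, q, v, pol; simpl. transitivity (- rho * (sin phi * sin phi + cos phi * cos phi)); [ring|rewrite E; ring]. }
  assert (Ecv : cross q v = 0) by (unfold cross, q, v, pol; simpl; ring).
  destruct (H v) as (sigma & w & Hs & Hw & Ha).
  { fold q. rewrite gmet_polar by lra. rewrite Nq, Eqv, Ecv. field. lra. }
  fold q in Hs, Ha.
  assert (Hg : gmet m q v w = - dot q w / rho).
  { rewrite gmet_polar by lra. rewrite Nq, Eqv, Ecv. field. lra. }
  assert (Hqw : dot q w <= 0).
  { apply Rnot_lt_le. intros Hlt. unfold angle in Ha. apply acos_le_half_PI in Ha.
    assert (Gv : gnorm m q v = 1).
    { unfold gnorm. rewrite gmet_polar by lra. rewrite Nq, Eqv, Ecv. replace (- rho * - rho / rho ^ 2 + m rho ^ 2 * (0 * 0) / rho ^ 4) with 1 by (field; lra). apply sqrt_1. }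
    assert (Gw : 0 < gnorm m q w).
    { apply sqrt_lt_R0. rewrite gmet_polar by lra. rewrite Nq.
      assert (0 < dot q w * dot q w / rho ^ 2).
      { apply Rdiv_lt_0_compat; [nra|apply pow_lt; lra]. }
      assert (0 <= m rho ^ 2 * (cross q w * cross q w) / rho ^ 4).
      { apply Rdiv_le_0_compat; [|apply pow_lt; lra]. apply Rmult_le_pos; [apply pow2_ge_0|nra]. }
      lra. }
    rewrite Hg, Gv, Rmult_1_l in Ha.
    assert (- dot q w / rho / gnorm m q w < 0); [|lra].
    apply (Rlt_div_l (- dot q w / rho) 0 (gnorm m q w)); [lra|]. rewrite Rmult_0_l.
    apply (Rlt_div_l (- dot q w) 0 rho); lra. }
  apply (inward_ray_straight rho (fun t => rotate (- phi) (sigma t)) (rotate (- phi) w) Hr).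
  - replace (pol rho 0) with (rotate (- phi) q) by (unfold q; rewrite rotate_pol; f_equal; ring).
    apply (ray_ortho m W); [apply rotate_iso|exact Hs].
  - apply init_vel_ortho, Hw.
  - unfold rotate, ortho; simpl. rewrite cos_neg, sin_neg.
    unfold dot, q, pol in Hqw; simpl in Hqw.
    apply Rmult_le_reg_l with rho; [lra|]. lra.
Qed.

End Warped.

(** * Souls have radius that is not bent *)

Lemma edist_le (x y : pt) : edist x y <= Rabs (fst x - fst y) + Rabs (snd x - snd y).
Proof.
  unfold edist. pose proof (Rabs_pos (fst x - fst y)). pose proof (Rabs_pos (snd x - snd y)).
  rewrite <- (sqrt_pow2 (Rabs (fst x - fst y) + Rabs (snd x - snd y))) by lra. apply sqrt_le_1_alt.
  rewrite <- (pow2_abs (fst x - fst y)), <- (pow2_abs (snd x - snd y)). nra.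
Qed.

Section Warped.
Context (m : R -> R) (W : warp m).

Lemma dist_le_nrm x y : dist m x y <= nrm x + nrm y.
Proof.
  destruct (pol_surj x) as [a Ha]. destruct (pol_surj y) as [b Hb].
  pose proof (nrm_ge0 x). pose proof (nrm_ge0 y).
  apply Rle_trans with (1 := dist_triangle m W x (pol 0 a) y).
  assert (E1 : dist m x (pol 0 a) = nrm x).
  { rewrite Ha at 1. rewrite (dist_radial m W) by lra. rewrite Rabs_pos_eq; lra. }
  assert (E2 : dist m (pol 0 a) y = nrm y).
  { replace (pol 0 a) with (pol 0 b) by (unfold pol; f_equal; ring).
    rewrite Hb at 1. rewrite (dist_radial m W) by lra. rewrite Rabs_left1; lra. }
  lra.
Qed.

Lemma ray_dist p sigma t : ray m p sigma -> 0 <= t -> dist m p (sigma t) = t.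
Proof. intros [<- Hd] Ht. rewrite Hd by lra. rewrite Rabs_left1; lra. Qed.

Lemma nrm_ray p sigma t : ray m p sigma -> 0 <= t -> t - nrm p <= nrm (sigma t).
Proof.
  intros Hs Ht. pose proof (dist_le_nrm p (sigma t)). rewrite (ray_dist p sigma t Hs Ht) in H. lra.
Qed.

(** The limit of [dist m (sigma t) x - t] is the Busemann function of the ray. By this monotonicity
    the horoball condition can be tested at arbitrarily late times, where the estimates for far
    points apply. *)
Lemma ray_push p sigma x s t : ray m p sigma -> 0 <= s <= t ->
  dist m (sigma t) x - t <= dist m (sigma s) x - s.
Proof.
  intros [_ Hd] Hst. pose proof (dist_triangle m W (sigma t) (sigma s) x) as H.
  rewrite (Hd t s), Rabs_pos_eq in H by lra. lra.
Qed.

Lemma not_C0 p x : ~ C0 m p x -> exists sigma t, ray m p sigma /\ 0 <= t /\ dist m (sigma t) x < t.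
Proof.
  intros H. apply NNPP. intros Hn. apply H. intros sigma Hs t Ht. apply Rnot_lt_le. intros Hlt.
  apply Hn. exists sigma, t. auto.
Qed.

Lemma distset_glb (A : set_pt) x : (exists a, A a) ->
  (forall a, A a -> distset m A x <= dist m x a) /\
  (forall l, (forall a, A a -> l <= dist m x a) -> l <= distset m A x).
Proof.
  intros [a0 Ha0]. unfold distset. set (E := fun r => exists y, A y /\ r = dist m x y).
  pose proof (Glb_Rbar_correct E) as [H1 H2].
  destruct (Glb_Rbar E) as [d| |]; simpl in *.
  - split.
    + intros a Ha. apply (H1 (dist m x a)). now exists a.
    + intros l Hl. apply (H2 (Finite l)). intros r [a [Ha ->]]. now apply Hl.
  - exfalso. apply (H1 (dist m x a0)). now exists a0.
  - exfalso. apply (H2 (Finite 0)). intros r [a [Ha ->]]. now apply (dist_ge0 m W).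
Qed.

Lemma curve_edist c t e : C1curve c -> 0 <= t <= 1 -> 0 < e ->
  exists d, 0 < d /\ forall s, Rabs (s - t) < d -> edist (c t) (c s) < e.
Proof.
  intros HC Ht He. destruct (C1on_cont c 0 1 t HC Ht) as (X & Y & _).
  destruct (proj1 (continuous_eps _ _) X (e / 2) ltac:(lra)) as [d1 [H1 K1]].
  destruct (proj1 (continuous_eps _ _) Y (e / 2) ltac:(lra)) as [d2 [H2 K2]].
  exists (Rmin d1 d2). split; [now apply Rmin_glb_lt|]. intros s Hs.
  pose proof (Rmin_l d1 d2). pose proof (Rmin_r d1 d2).
  specialize (K1 s ltac:(lra)). specialize (K2 s ltac:(lra)).
  apply Rle_lt_trans with (1 := edist_le _ _).
  rewrite (Rabs_minus_sym (fst (c t))), (Rabs_minus_sym (snd (c t))). unfold cx, cy in *. lra.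
Qed.

(** Horoballs are open, so the point where the curve last belongs to the set still lies in it, but
    not in its interior. *)
Lemma curve_leaves p (S : set_pt) c : (forall x, S x <-> C0 m p x) -> C1curve c -> S (c 0) -> ~ S (c 1) ->
  exists t, 0 <= t <= 1 /\ S (c t) /\ ~ tint S (c t).
Proof.
  intros HS HC H0 H1.
  set (E := fun t => 0 <= t <= 1 /\ forall s, 0 <= s <= t -> S (c s)).
  destruct (completeness E) as [t [Hub Hl]].
  - exists 1. intros x [Hx _]. lra.
  - exists 0. split; [lra|]. intros s Hs. now replace s with 0 by lra.
  - assert (Ht : 0 <= t <= 1).
    { split; [apply Hub; split; [lra|]; intros s Hs; now replace s with 0 by lra|].
      apply Hl. intros x [Hx _]; lra. }
    assert (Hlt : forall s, 0 <= s < t -> S (c s)).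
    { intros s Hs. apply NNPP. intros Hn. assert (t <= s); [|lra]. apply Hl. intros x [Hx Hxs].
      apply Rnot_lt_le. intros Hsx. apply Hn, Hxs. lra. }
    assert (HSt : S (c t)).
    { apply NNPP. intros Hn. destruct (Req_dec t 0) as [E0|E0]; [now rewrite E0 in Hn|].
      destruct (not_C0 p (c t)) as (sigma & u & Hs & Hu & Hd); [now rewrite <- HS|].
      destruct (curve_edist c t (u - dist m (sigma u) (c t)) HC Ht ltac:(lra)) as [d [Hd1 Hd2]].
      set (s := Rmax 0 (t - d / 2)).
      assert (Hs1 : 0 <= s < t /\ t - d < s) by (unfold s, Rmax; destruct Rle_dec; lra).
      specialize (Hd2 s ltac:(rewrite Rabs_left1; lra)).
      pose proof (proj1 (HS _) (Hlt s ltac:(lra)) sigma Hs u Hu) as Hge.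
      pose proof (dist_triangle m W (sigma u) (c t) (c s)). pose proof (dist_le_edist m W (c t) (c s)). lra. }
    exists t. split; [exact Ht|]. split; [exact HSt|]. intros [e [He Hi]].
    destruct (curve_edist c t e HC Ht He) as [d [Hd1 Hd2]].
    destruct (Req_dec t 1) as [E1|E1]; [now rewrite E1 in HSt|].
    set (s := Rmin 1 (t + d / 2)).
    assert (Hs1 : t < s <= 1 /\ s < t + d) by (unfold s, Rmin; destruct Rle_dec; lra).
    assert (s <= t); [|lra]. apply Hub. split; [lra|]. intros u Hu.
    destruct (Rlt_dec u t); [apply Hlt; lra|]. apply Hi, Hd2. rewrite Rabs_right; lra.
Qed.

(** Depth is measured by Busemann functions, and each of them gains [k * e] from [q] to [y]. If the
    construction stops at once, [y] is a second point of the soul. Otherwise [y] is an interior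
    point of the first set, so that its boundary is the topological one, and [y] is farther from it
    than [q]. *)
Lemma straight_of_soul p q : q <> (0, 0) -> soul_of m p (fun x => x = q) -> ~ bent m (nrm q).
Proof.
  intros Hq0 (C & n & HC0 & Hstep & Hend & Hfin) Hb.
  assert (Hr : 0 < nrm q).
  { pose proof (nrm_ge0 q). destruct (Req_dec (nrm q) 0) as [E|]; [|lra]. now apply nrm0 in E. }
  destruct (pol_surj q) as [phi Hphi]. set (rho := nrm q) in *.
  destruct (bent_drift m W rho Hr Hb) as (k & e0 & Hk & He0 & Hdrift).
  set (e := e0 / 2). destruct (Hdrift e ltac:(unfold e; lra)) as [R0 HR0].
  set (y := pol (rho - e) phi).
  assert (Hke : 0 < k * e) by (apply Rmult_lt_0_compat; unfold e; lra).
  (* A point at depth [d] for a ray gains [k * e] of depth when moved to [y]. *)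
  assert (HA : forall d sigma, ray m p sigma -> (forall t, 0 <= t -> t + d <= dist m (sigma t) q) ->
    forall t, 0 <= t -> t + d + k * e <= dist m (sigma t) y).
  { intros d sigma Hs Hd t Ht. set (t' := t + Rabs R0 + nrm p).
    pose proof (Rabs_pos R0). pose proof (Rle_abs R0). pose proof (nrm_ge0 p).
    pose proof (nrm_ray p sigma t' Hs ltac:(unfold t'; lra)).
    pose proof (HR0 phi (sigma t') ltac:(unfold t' in *; lra)) as H3. rewrite <- Hphi in H3.
    fold y in H3. rewrite !(dist_sym m W _ (sigma t')) in H3.
    pose proof (Hd t' ltac:(unfold t'; lra)).
    pose proof (ray_push p sigma y t t' Hs ltac:(unfold t'; lra)). lra. }
  assert (Hin : forall i, (i <= n)%nat -> C (n - i)%nat q).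
  { induction i as [|i IH]; intros Hi.
    - rewrite PeanoNat.Nat.sub_0_r. now apply Hfin.
    - specialize (IH ltac:(lia)). destruct (Hstep (n - S i)%nat ltac:(lia)) as [_ HS].
      replace (S (n - S i))%nat with (n - i)%nat in HS by lia. apply HS in IH. apply IH. }
  assert (Hq : C 0%nat q) by (specialize (Hin n (le_n n)); now rewrite PeanoNat.Nat.sub_diag in Hin).
  assert (HqC : forall sigma, ray m p sigma -> forall t, 0 <= t -> t <= dist m (sigma t) q) by now apply HC0.
  assert (Hyint : tint (C 0%nat) y).
  { exists (k * e). split; [exact Hke|]. intros z Hz. apply HC0. intros sigma Hs t Ht.
    pose proof (HA 0 sigma Hs ltac:(intros; rewrite Rplus_0_r; now apply HqC) t Ht).
    pose proof (dist_triangle m W (sigma t) z y). pose proof (dist_le_edist m W y z).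
    rewrite (dist_sym m W z y) in *. lra. }
  assert (Hy : C 0%nat y).
  { destruct Hyint as [r [Hr0 Hi]]. apply Hi. unfold edist. rewrite !Rminus_diag.
    replace (0 ^ 2 + 0 ^ 2) with 0 by ring. now rewrite sqrt_0. }
  assert (Hyq : y <> q).
  { intros E. apply (f_equal nrm) in E. unfold y in E. rewrite nrm_pol in E by (unfold e; lra).
    fold rho in E. unfold e in E. lra. }
  destruct n as [|n].
  - apply Hyq. now apply Hfin.
  - destruct (Hstep 0%nat ltac:(lia)) as [[b0 Hb0] HS1].
    assert (Hq1 : C 1%nat q) by (specialize (Hin n ltac:(lia)); now replace (S n - n)%nat with 1%nat in Hin by lia).
    apply HS1 in Hq1. destruct Hq1 as [_ Hmax].
    set (A := bdry m (C 0%nat)) in *.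
    assert (HAint : forall b, A b -> C 0%nat b /\ ~ tint (C 0%nat) b).
    { intros b [Hb1 [[_ Hb2]|[Hb2 _]]]; [now split|]. exfalso. apply Hb2. now exists y. }
    assert (HAmk : forall b, C 0%nat b -> ~ tint (C 0%nat) b -> A b).
    { intros b H1 H2. split; [easy|]. left. split; [now exists y|easy]. }
    destruct (distset_glb A q (ex_intro _ b0 Hb0)) as [Dq _].
    destruct (distset_glb A y (ex_intro _ b0 Hb0)) as [_ Dy].
    set (d := distset m A q) in *.
    (* A nearly shortest curve from [q] to a late point of the ray must leave [C0]; it spends at
       least [d] before reaching the boundary, and the remainder is bounded below because the
       boundary point lies in [C0]. *)
    assert (HB : forall sigma, ray m p sigma -> forall t, 0 <= t -> t + d <= dist m (sigma t) q).
    { intros sigma Hs t Ht. apply Rnot_lt_le. intros Hlt.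
      pose proof (ray_push p sigma q t (t + 1) Hs ltac:(lra)).
      destruct (dist_approx m W q (sigma (t + 1)) (t + 1 + d)) as [c (HC & Ec0 & Ec1 & HL)].
      { rewrite (dist_sym m W). lra. }
      destruct (curve_leaves p (C 0%nat) c HC0 HC) as [u (Hu & HSu & Hnu)].
      { now rewrite Ec0. }
      { rewrite Ec1, HC0. intros HH. specialize (HH sigma Hs (t + 2) ltac:(lra)).
        destruct Hs as [_ Hd]. rewrite Hd, Rabs_pos_eq in HH by lra. lra. }
      pose proof (dist_split m W c u HC Hu) as Hsp. rewrite Ec0, Ec1 in Hsp.
      pose proof (Dq (c u) (HAmk _ HSu Hnu)). apply HC0 in HSu.
      specialize (HSu sigma Hs (t + 1) ltac:(lra)). rewrite (dist_sym m W) in HSu. lra. }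
    (* A point closer to [y] than the depth of [y] has a neighbourhood inside [C0], so it is no
       boundary point. *)
    assert (Hgt : d + k * e <= distset m A y).
    { apply Dy. intros b Hb1. destruct (HAint b Hb1) as [Hb2 Hb3]. apply Rnot_lt_le. intros Hlt. apply Hb3.
      exists (d + k * e - dist m y b). split; [lra|]. intros z Hz. apply HC0. intros sigma Hs t Ht.
      pose proof (HA d sigma Hs (HB sigma Hs) t Ht).
      pose proof (dist_triangle m W (sigma t) z y). pose proof (dist_triangle m W z b y).
      pose proof (dist_le_edist m W b z). rewrite (dist_sym m W z b), (dist_sym m W b y) in *. lra. }
    specialize (Hmax y Hy). lra.
Qed.

End Warped.

(** * Horoballs of rays from a point of radius that is not bent *)

Lemma strict_of_derive (f df : R -> R) (a b x0 : R) :
  (forall x, a <= x <= b -> continuous f x) ->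
  (forall x, a < x < b -> is_derive f x (df x)) ->
  (forall x, a < x < b -> 0 <= df x) -> a < x0 < b -> 0 < df x0 -> f a < f b.
Proof.
  intros Hc Hd Hp Hx H0.
  pose proof (Hd x0 Hx) as D. apply is_derive_Reals in D.
  destruct (D (df x0) H0) as [d Hd']. pose proof (cond_pos d).
  set (h := Rmin (d / 2) ((b - x0) / 2)).
  assert (Hh : 0 < h < d /\ h < b - x0) by (unfold h, Rmin; destruct Rle_dec; lra).
  specialize (Hd' h ltac:(lra) ltac:(rewrite Rabs_right; lra)). apply Rabs_def2 in Hd'.
  assert (Hq : 0 < (f (x0 + h) - f x0) / h) by lra.
  assert (f x0 < f (x0 + h)).
  { apply (Rmult_lt_compat_r h) in Hq; [|lra].
    unfold Rdiv in Hq. rewrite Rmult_0_l, Rmult_assoc, Rinv_l, Rmult_1_r in Hq by lra. lra. }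
  assert (f a <= f x0).
  { apply (monotone_of_derive f df); [lra| | |]; intros; [apply Hc|apply Hd|apply Hp]; lra. }
  assert (f (x0 + h) <= f b).
  { apply (monotone_of_derive f df); [lra| | |]; intros; [apply Hc|apply Hd|apply Hp]; lra. }
  lra.
Qed.

Section Warped.
Context (m : R -> R) (W : warp m).

Lemma qf_large c : unbounded m -> 0 <= c -> forall V, exists R0, forall R, R0 <= R -> c < m R /\ V <= qf m c R.
Proof.
  intros HU Hc V. destruct (HU (c + 1 + Rabs V)) as [R0 HR]. exists R0. intros R HR0.
  specialize (HR R HR0). pose proof (Rabs_pos V). pose proof (Rle_abs V). split; [lra|].
  apply Rle_trans with (m R - c); [lra|].
  unfold qf. rewrite <- (sqrt_pow2 (m R - c)) by lra. apply sqrt_le_1_alt. nra.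
Qed.

Lemma qf_diff_le c c' x : 0 <= c' <= c -> c < m x -> qf m c' x - qf m c x <= c ^ 2 / qf m c x.
Proof.
  intros Hc Hx. pose proof (qf_pos m c x ltac:(lra)) as Hq. pose proof (qf_mono_c m c' c x ltac:(lra)).
  pose proof (qf_sq m c x ltac:(lra)) as E. pose proof (qf_sq m c' x ltac:(lra)) as E'.
  apply (Rle_div_r _ _ _ Hq). nra.
Qed.

Lemma Af_lower c x : 0 < c < m x -> PI / 2 - c / qf m c x <= Af m c x.
Proof. intros H. rewrite Af_xi by easy. pose proof (xi_range m c x ltac:(lra)). lra. Qed.

Lemma Af_eq0 c x : m x = c -> Af m c x = 0.
Proof. intros H. unfold Af. rewrite qf_eq0 by easy. unfold Rdiv. now rewrite Rmult_0_l, atan_0. Qed.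

(** Since m' is at most 1, the tangential geodesic turns at least as much as a straight line in the
    plane, hence by almost PI / 2 far out. *)
Lemma tangent_ge_Af rho Th R : outgoing m (m rho) rho -> ang m (m rho) rho Th -> rho <= R ->
  Af m (m rho) R <= Th R.
Proof.
  intros Ho (TC & TD & T0) HR. pose proof Ho as (Hr & Hc & Hm). set (M := m rho) in *.
  assert (Th rho - Af m M rho <= Th R - Af m M R).
  2:{ rewrite T0, Af_eq0 in H by easy. lra. }
  apply (monotone_of_derive (fun x => Th x - Af m M x)
    (fun x => M / (m x * qf m M x) - M * Derive m x / (m x * qf m M x))); [lra| | |].
  - intros x Hx. apply cont_minus; [apply TC; lra|now apply Af_continuous].
  - intros x Hx. apply (is_derive_minus Th (Af m M)); [apply TD; lra|].
    apply (is_derive_Af m W). split; [lra|apply Hm; lra].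
  - intros x Hx. specialize (Hm x ltac:(lra)). pose proof (qf_pos m M x ltac:(lra)).
    pose proof (dm_le1 m W x ltac:(lra)).
    replace (M / (m x * qf m M x) - M * Derive m x / (m x * qf m M x)) with
      (M * (1 - Derive m x) / (m x * qf m M x)) by (field; lra).
    apply Rdiv_le_0_compat; [apply Rmult_le_pos; lra|apply Rmult_lt_0_compat; lra].
Qed.

(** The horoball of some ray from [pol rho 0] that does not turn towards the outward meridian contains
    [pol r 0]. *)
Definition captured (rho r : R) : Prop :=
  exists sigma, ray m (pol rho 0) sigma /\ forall eta, 0 < eta -> exists t0, 0 <= t0 /\ forall t, t0 <= t ->
    exists R th, 0 <= R /\ sigma t = pol R th /\ PI / 2 - eta <= th <= PI /\ dist m (pol r 0) (sigma t) < t.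

Lemma J_facts r : 0 <= r -> forall x, r < x ->
  continuous (J m (m r) r) x /\ is_derive (J m (m r) r) x (jc m (m r) x).
Proof.
  intros Hr x Hx. assert (D : is_derive (J m (m r) r) x (jc m (m r) x)).
  { destruct (Req_dec r 0) as [->|Hn].
    - rewrite (warp_0 m W). rewrite jc_0.
      apply (is_derive_ext (fun x => x - 0)); [intros t; symmetry; apply J_0|].
      auto_derive; auto; ring.
    - apply is_derive_J; [exact W|lra|lra]. }
  split; [eapply is_derive_continuous, D|exact D].
Qed.

Lemma J_continuous_base r : 0 <= r -> continuous (J m (m r) r) r.
Proof.
  intros Hr. destruct (Req_dec r 0) as [->|Hn].
  - rewrite (warp_0 m W). apply (continuous_ext (fun x => x - 0)); [intros t; symmetry; apply J_0|]. cont.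
  - eapply is_derive_continuous, is_derive_J; [exact W|lra|lra].
Qed.

(** Includes the pole, where the tangential geodesic degenerates to a meridian with angle function
    0. *)
Lemma inner_tangent r : 0 <= r -> unbounded m -> exists Th0, ang m (m r) r Th0 /\ (forall x, r < x -> m r < m x) /\
  forall R th, r < R -> dist m (pol r 0) (pol R th) <= m r * Th0 R + J m (m r) r R + m r * Rabs (th - Th0 R).
Proof.
  intros Hr HU. destruct (Req_dec r 0) as [->|Hn].
  - exists (fun _ => 0). rewrite (warp_0 m W). split; [|split].
    + split; [|split; [|easy]]; [intros; apply cont_const|].
      intros x Hx. replace (0 / (m x * qf m 0 x)) with 0 by (unfold Rdiv; ring). apply @is_derive_const.
    + intros x Hx. now apply (warp_pos m W).
    + intros R th HR. rewrite J_0. replace (pol 0 0) with (pol 0 th) by (unfold pol; f_equal; ring).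
      rewrite (dist_radial m W) by lra. rewrite Rabs_left1; lra.
  - pose proof (unbounded_dm_pos m W r Hr HU) as Hd.
    destruct (tangent_ang m W r ltac:(lra) Hd) as [Th0 Ha]. pose proof (tangent_outgoing m W r ltac:(lra) Hd) as Ho.
    exists Th0. split; [exact Ha|]. split; [apply Ho|]. intros R th HR.
    pose proof (dist_upper m W (m r) r Th0 R th Ho Ha ltac:(lra)). unfold arc in H. lra.
Qed.

(** Comparison with the cone of slope [m' rho]. *)
Lemma tangent_gains rho r Th : 0 <= r < rho -> unbounded m -> ang m (m rho) rho Th ->
  (exists x, r < x /\ Derive m x <> Derive m rho) ->
  exists R1, rho <= R1 /\ forall R, R1 <= R -> dist m (pol r 0) (pol R (Th R)) < arc m (m rho) rho Th R.
Proof.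
  intros Hr HU Ha (x0 & Hx0 & Hne).
  pose proof (unbounded_dm_pos m W rho ltac:(lra) HU) as Hd.
  pose proof (tangent_outgoing m W rho ltac:(lra) Hd) as Ho.
  destruct (inner_tangent r ltac:(lra) HU) as (Th0 & (TC0 & TD0 & T00) & Hm0 & HD).
  pose proof Ha as (TC & TD & T0). pose proof Ho as (_ & _ & Hm).
  set (M := m rho) in *. set (m0 := m r) in *. set (l := / Derive m rho).
  assert (Hl : 0 < l) by (apply Rinv_0_lt_compat; lra).
  assert (Hl1 : l * Derive m rho = 1) by (apply Rinv_l; lra).
  assert (HM : 0 < M) by (apply (warp_pos m W); lra).
  assert (Hm0p : 0 <= m0) by (apply (m_ge0 m W); lra).
  assert (Hm0M : m0 < M) by (apply Hm0; lra).
  assert (Hin : forall x, r < x < rho -> 0 <= l * Derive m x - 1).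
  { intros x Hx. pose proof (warp_dec m W x rho ltac:(lra)).
    assert (l * Derive m rho <= l * Derive m x) by (apply Rmult_le_compat_l; lra). lra. }
  assert (Hout : forall x, rho < x -> 0 <= 1 - l * Derive m x).
  { intros x Hx. pose proof (warp_dec m W rho x ltac:(lra)).
    assert (l * Derive m x <= l * Derive m rho) by (apply Rmult_le_compat_l; lra). lra. }
  (* Up to a vanishing error the geodesic from the inner radius does not turn further than the one
     from [rho]: its slope is at most that of the cone before [rho], and beyond [rho] the smaller m'
     adds more to [Th] than to [Th0]. *)
  assert (HTh : forall R, rho < R -> Th0 R - Th R <= l * (M / qf m M R)).
  { intros R HR.
    assert (A1 : l * Af m m0 r - Th0 r <= l * Af m m0 rho - Th0 rho).
    { apply (monotone_of_derive (fun x => l * Af m m0 x - Th0 x)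
        (fun x => l * (m0 * Derive m x / (m x * qf m m0 x)) - m0 / (m x * qf m m0 x))); [lra| | |].
      - intros x Hx. pose proof (Af_continuous m W m0 x). pose proof (TC0 x ltac:(lra)). cont.
      - intros x Hx. apply (is_derive_minus (fun x => l * Af m m0 x) Th0); [|apply TD0; lra].
        apply (is_derive_scal (Af m m0)), (is_derive_Af m W). split; [lra|apply Hm0; lra].
      - intros x Hx. specialize (Hm0 x ltac:(lra)). pose proof (qf_pos m m0 x ltac:(lra)).
        specialize (Hin x ltac:(lra)).
        replace (l * (m0 * Derive m x / (m x * qf m m0 x)) - m0 / (m x * qf m m0 x)) with
          (m0 * (l * Derive m x - 1) / (m x * qf m m0 x)) by (field; lra).
        apply Rdiv_le_0_compat; [apply Rmult_le_pos; lra|apply Rmult_lt_0_compat; lra]. }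
    assert (A2 : Th rho - Th0 rho - l * (Af m M rho - Af m m0 rho) <= Th R - Th0 R - l * (Af m M R - Af m m0 R)).
    { apply (monotone_of_derive (fun x => Th x - Th0 x - l * (Af m M x - Af m m0 x))
        (fun x => M / (m x * qf m M x) - m0 / (m x * qf m m0 x)
           - l * (M * Derive m x / (m x * qf m M x) - m0 * Derive m x / (m x * qf m m0 x)))); [lra| | |].
      - intros x Hx. pose proof (Af_continuous m W m0 x). pose proof (Af_continuous m W M x).
        pose proof (TC0 x ltac:(lra)). pose proof (TC x ltac:(lra)). cont.
      - intros x Hx. apply (is_derive_minus (fun x => Th x - Th0 x) (fun x => l * (Af m M x - Af m m0 x))).
        + apply (is_derive_minus Th Th0); [apply TD|apply TD0]; lra.
        + apply (is_derive_scal (fun x => Af m M x - Af m m0 x)).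
          apply (is_derive_minus (Af m M) (Af m m0)); apply (is_derive_Af m W); (split; [lra|]);
            [apply Hm|apply Hm0]; lra.
      - intros x Hx. specialize (Hm0 x ltac:(lra)). specialize (Hm x ltac:(lra)).
        pose proof (qf_pos m m0 x ltac:(lra)). pose proof (qf_pos m M x ltac:(lra)).
        specialize (Hout x ltac:(lra)).
        pose proof (slope_diff m m0 M (qf m M x) (m x) x ltac:(lra) Hm ltac:(lra) ltac:(lra)) as [HS _].
        replace (M / (m x * qf m M x) - m0 / (m x * qf m m0 x) -
          l * (M * Derive m x / (m x * qf m M x) - m0 * Derive m x / (m x * qf m m0 x))) with
          ((M / (m x * qf m M x) - m0 / (m x * qf m m0 x)) * (1 - l * Derive m x)) by (field; lra).
        now apply Rmult_le_pos. }
    rewrite T0, (Af_eq0 M rho) in A2 by easy. rewrite T00, (Af_eq0 m0 r) in A1 by easy.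
    pose proof (Af_range m m0 R ltac:(lra)). pose proof (Af_lower M R ltac:(split; [lra|apply Hm; lra])).
    assert (l * (Af m m0 R - Af m M R) <= l * (M / qf m M R)) by (apply Rmult_le_compat_l; lra). lra. }
  (* [E R] bounds the length of the outer geodesic minus the distance from [pol r 0], up to
     vanishing terms: the bracket subtracted in [E] is the cone value, which tends to 0. [E1]
     collects the contribution of the radii below [rho]. *)
  set (E1 := fun x => l * La m m0 x - J m m0 r x).
  set (E := fun x => (M - m0) * Th x + J m M rho x - J m m0 r x
     - l * ((M - m0) * Af m M x + La m M x - La m m0 x)).
  assert (HE10 : E1 r = 0) by (unfold E1; rewrite La_eq0, J_point by easy; ring).
  assert (HE1c : forall x, r <= x <= rho -> continuous E1 x).
  { intros x Hx. pose proof (La_continuous m W m0 x).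
    assert (continuous (J m m0 r) x).
    { destruct (Req_dec x r) as [->|]; [apply J_continuous_base; lra|apply (J_facts r); lra]. }
    unfold E1. cont. }
  assert (HE1d : forall x, r < x < rho -> is_derive E1 x (jc m m0 x * (l * Derive m x - 1))).
  { intros x Hx. evar_last.
    - apply (is_derive_minus (fun x => l * La m m0 x) (J m m0 r)); [|apply (J_facts r); lra].
      apply (is_derive_scal (La m m0)), (is_derive_La m W). split; [lra|apply Hm0; lra].
    - unfold minus, plus, opp; simpl. fold m0. ring. }
  assert (HEc : forall x, rho <= x -> continuous E x).
  { intros x Hx. pose proof (La_continuous m W m0 x). pose proof (La_continuous m W M x).
    pose proof (Af_continuous m W M x). pose proof (TC x Hx).
    assert (continuous (J m m0 r) x) by (apply (J_facts r); lra).
    assert (continuous (J m M rho) x) by (eapply is_derive_continuous, is_derive_J; [exact W|lra|lra]).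
    unfold E. cont. }
  set (w := fun x => (M - m0) * (M / (m x * qf m M x)) + jc m M x - jc m m0 x).
  assert (HEd : forall x, rho < x -> is_derive E x (w x * (1 - l * Derive m x))).
  { intros x Hx. assert (HMx : M < m x) by (apply Hm; lra). assert (Hm0x : m0 < m x) by lra.
    pose proof (qf_pos m M x ltac:(lra)). evar_last.
    - apply (is_derive_minus (fun x => (M - m0) * Th x + J m M rho x - J m m0 r x)
        (fun x => l * ((M - m0) * Af m M x + La m M x - La m m0 x))).
      + apply (is_derive_minus (fun x => (M - m0) * Th x + J m M rho x) (J m m0 r)); [|apply (J_facts r); lra].
        apply (is_derive_plus (fun x => (M - m0) * Th x) (J m M rho)).
        * apply (is_derive_scal Th), TD, Hx.
        * apply is_derive_J; [exact W|lra|lra].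
      + apply (is_derive_scal (fun x => (M - m0) * Af m M x + La m M x - La m m0 x)).
        apply (is_derive_minus (fun x => (M - m0) * Af m M x + La m M x) (La m m0)).
        * apply (is_derive_plus (fun x => (M - m0) * Af m M x) (La m M)).
          -- apply (is_derive_scal (Af m M)), (is_derive_Af m W). lra.
          -- apply (is_derive_La m W). lra.
        * apply (is_derive_La m W). lra.
    - unfold minus, plus, opp; simpl. fold m0. unfold w. field. lra. }
  assert (Hw : forall x, rho < x -> 0 < w x).
  { intros x Hx. assert (HMx : M < m x) by (apply Hm; lra).
    pose proof (qf_pos m M x ltac:(lra)) as Hq. pose proof (qf_pos m m0 x ltac:(lra)) as Hq0.
    pose proof (qf_mono_c m m0 M x ltac:(lra)) as Hqq.
    unfold w. rewrite !jc_qf by lra.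
    assert (Edif : qf m m0 x - qf m M x = (M - m0) * (M + m0) / (qf m m0 x + qf m M x)).
    { apply Rmult_eq_reg_r with (qf m m0 x + qf m M x); [|lra].
      transitivity (qf m m0 x * qf m m0 x - qf m M x * qf m M x); [ring|]. rewrite !qf_sq by lra. field. lra. }
    replace ((M - m0) * (M / (m x * qf m M x)) + qf m M x / m x - qf m m0 x / m x) with
      (((M - m0) * M / qf m M x - (qf m m0 x - qf m M x)) / m x) by (field; lra).
    rewrite Edif.
    replace ((M - m0) * M / qf m M x - (M - m0) * (M + m0) / (qf m m0 x + qf m M x)) with
      ((M - m0) * (M * qf m m0 x - m0 * qf m M x) / (qf m M x * (qf m m0 x + qf m M x))) by (field; lra).
    apply Rdiv_lt_0_compat; [|lra].
    apply Rdiv_lt_0_compat; [|apply Rmult_lt_0_compat; lra].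
    apply Rmult_lt_0_compat; [lra|]. nra. }
  assert (HEmono : forall x y, rho <= x <= y -> E x <= E y).
  { intros x y Hxy. apply (monotone_of_derive E (fun x => w x * (1 - l * Derive m x))); [lra| | |].
    - intros; apply HEc; lra.
    - intros; apply HEd; lra.
    - intros t Ht. apply Rmult_le_pos; [apply Rlt_le, Hw; lra|apply Hout; lra]. }
  assert (HEE1 : E rho = E1 rho).
  { unfold E, E1. rewrite T0, J_point, (Af_eq0 M rho), (La_eq0 m M rho) by easy. ring. }
  assert (HE1mono : E1 r <= E1 rho).
  { apply (monotone_of_derive E1 (fun x => jc m m0 x * (l * Derive m x - 1))); [lra|exact HE1c|exact HE1d|].
    intros x Hx. apply Rmult_le_pos; [apply jc_ge0|now apply Hin]. }
  (* A radius where m' differs from m' rho makes one of the two monotonicities strict, according to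
     the side of [rho] on which it lies. *)
  assert (Hpos : exists Rs, rho <= Rs /\ 0 < E Rs).
  { assert (Hxr : x0 <> rho) by (intros ->; now apply Hne).
    destruct (Rlt_dec x0 rho) as [Hlt|Hge].
    - exists rho. split; [lra|]. rewrite HEE1, <- HE10.
      apply (strict_of_derive E1 (fun x => jc m m0 x * (l * Derive m x - 1)) r rho x0 HE1c HE1d); [|lra|].
      + intros x Hx. apply Rmult_le_pos; [apply jc_ge0|now apply Hin].
      + apply Rmult_lt_0_compat.
        * assert (Hmx : m0 < m x0) by (apply Hm0; lra). rewrite jc_qf by lra.
          apply Rdiv_lt_0_compat; [apply qf_pos; lra|lra].
        * pose proof (warp_dec m W x0 rho ltac:(lra)).
          assert (l * Derive m rho < l * Derive m x0) by (apply Rmult_lt_compat_l; lra). lra.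
    - exists (x0 + 1). split; [lra|]. apply Rle_lt_trans with (E rho); [lra|].
      apply (strict_of_derive E (fun x => w x * (1 - l * Derive m x)) rho (x0 + 1) x0).
      + intros; apply HEc; lra.
      + intros; apply HEd; lra.
      + intros t Ht. apply Rmult_le_pos; [apply Rlt_le, Hw; lra|apply Hout; lra].
      + lra.
      + apply Rmult_lt_0_compat; [apply Hw; lra|].
        pose proof (warp_dec m W rho x0 ltac:(lra)).
        assert (l * Derive m x0 < l * Derive m rho) by (apply Rmult_lt_compat_l; lra). lra. }
  destruct Hpos as (Rs & HRs & HEs). set (dl := E Rs) in *.
  destruct (qf_large M HU ltac:(lra) (4 * l * M ^ 2 / dl + 1)) as [R0 HR0].
  exists (Rmax (Rmax Rs R0) (rho + 1)). split; [apply Rle_trans with (2 := Rmax_r _ _); lra|].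
  intros R HR. pose proof (Rmax_l (Rmax Rs R0) (rho + 1)). pose proof (Rmax_r (Rmax Rs R0) (rho + 1)).
  pose proof (Rmax_l Rs R0). pose proof (Rmax_r Rs R0).
  destruct (HR0 R ltac:(lra)) as [HMR HqR].
  assert (Hp : 0 <= 4 * l * M ^ 2 / dl).
  { apply Rdiv_le_0_compat; [|easy]. apply Rmult_le_pos; [lra|apply pow2_ge_0]. }
  set (q := qf m M R) in *. assert (Hq : 0 < q) by lra.
  assert (Hsmall : l * (4 * (M ^ 2 / q)) < dl).
  { replace (l * (4 * (M ^ 2 / q))) with (4 * l * M ^ 2 / q) by (field; lra).
    apply Rlt_div_l; [easy|]. apply Rlt_le_trans with (dl * (4 * l * M ^ 2 / dl + 1)).
    - replace (dl * (4 * l * M ^ 2 / dl + 1)) with (4 * l * M ^ 2 + dl) by (field; lra). lra.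
    - apply Rmult_le_compat_l; lra. }
  specialize (HD R (Th R) ltac:(lra)). specialize (HTh R ltac:(lra)). fold q in HTh.
  pose proof (HEmono Rs R ltac:(lra)) as HER. fold dl in HER.
  assert (HD2 : dist m (pol r 0) (pol R (Th R)) <= m0 * Th R + J m m0 r R + 2 * m0 * (l * (M / q))).
  { apply Rle_trans with (1 := HD). unfold Rabs. destruct Rcase_abs.
    - assert (m0 * (Th0 R - Th R) <= m0 * (l * (M / q))) by (apply Rmult_le_compat_l; lra). lra.
    - assert (0 <= m0 * (l * (M / q))); [|lra].
      apply Rmult_le_pos; [lra|]. apply Rmult_le_pos; [lra|]. apply Rdiv_le_0_compat; lra. }
  assert (HMq : m0 * (M / q) <= M ^ 2 / q).
  { replace (M ^ 2 / q) with (M * (M / q)) by (field; lra). apply Rmult_le_compat_r; [apply Rdiv_le_0_compat; lra|lra]. }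
  assert (HB : - (2 * (M ^ 2 / q)) <= (M - m0) * Af m M R + La m M R - La m m0 R).
  { pose proof (qf_diff_le M m0 R ltac:(lra) HMR) as Hqd. fold q in Hqd.
    unfold La. fold q.
    assert (Hm0A : - (M ^ 2 / q) <= m0 * (Af m m0 R - Af m M R)).
    { destruct (Req_dec m0 0) as [->|Hz].
      - rewrite Rmult_0_l. assert (0 <= M ^ 2 / q) by (apply Rdiv_le_0_compat; [apply pow2_ge_0|lra]). lra.
      - pose proof (Af_lower m0 R ltac:(lra)). pose proof (Af_range m M R ltac:(lra)).
        pose proof (qf_mono_c m m0 M R ltac:(lra)). fold q in H5.
        assert (m0 / qf m m0 R <= M / q).
        { apply Rmult_le_compat; [lra|apply Rlt_le, Rinv_0_lt_compat; lra|lra|apply Rinv_le_contravar; lra]. }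
        assert (m0 * (- (M / q)) <= m0 * (Af m m0 R - Af m M R)) by (apply Rmult_le_compat_l; lra). lra. }
    lra. }
  apply (Rmult_le_compat_l l) in HB; [|lra]. apply (Rmult_le_compat_l l) in HMq; [|lra].
  unfold E in HER. unfold arc. fold M. lra.
Qed.

Lemma captured_tangent rho r : 0 <= r < rho -> ~ bent m rho ->
  (exists x, r < x /\ Derive m x <> Derive m rho) -> captured rho r.
Proof.
  intros Hr Hn Hx. pose proof (straight_unbounded m W rho ltac:(lra) Hn) as HU.
  pose proof (unbounded_dm_pos m W rho ltac:(lra) HU) as Hd.
  destruct (tangent_ang m W rho ltac:(lra) Hd) as [Th Ha]. pose proof (tangent_outgoing m W rho ltac:(lra) Hd) as Ho.
  destruct (outgoing_ray m W (m rho) rho Th Ho Ha HU) as [sigma [Hs HsR]].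
  { intros R HR. apply (straight_tangent m W rho); auto; lra. }
  exists sigma. split; [exact Hs|]. intros eta Heta.
  destruct (tangent_gains rho r Th Hr HU Ha Hx) as (R1 & HR1 & HG).
  pose proof (warp_pos m W rho ltac:(lra)) as HM.
  destruct (qf_large (m rho) HU ltac:(lra) (m rho / eta)) as [R2 HR2].
  set (R3 := Rmax R1 R2). pose proof (Rmax_l R1 R2). pose proof (Rmax_r R1 R2). fold R3 in H, H0.
  exists (arc m (m rho) rho Th R3). split.
  { pose proof (arc_expand m W _ rho Th rho R3 Ho Ha ltac:(lra)) as HE. rewrite (arc_0 m _ rho Th Ha) in HE. lra. }
  intros t Ht.
  assert (Ht0 : 0 <= t).
  { pose proof (arc_expand m W _ rho Th rho R3 Ho Ha ltac:(lra)) as HE. rewrite (arc_0 m _ rho Th Ha) in HE. lra. }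
  destruct (arc_surj m W _ rho Th t Ho Ha Ht0) as (R & HR & Et).
  assert (HR3 : R3 <= R).
  { apply Rnot_lt_le. intros Hlt. pose proof (arc_expand m W _ rho Th R R3 Ho Ha ltac:(lra)). lra. }
  exists R, (Th R). split; [lra|]. rewrite <- Et. split; [now apply HsR|]. split.
  - split; [|apply (straight_tangent m W rho); auto; lra].
    apply Rle_trans with (2 := tangent_ge_Af rho Th R Ho Ha HR).
    destruct (HR2 R ltac:(lra)) as [HMR Hq].
    apply Rle_trans with (2 := Af_lower (m rho) R ltac:(lra)).
    pose proof (qf_pos m (m rho) R ltac:(lra)).
    assert (m rho / qf m (m rho) R <= eta); [|lra].
    apply (Rle_div_l _ _ _ H1). apply Rle_trans with (eta * (m rho / eta)); [apply Req_le; field; lra|].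
    apply Rmult_le_compat_l; lra.
  - rewrite HsR by lra. apply HG. lra.
Qed.

End Warped.

(** * Cones: straight lines that first dip inwards *)

Lemma equal_increments (f g df : R -> R) (a b : R) : a <= b ->
  (forall x, a <= x <= b -> continuous f x) -> (forall x, a <= x <= b -> continuous g x) ->
  (forall x, a < x < b -> is_derive f x (df x)) -> (forall x, a < x < b -> is_derive g x (df x)) ->
  f b - f a = g b - g a.
Proof.
  intros Hab Cf Cg Df Dg.
  assert (H : forall f g : R -> R, (forall x, a <= x <= b -> continuous f x) ->
    (forall x, a <= x <= b -> continuous g x) ->
    (forall x, a < x < b -> is_derive f x (df x)) -> (forall x, a < x < b -> is_derive g x (df x)) ->
    f b - f a <= g b - g a).
  { clear - Hab. intros f g Cf Cg Df Dg.
    pose proof (monotone_of_derive (fun x => g x - f x) (fun _ => 0) a b Hab) as H. cbv beta in H.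
    enough (g a - f a <= g b - f b) by lra. apply H; [| |intros; lra].
    - intros x Hx. apply cont_minus; auto.
    - intros x Hx. replace 0 with (df x - df x) by ring. apply (is_derive_minus g f); auto. }
  apply Rle_antisym; auto.
Qed.

Lemma sin_tangent_le (A B : R) : 0 <= A <= PI / 2 -> 0 <= B <= PI / 2 ->
  sin A <= sin B + cos B * (A - B).
Proof.
  intros HA HB. pose proof PI_RGT_0.
  set (f := fun t => sin B + cos B * (t - B) - sin t).
  assert (Df : forall t, is_derive f t (cos B - cos t)) by (intros t; unfold f; auto_derive; auto; ring).
  assert (Cf : forall t, continuous f t) by (intros t; apply (is_derive_continuous _ _ _ (Df t))).
  assert (f B = 0) by (unfold f; ring).
  destruct (Rle_dec A B).
  - enough (- f A <= - f B) by (unfold f in *; lra).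
    apply (monotone_of_derive (fun t => - f t) (fun t => - (cos B - cos t))); auto.
    + intros; apply cont_opp; auto.
    + intros x Hx. apply (is_derive_opp f); auto.
    + intros x Hx. assert (cos B <= cos x) by (apply cos_decr_1; lra). lra.
  - enough (f B <= f A) by (unfold f in *; lra).
    apply (monotone_of_derive f (fun t => (cos B - cos t))); auto; try lra.
    intros x Hx. assert (cos x <= cos B) by (apply cos_decr_1; lra). lra.
Qed.

Section Warped.
Context (m : R -> R) (W : warp m).

(** In the unrolled cone, scaled by its slope, [Af c x] is the angle at the apex of the right
    triangle with hypotenuse [m x] and adjacent leg [c]. *)
Lemma Af_polar c x : 0 < c <= m x ->
  0 <= Af m c x <= PI / 2 /\ m x * cos (Af m c x) = c /\ m x * sin (Af m c x) = qf m c x.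
Proof.
  intros H. split; [apply Af_range; lra|]. pose proof (qf_ge0 m c x) as Hq.
  pose proof (qf_sq m c x ltac:(lra)) as Hs. unfold Af.
  assert (E : sqrt (1 + (qf m c x / c)²) = m x / c).
  { apply sqrt_lem_1; [unfold Rsqr; nra|apply Rdiv_le_0_compat; lra|]. unfold Rsqr.
    replace (m x / c * (m x / c)) with (m x ^ 2 / c ^ 2) by (field; lra).
    replace (m x ^ 2) with (qf m c x * qf m c x + c ^ 2) by lra. field; lra. }
  rewrite cos_atan, sin_atan, E. split; field; lra.
Qed.

(** [sin] is concave, and [qf c x = m x * sin (Af c x)]. *)
Lemma qf_le_cone c c' x : 0 < c <= m x -> 0 <= c' <= m x ->
  qf m c x <= c' * Af m c x + La m c' x.
Proof.
  intros Hc Hc'. unfold La. destruct (Req_dec c' 0) as [->|Hn].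
  - pose proof (qf_mono_c m 0 c x ltac:(lra)). lra.
  - destruct (Af_polar c x Hc) as (HA & _ & HsA). destruct (Af_polar c' x ltac:(lra)) as (HB & HcB & HsB).
    pose proof (sin_tangent_le _ _ HA HB). rewrite <- HsA, <- HsB.
    assert (m x * sin (Af m c x) <= m x * (sin (Af m c' x) + cos (Af m c' x) * (Af m c x - Af m c' x)))
      by (apply Rmult_le_compat_l; lra).
    set (B := Af m c' x) in *. set (A := Af m c x) in *. rewrite <- HcB. lra.
Qed.

Section Cone.
Context (r a : R) (Hr : 0 <= r) (Ha : 0 < a) (Hcone : forall x, r < x -> Derive m x = a).

Lemma cone_m x : r <= x -> m x = m r + a * (x - r).
Proof.
  intros Hx. enough (m x - m r = a * x - a * r) by lra.
  apply (equal_increments m (fun t => a * t) (fun _ => a)); [lra| | | |].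
  - intros; apply (m_continuous m W).
  - intros; cont.
  - intros t Ht. rewrite <- (Hcone t) by lra. apply (warp_derive m W).
  - intros t Ht. apply is_derive_lin.
Qed.

Lemma cone_J r0 u x : 0 <= r0 <= u -> r <= u <= x -> m r0 <= m u ->
  a * (J m (m r0) r0 x - J m (m r0) r0 u) = La m (m r0) x - La m (m r0) u.
Proof.
  intros Hr0 Hu Hm. rewrite Rmult_minus_distr_l.
  pose proof (m_ge0 m W r0 ltac:(lra)).
  assert (Hlt : forall t, u < t -> m r0 < m t).
  { intros t Ht. rewrite (cone_m u), (cone_m t) in * by lra. nra. }
  apply (equal_increments (fun t => a * J m (m r0) r0 t) (La m (m r0)) (fun t => a * jc m (m r0) t)); [lra| | | |].
  - intros t Ht. apply cont_mult; [cont|]. destruct (Req_dec t r0) as [->|Hn].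
    + apply J_continuous_base; [exact W|lra].
    + apply (J_facts m W); lra.
  - intros; apply (La_continuous m W).
  - intros t Ht. apply (is_derive_scal (J m (m r0) r0)). apply (J_facts m W); lra.
  - intros t Ht. rewrite <- (Hcone t) by lra. apply (is_derive_La m W). specialize (Hlt t). lra.
Qed.

Lemma cone_ang rho c Th x : r <= rho -> 0 <= c -> (forall t, rho < t -> c < m t) -> ang m c rho Th -> rho <= x ->
  a * Th x = Af m c x - Af m c rho.
Proof.
  intros Hrho Hc Hm (TC & TD & T0) Hx.
  enough (a * Th x - a * Th rho = Af m c x - Af m c rho) by (rewrite T0 in *; lra).
  apply (equal_increments (fun t => a * Th t) (Af m c) (fun t => a * (c / (m t * qf m c t)))); [lra| | | |].
  - intros t Ht. apply cont_mult; [cont|]. apply TC; lra.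
  - intros; apply (Af_continuous m W).
  - intros t Ht. apply (is_derive_scal Th). apply TD; lra.
  - intros t Ht. specialize (Hm t ltac:(lra)). pose proof (qf_pos m c t ltac:(lra)).
    replace (a * _) with (c * Derive m t / (m t * qf m c t)).
    + apply (is_derive_Af m W); lra.
    + rewrite (Hcone t) by lra. field. lra.
Qed.

Section Dip.
(** [HLa] makes competitors that enter the core inside radius [r] too long. [HA] keeps the total
    turning (PI / 2 + Af c rho) / a of the line at most [PI]. *)
Context (rho c : R) (Hrho : r < rho) (Hmono : forall x y, 0 <= x < y -> y <= r -> m x < m y)
  (Hc : m r < c < m rho) (Ha2 : 1 / 2 <= a) (HLa : qf m c rho <= La m (m r) rho)
  (HA : Af m c rho <= PI * (a - 1 / 2)).

(** In a cone, straight lines at distance [c / a] from the apex, parametrized by [a] times the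
    arc length from the closest point; the geodesic starts inwards at [y = - qf m c rho]. *)
Definition dip_radius (y : R) : R := r + (sqrt (c ^ 2 + y ^ 2) - m r) / a.
Definition dip_angle (y : R) : R := (atan (y / c) + Af m c rho) / a.
Definition dip (y : R) : pt := pol (dip_radius y) (dip_angle y).

Lemma dip_pos : 0 < c.
Proof. pose proof (m_ge0 m W r Hr). lra. Qed.

Lemma dip_sqrt y : c <= sqrt (c ^ 2 + y ^ 2).
Proof.
  pose proof dip_pos. rewrite <- (sqrt_pow2 c) at 1 by lra. apply sqrt_le_1_alt. nra.
Qed.

Lemma dip_radius_gt y : r < dip_radius y.
Proof.
  pose proof (dip_sqrt y). unfold dip_radius. enough (0 < (sqrt (c ^ 2 + y ^ 2) - m r) / a) by lra.
  apply Rdiv_lt_0_compat; lra.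
Qed.

Lemma dip_m y : m (dip_radius y) = sqrt (c ^ 2 + y ^ 2).
Proof.
  pose proof (dip_radius_gt y). rewrite cone_m by lra. unfold dip_radius. field. lra.
Qed.

Lemma dip_qf y : 0 <= y -> qf m c (dip_radius y) = y.
Proof.
  intros Hy. unfold qf. rewrite dip_m, pow2_sqrt by nra.
  replace (c ^ 2 + y ^ 2 - c ^ 2) with (y ^ 2) by ring. now apply sqrt_pow2.
Qed.

Lemma dip_start : dip (- qf m c rho) = pol rho 0.
Proof.
  pose proof dip_pos. pose proof (qf_sq m c rho ltac:(lra)) as Hs.
  unfold dip. f_equal.
  - unfold dip_radius. replace (c ^ 2 + (- qf m c rho) ^ 2) with (m rho ^ 2) by lra.
    rewrite sqrt_pow2 by lra. rewrite (cone_m rho) by lra. field. lra.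
  - unfold dip_angle, Af. replace (- qf m c rho / c) with (- (qf m c rho / c)) by (field; lra).
    rewrite atan_opp. field. lra.
Qed.

Lemma dip_upper y1 y2 : y1 <= y2 -> dist m (dip y1) (dip y2) <= (y2 - y1) / a.
Proof.
  intros Hy. pose proof dip_pos as Hc0. replace ((y2 - y1) / a) with (/ a * y2 - / a * y1) by (field; lra).
  apply (polar_path_le m W dip_radius (fun y => y / (a * sqrt (c ^ 2 + y ^ 2))) dip_angle
    (fun y => c / (a * (c ^ 2 + y ^ 2))) (fun y => / a * y) (fun _ => / a)); auto.
  - intros t Ht. apply filter_forall. intros u. pose proof (dip_sqrt u). split; [pose proof (dip_radius_gt u); lra|]. split.
    + unfold dip_radius. auto_derive; [nra|].
      replace (c * (c * 1) + u * (u * 1)) with (c ^ 2 + u ^ 2) by ring. field. lra.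
    + unfold dip_angle. auto_derive; auto. unfold Rsqr. field. repeat split; nra.
  - intros t Ht. split.
    + pose proof (dip_sqrt t). apply cont_div; [cont|cont|nra].
    + apply cont_div; [cont|cont|]. nra.
  - intros t Ht. cont.
  - intros t Ht. apply is_derive_lin.
  - intros t Ht. pose proof (dip_sqrt t) as Hs. rewrite dip_m. set (w := sqrt (c ^ 2 + t ^ 2)) in *.
    assert (Hw : c ^ 2 + t ^ 2 = w * w) by (unfold w; rewrite sqrt_sqrt; nra).
    apply Req_le. apply sqrt_lem_1; [nra|left; apply Rinv_0_lt_compat; lra|].
    rewrite Hw. replace ((t / (a * w)) ^ 2 + (w * (c / (a * (w * w)))) ^ 2) with ((c ^ 2 + t ^ 2) / (a ^ 2 * w ^ 2)) by (field; lra).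
    rewrite Hw. field. lra.
Qed.

(** A competitor of minimal radius [r0] is calibrated by [m r0]; [qf_le_cone], applied on both sides
    of the closest point, compares the result with the straight line. *)
Lemma dip_lower_start y : 0 <= y -> (y + qf m c rho) / a <= dist m (pol rho 0) (dip y).
Proof.
  intros Hy. pose proof dip_pos as Hc0. pose proof (dip_radius_gt y) as HRr.
  pose proof (dip_qf y Hy) as Hqy. unfold dip. set (R := dip_radius y) in *.
  pose proof (dip_m y) as HmR. pose proof (dip_sqrt y) as Hcs. fold R in HmR.
  assert (Hth : dip_angle y = (Af m c R + Af m c rho) / a) by (unfold dip_angle, Af; rewrite Hqy; easy).
  pose proof (Af_range m c R ltac:(lra)) as HAR. pose proof (Af_range m c rho ltac:(lra)) as HArho.
  assert (Hq : 0 <= qf m c rho) by apply qf_ge0.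
  assert (HaT : a * dip_angle y = Af m c R + Af m c rho) by (rewrite Hth; field; lra).
  apply (dist_ge_calibrated m W _ _ (dip_angle y)).
  - rewrite nrm_pol; lra.
  - rewrite nrm_pol; lra.
  - rewrite Hth. split; [apply Rdiv_le_0_compat; lra|]. apply Rle_div_l; lra.
  - rewrite dot_pol, !nrm_pol by lra. rewrite Rminus_0_l. now rewrite cos_neg.
  - intros r0. rewrite !nrm_pol by lra. intros H0 H0R.
    pose proof (m_ge0 m W r0 ltac:(lra)) as Hm0.
    exists (m r0). split; [lra|].
    apply Rle_div_l; [lra|].
    assert (m r0 <= m rho) by (apply (m_mono m W); lra).
    assert (m r0 <= m R) by (apply (m_mono m W); lra).
    pose proof (qf_le_cone c (m r0) R ltac:(lra) ltac:(lra)) as K1. rewrite Hqy in K1.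
    pose proof (qf_le_cone c (m r0) rho ltac:(lra) ltac:(lra)) as K2.
    (* The left side is for a minimal radius in the cone, where a [J] equals an increment of [La].
       The right side is for one in the core, where the angular term at [rho] is given up and [HLa]
       replaces it. *)
    enough (La m (m r0) R + La m (m r0) rho <= a * J m (m r0) r0 rho + a * J m (m r0) r0 R
      \/ y + qf m c rho <= m r0 * Af m c R + a * J m (m r0) r0 rho + a * J m (m r0) r0 R) as [E|E].
    { replace ((m r0 * dip_angle y + J m (m r0) r0 rho + J m (m r0) r0 R) * a)
        with (m r0 * (a * dip_angle y) + a * J m (m r0) r0 rho + a * J m (m r0) r0 R) by ring. rewrite HaT. lra. }
    { replace ((m r0 * dip_angle y + J m (m r0) r0 rho + J m (m r0) r0 R) * a)
        with (m r0 * (a * dip_angle y) + a * J m (m r0) r0 rho + a * J m (m r0) r0 R) by ring. rewrite HaT.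
      assert (0 <= m r0 * Af m c rho) by (apply Rmult_le_pos; lra). lra. }
    destruct (Rle_dec r r0) as [Hrr|Hrr].
    + left. pose proof (cone_J r0 r0 rho ltac:(lra) ltac:(lra) ltac:(lra)) as E1.
      pose proof (cone_J r0 r0 R ltac:(lra) ltac:(lra) ltac:(lra)) as E2.
      rewrite (La_eq0 m _ r0), J_point in E1, E2 by easy. lra.
    + right. assert (Hlt : m r0 < m r) by (apply Hmono; lra).
      pose proof (cone_J r0 r rho ltac:(lra) ltac:(lra) ltac:(lra)) as E1.
      pose proof (cone_J r0 r R ltac:(lra) ltac:(lra) ltac:(lra)) as E2.
      pose proof (J_ge_La m W r0 r ltac:(lra) Hlt) as HJ.
      pose proof (La_ge0 m (m r0) r Hm0) as HL0.
      assert (HL : La m (m r) rho <= La m (m r0) rho - La m (m r0) r).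
      { pose proof (monotone_of_derive (fun x => La m (m r0) x - La m (m r) x)
          (fun x => a * jc m (m r0) x - a * jc m (m r) x) r rho ltac:(lra)) as HM. cbv beta in HM.
        rewrite (La_eq0 m (m r) r) in HM by easy.
        enough (La m (m r0) r - 0 <= La m (m r0) rho - La m (m r) rho) by lra. apply HM.
        - intros x Hx. apply cont_minus; apply (La_continuous m W).
        - intros x Hx. assert (m r < m x) by (rewrite (cone_m x) by lra; nra).
          rewrite <- (Hcone x) at 1 2 by lra.
          apply (is_derive_minus (La m (m r0)) (La m (m r))); apply (is_derive_La m W); pose proof (m_ge0 m W r Hr); lra.
        - intros x Hx. assert (m r < m x) by (rewrite (cone_m x) by lra; nra).
          rewrite !(jc_qf m) by lra.
          assert (qf m (m r) x <= qf m (m r0) x) by (apply qf_mono_c; lra).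
          assert (qf m (m r) x / m x <= qf m (m r0) x / m x) by (apply Rmult_le_compat_r; [left; apply Rinv_0_lt_compat; lra|easy]).
          nra. }
      assert (2 * a * La m (m r0) r <= 2 * a * J m (m r0) r0 r) by (apply Rmult_le_compat_l; lra).
      assert (0 <= (2 * a - 1) * La m (m r0) r) by (apply Rmult_le_pos; lra).
      lra.
Qed.

Lemma dip_ray : ray m (pol rho 0) (fun t => dip (- qf m c rho + a * t)).
Proof.
  split; [rewrite Rmult_0_r, Rplus_0_r; apply dip_start|].
  assert (Key : forall s t, 0 <= s <= t -> dist m (dip (- qf m c rho + a * s)) (dip (- qf m c rho + a * t)) = t - s).
  { intros s t H. set (y1 := - qf m c rho + a * s). set (y2 := - qf m c rho + a * t).
    assert (E1 : s = (y1 - - qf m c rho) / a) by (unfold y1; field; lra).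
    assert (E2 : t = (y2 - - qf m c rho) / a) by (unfold y2; field; lra).
    assert (E : t - s = (y2 - y1) / a) by (unfold y1, y2; field; lra).
    assert (H12 : y1 <= y2) by (unfold y1, y2; nra).
    assert (H1 : - qf m c rho <= y1) by (unfold y1; nra).
    rewrite E. apply Rle_antisym; [now apply dip_upper|].
    (* The lower bound holds only beyond the closest point to the apex; earlier pairs of points
       follow from it by the triangle inequality. *)
    set (y := Rmax y2 0). pose proof (Rmax_l y2 0). pose proof (Rmax_r y2 0). fold y in H0, H2.
    pose proof (dip_lower_start y H2) as L. rewrite <- dip_start in L.
    pose proof (dip_upper _ _ H1). pose proof (dip_upper _ _ H0).
    pose proof (dist_triangle m W (dip (- qf m c rho)) (dip y1) (dip y)).
    pose proof (dist_triangle m W (dip y1) (dip y2) (dip y)).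
    unfold Rdiv in *. lra. }
  intros s t Hs Ht. destruct (Rle_dec s t).
  - rewrite Key by lra. rewrite Rabs_minus_sym, Rabs_pos_eq; lra.
  - rewrite dist_sym, Key by (auto; lra). rewrite Rabs_pos_eq; lra.
Qed.

End Dip.

Lemma cone_increase x y : 0 <= x < y -> m x < m y.
Proof.
  intros H. enough (m x - a * x <= m y - a * y) by nra.
  apply (monotone_of_derive (fun t => m t - a * t) (fun t => Derive m t - a)); [lra| | |].
  - intros; apply cont_minus; [apply (m_continuous m W)|cont].
  - intros t Ht. apply (is_derive_minus m (fun t => a * t)); [apply (warp_derive m W)|apply is_derive_lin].
  - intros t Ht. destruct (Rle_dec t r).
    + rewrite <- (Hcone (r + 1)) by lra. pose proof (warp_dec m W t (r + 1) ltac:(lra)). lra.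
    + rewrite (Hcone t) by lra. lra.
Qed.

(** Scaled by [a], the distance from [pol r 0] to a far point of the line is about
    [y + m0 * Af m c rho], whereas the time is [y + Q] with [Q = qf m c rho]. For a shallow dip [Q]
    is close to [c] times the same angle, and [c > m0]. *)
Lemma captured_dip rho : r < rho -> unbounded m -> 1 / 2 < a <= 1 -> captured m rho r.
Proof.
  intros Hrho HU Ha2. set (m0 := m r). set (M := m rho).
  assert (Hm0 : 0 <= m0) by apply (m_ge0 m W r Hr).
  assert (HmM : m0 < M) by (apply cone_increase; lra).
  assert (HLpos : 0 < La m m0 rho).
  { rewrite <- (La_eq0 m m0 r) by easy.
    apply (strict_of_derive (La m m0) (fun x => a * jc m m0 x) r rho ((r + rho) / 2)).
    - intros; apply (La_continuous m W).
    - intros x Hx. rewrite <- (Hcone x) by lra. apply (is_derive_La m W).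
      pose proof (cone_increase r x ltac:(lra)). unfold m0 in *. lra.
    - intros x Hx. apply Rmult_le_pos; [lra|apply jc_ge0].
    - lra.
    - pose proof (cone_increase r ((r + rho) / 2) ltac:(lra)). apply Rmult_lt_0_compat; [lra|].
      rewrite jc_qf by (unfold m0 in *; lra).
      apply Rdiv_lt_0_compat; [|unfold m0 in *; lra]. apply qf_pos. unfold m0 in *. lra. }
  pose proof PI_RGT_0 as HPI.
  (* [Q] is the depth of the dip. The bounds give, in order, [HLa], the turning condition [HA],
     [m0 < c], and [M / 2 <= c], which [HA] needs as well. *)
  assert (Hex : exists Q, 0 < Q /\ Q <= La m m0 rho /\ Q <= M * (PI * (a - 1 / 2)) / 2 /\ Q < sqrt (M ^ 2 - m0 ^ 2) /\ Q <= M / 2).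
  { set (q1 := La m m0 rho) in *. set (q2 := M * (PI * (a - 1 / 2)) / 2). set (q3 := sqrt (M ^ 2 - m0 ^ 2)).
    assert (0 < q2) by (unfold q2; apply Rdiv_lt_0_compat; [|lra]; apply Rmult_lt_0_compat; [lra|]; apply Rmult_lt_0_compat; lra).
    assert (0 < q3) by (unfold q3; apply sqrt_lt_R0; nra).
    exists (Rmin (Rmin q1 q2) (Rmin (q3 / 2) (M / 2))).
    pose proof (Rmin_l (Rmin q1 q2) (Rmin (q3 / 2) (M / 2))). pose proof (Rmin_r (Rmin q1 q2) (Rmin (q3 / 2) (M / 2))).
    pose proof (Rmin_l q1 q2). pose proof (Rmin_r q1 q2).
    pose proof (Rmin_l (q3 / 2) (M / 2)). pose proof (Rmin_r (q3 / 2) (M / 2)).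
    split; [repeat apply Rmin_glb_lt; lra|]. repeat split; lra. }
  destruct Hex as (Q & HQ0 & HQ1 & HQ2 & HQ3 & HQ4).
  assert (HQ5 : Q ^ 2 < M ^ 2 - m0 ^ 2).
  { rewrite <- (pow2_sqrt (M ^ 2 - m0 ^ 2)) by nra. nra. }
  set (c := sqrt (M ^ 2 - Q ^ 2)).
  assert (Hcc : c * c = M ^ 2 - Q ^ 2) by (unfold c; apply sqrt_sqrt; nra).
  assert (Hc0 : 0 <= c) by apply sqrt_pos.
  assert (Hc1 : m0 < c) by nra.
  assert (Hc2 : c < M) by nra.
  assert (Hc3 : M / 2 <= c) by nra.
  assert (HqQ : qf m c rho = Q).
  { unfold qf. fold M. replace (M ^ 2 - c ^ 2) with (Q ^ 2) by lra. apply sqrt_pow2; lra. }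
  assert (HAQ : 0 <= Af m c rho <= Q / c).
  { unfold Af. rewrite HqQ. apply atan_nonneg_le. apply Rdiv_le_0_compat; lra. }
  assert (HA : Af m c rho <= PI * (a - 1 / 2)).
  { apply Rle_trans with (1 := proj2 HAQ). apply Rle_div_l; [lra|].
    assert (0 <= PI * (a - 1 / 2)) by (apply Rmult_le_pos; lra). nra. }
  assert (HApos : 0 < Af m c rho).
  { unfold Af. rewrite HqQ. rewrite <- atan_0. apply atan_increasing. apply Rdiv_lt_0_compat; lra. }
  assert (Hgap : m0 * Af m c rho < Q).
  { apply Rle_lt_trans with (m0 * (Q / c)); [apply Rmult_le_compat_l; lra|].
    replace (m0 * (Q / c)) with (m0 * Q / c) by (field; lra). apply Rlt_div_l; nra. }
  exists (fun t => dip rho c (- qf m c rho + a * t)). split.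
  { apply dip_ray; try lra; [intros; apply cone_increase; lra|fold m0 M; lra|rewrite HqQ; exact HQ1]. }
  intros eta Heta.
  (* The first summand makes the line turn by at least PI / 2, the second pushes the error (c^2 +
     m0^2) / y below the gain [Q - m0 * Af m c rho]. *)
  set (y0 := c / Af m c rho + (c ^ 2 + m0 ^ 2) / (Q - m0 * Af m c rho) + 1).
  assert (Hy01 : 0 < c / Af m c rho) by (apply Rdiv_lt_0_compat; lra).
  assert (Hy02 : 0 < (c ^ 2 + m0 ^ 2) / (Q - m0 * Af m c rho)) by (apply Rdiv_lt_0_compat; nra).
  exists ((y0 + Q) / a). split; [apply Rdiv_le_0_compat; unfold y0; lra|].
  intros t Ht. rewrite HqQ. set (y := - Q + a * t).
  assert (Hy : y0 <= y).
  { unfold y. apply Rle_div_l in Ht; lra. }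
  assert (Hyp : 0 < y) by (unfold y0 in Hy; lra).
  assert (Hmc : m r < c < m rho) by (fold m0 M; lra).
  assert (Hqy : qf m c (dip_radius c y) = y) by (apply (dip_qf rho); auto; lra).
  assert (HRr : r < dip_radius c y) by (apply (dip_radius_gt rho); auto).
  assert (HmR : m (dip_radius c y) = sqrt (c ^ 2 + y ^ 2)) by (apply (dip_m rho); auto).
  set (R := dip_radius c y) in *. set (th := dip_angle rho c y).
  assert (HcR : c < m R).
  { rewrite HmR, <- (sqrt_pow2 c) at 1 by lra. apply sqrt_lt_1_alt. nra. }
  assert (Hath : a * th = Af m c R + Af m c rho).
  { unfold th, dip_angle. replace (y / c) with (qf m c R / c) by now rewrite Hqy. fold (Af m c R). field. lra. }
  pose proof (Af_range m c R Hc0) as HAR. pose proof (Af_lower m c R ltac:(lra)) as HAl. rewrite Hqy in HAl.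
  assert (Hlarge : PI / 2 <= a * th).
  { assert (c / y <= Af m c rho); [|lra]. apply Rle_div_l; [lra|].
    assert (c / Af m c rho <= y) by (unfold y0 in Hy; lra). apply Rle_div_l in H; lra. }
  assert (Hth : PI / 2 <= th <= PI).
  { split; [|apply Rmult_le_reg_l with a; lra]. assert (0 < th) by nra. nra. }
  exists R, th. split; [lra|]. split; [reflexivity|]. split; [lra|].
  destruct (inner_tangent m W r Hr HU) as (Th0 & HT0 & Hinc & HD). fold m0 in HT0, Hinc, HD.
  specialize (HD R th HRr). apply Rle_lt_trans with (1 := HD).
  pose proof (cone_ang r m0 Th0 R ltac:(lra) Hm0 Hinc HT0 ltac:(lra)) as HaT.
  rewrite (Af_eq0 m m0 r) in HaT by easy.
  pose proof (Af_range m m0 R Hm0) as HA0.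
  assert (HTh0 : Th0 R <= th) by (apply Rmult_le_reg_l with a; lra).
  rewrite Rabs_pos_eq by lra.
  pose proof (cone_J r r R ltac:(lra) ltac:(lra) ltac:(lra)) as HJ.
  rewrite J_point, (La_eq0 m _ r) in HJ by easy. fold m0 in HJ. unfold La in HJ.
  pose proof (qf_diff_le m c m0 R ltac:(lra) HcR) as HQd. rewrite Hqy in HQd.
  assert (Hq0 : y <= qf m m0 R) by (rewrite <- Hqy; apply qf_mono_c; lra).
  assert (HA00 : m0 * (PI / 2 - Af m m0 R) <= m0 ^ 2 / y).
  { destruct Hm0 as [Hp|<-].
    - pose proof (Af_lower m m0 R ltac:(lra)). replace (m0 ^ 2 / y) with (m0 * (m0 / y)) by (field; lra).
      apply Rmult_le_compat_l; [lra|].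
      assert (m0 / qf m m0 R <= m0 / y) by (apply Rmult_le_compat_l; [lra|apply Rinv_le_contravar; lra]). lra.
    - unfold Rdiv. nra. }
  assert (Hfin : (c ^ 2 + m0 ^ 2) / y < Q - m0 * Af m c rho).
  { apply Rlt_div_l; [lra|].
    assert (Hlt : (c ^ 2 + m0 ^ 2) / (Q - m0 * Af m c rho) < y) by (unfold y0 in Hy; lra).
    apply Rlt_div_l in Hlt; lra. }
  apply Rmult_lt_reg_l with a; [lra|].
  assert (Et : a * t = y + Q) by (unfold y; ring). rewrite Et.
  assert (E2 : m0 * (a * th) = m0 * (Af m c R + Af m c rho)) by now rewrite Hath.
  assert (m0 * Af m c R <= m0 * (PI / 2)) by (apply Rmult_le_compat_l; lra).
  unfold Rdiv in *. lra.
Qed.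

End Cone.

(** In a cone of slope [a] the tangential geodesic turns by PI / (2 a) in the limit, which must not
    exceed [PI]. *)
Lemma straight_slope r rho a : 0 <= r < rho -> ~ bent m rho -> (forall x, r < x -> Derive m x = a) -> 1 / 2 <= a.
Proof.
  intros Hr Hs Hcone. pose proof (straight_unbounded m W rho ltac:(lra) Hs) as Hu.
  pose proof (unbounded_dm_pos m W rho ltac:(lra) Hu) as Hd.
  destruct (tangent_ang m W rho ltac:(lra) Hd) as [Th HTh].
  assert (Ha : 0 < a) by (rewrite <- (Hcone rho); lra).
  apply Rnot_lt_le. intros Hn. pose proof PI_RGT_0.
  pose proof (warp_pos m W rho ltac:(lra)) as HM.
  set (e := PI * (1 / 2 - a)). assert (0 < e) by (unfold e; nra).
  destruct (qf_large m (m rho) Hu ltac:(lra) (2 * m rho / e)) as [R0 HR0].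
  set (R := Rmax rho R0). assert (rho <= R /\ R0 <= R) as [HR1 HR2] by (split; [apply Rmax_l|apply Rmax_r]).
  destruct (HR0 R HR2) as [Hm Hq].
  pose proof (straight_tangent m W rho Th R ltac:(lra) Hs HTh HR1) as HPI.
  destruct (tangent_outgoing m W rho ltac:(lra) Hd) as (_ & _ & Ho).
  pose proof (cone_ang r a Hcone rho (m rho) Th R ltac:(lra) ltac:(lra) Ho HTh HR1) as E.
  rewrite (Af_eq0 m _ rho) in E by easy.
  pose proof (Af_lower m (m rho) R ltac:(lra)) as HA.
  pose proof (qf_pos m (m rho) R ltac:(lra)) as Hqp.
  assert (m rho / qf m (m rho) R <= e / 2).
  { apply Rle_div_l; [lra|]. apply Rle_div_l in Hq; [|lra]. nra. }
  assert (a * Th R <= a * PI) by (apply Rmult_le_compat_l; lra). unfold e in *. nra.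
Qed.

Lemma captured_straight rho r : 0 <= r < rho -> ~ bent m rho ->
  ~ (forall x, r < x -> Derive m x = 1 / 2) -> captured m rho r.
Proof.
  intros Hr Hs Hne.
  destruct (classic (exists x, r < x /\ Derive m x <> Derive m rho)) as [E|E].
  - now apply captured_tangent.
  - assert (Hcone : forall x, r < x -> Derive m x = Derive m rho).
    { intros x Hx. apply NNPP. intros H. apply E. now exists x. }
    pose proof (straight_slope r rho _ Hr Hs Hcone) as Hd.
    pose proof (dm_le1 m W rho ltac:(lra)).
    apply (captured_dip r (Derive m rho)); auto; try lra.
    + apply (straight_unbounded m W rho); auto; lra.
    + split; [|easy]. destruct Hd as [?|Hd]; [easy|]. exfalso. apply Hne. now rewrite Hd.
Qed.

End Warped.

(** * Which points can remain in [C0] when the radius of the basepoint is not bent *)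

Lemma edist_pol r a s b : edist (pol r a) (pol s b) = sqrt (r ^ 2 + s ^ 2 - 2 * r * s * cos (a - b)).
Proof.
  unfold edist, pol. simpl fst. simpl snd. f_equal. rewrite cos_minus.
  pose proof (sin2_cos2 a) as H1. pose proof (sin2_cos2 b) as H2. unfold Rsqr in *.
  replace (r ^ 2) with (r ^ 2 * (sin a * sin a + cos a * cos a)) by (rewrite H1; ring).
  replace (s ^ 2) with (s ^ 2 * (sin b * sin b + cos b * cos b)) by (rewrite H2; ring). ring.
Qed.

Section Warped.
Context (m : R -> R) (W : warp m).

Lemma C0_ortho al be sg p x : isortho al be sg -> C0 m p x -> C0 m (ortho al be sg p) (ortho al be sg x).
Proof.
  intros Ho Hx sigma Hs t Ht.
  pose proof (isortho_inv _ _ _ Ho) as Hi.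
  pose proof (ray_ortho m W _ _ _ _ _ Hi Hs) as Hs'. rewrite ortho_cancel in Hs' by easy.
  specialize (Hx _ Hs' t Ht). cbv beta in Hx.
  rewrite <- (dist_ortho m W _ _ _ (sigma t) _ Hi), ortho_cancel by easy. exact Hx.
Qed.

Lemma C0_polar rho phi x : C0 m (pol rho phi) x ->
  exists r al, 0 <= r /\ 0 <= al <= PI /\ C0 m (pol rho 0) (pol r al) /\
    (x = pol r (phi + al) \/ x = pol r (phi - al)).
Proof.
  intros Hx. destruct (pol_surj x) as [th E]. pose proof (nrm_ge0 x) as Hr. set (r := nrm x) in *.
  rewrite E in *. clear E.
  assert (H1 : C0 m (pol rho 0) (pol r (th - phi))).
  { replace 0 with (phi + - phi) by ring. rewrite <- !rotate_pol.
    replace (pol r (th - phi)) with (rotate (- phi) (pol r th)) by (rewrite rotate_pol; f_equal; ring).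
    apply C0_ortho; [apply rotate_iso|exact Hx]. }
  destruct (angle_in_0_PI (th - phi)) as (b & Hb & Ec & Es).
  exists r, b. split; [easy|]. split; [easy|]. destruct Es as [Es|Es].
  - assert (E : pol r b = pol r (th - phi)) by (unfold pol; now rewrite Ec, Es).
    split; [now rewrite E|]. left. replace (pol r th) with (rotate phi (pol r (th - phi))).
    + rewrite <- E, rotate_pol. f_equal. ring.
    + rewrite rotate_pol. f_equal. ring.
  - assert (E : pol r (- b) = pol r (th - phi)).
    { unfold pol. rewrite cos_neg, sin_neg, Ec, Es, Ropp_involutive. easy. }
    split.
    + replace (pol rho 0) with (reflect 0 (pol rho 0)) by (rewrite reflect_pol; f_equal; ring).
      replace (pol r b) with (reflect 0 (pol r (- b))) by (rewrite reflect_pol; f_equal; ring).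
      apply C0_ortho; [apply reflect_iso|]. now rewrite E.
    + right. replace (pol r th) with (rotate phi (pol r (th - phi))).
      * rewrite <- E, rotate_pol. f_equal. ring.
      * rewrite rotate_pol. f_equal. ring.
Qed.

Lemma captured_near rho r al : 0 <= r -> 0 <= al <= PI / 2 -> captured m rho r -> ~ C0 m (pol rho 0) (pol r al).
Proof.
  intros Hr Hal (sigma & Hs & Hc) HC. pose proof PI_RGT_0.
  (* From [th >= PI / 4] and [al <= PI / 2] follows |th - al| <= th: turning the point by [al]
     brings it no farther from the ray point. *)
  destruct (Hc (PI / 4) ltac:(lra)) as (t & Ht & Hct). destruct (Hct t ltac:(lra)) as (R & th & HR & E & Hth & Hd).
  specialize (HC sigma Hs t Ht). rewrite E in *.
  rewrite dist_sym in HC by auto.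
  rewrite (dist_pol_diff m W r al) in HC.
  pose proof (dist_pol_mono m W r R (th - al) th Hr HR) as Hm.
  assert (cos th <= cos (th - al)).
  { destruct (Rle_dec al th).
    - apply cos_decr_1; lra.
    - rewrite <- (cos_neg (th - al)). apply cos_decr_1; lra. }
  specialize (Hm H0). lra.
Qed.

(** The pole lies in the horoball with some depth [d]. The late ray points lie in directions at most
    PI / 2 + eta from [al], so by the law of cosines [pol r al] is farther from them than the pole
    by less than [d]. *)
Lemma captured_far rho r al : 0 < rho -> 0 <= r -> PI / 2 <= al <= PI -> captured m rho 0 -> ~ C0 m (pol rho 0) (pol r al).
Proof.
  intros Hrho Hr Hal (sigma & Hs & Hc) HC. pose proof PI_RGT_0.
  destruct (Hc 1 ltac:(lra)) as (t0 & Ht0 & Hct). destruct (Hct t0 ltac:(lra)) as (_ & _ & _ & _ & _ & Hd0).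
  set (d := t0 - dist m (pol 0 0) (sigma t0)). assert (Hd : 0 < d) by (unfold d; lra).
  set (eta := d / (2 * (r + 1))).
  assert (Heta : 0 < eta) by (unfold eta; apply Rdiv_lt_0_compat; lra).
  assert (Heta2 : r * eta <= d / 2).
  { unfold eta. replace (r * (d / (2 * (r + 1)))) with (r / (r + 1) * (d / 2)) by (field; lra).
    assert (r / (r + 1) <= 1) by (apply Rle_div_l; lra). nra. }
  destruct (Hc eta Heta) as (t1 & Ht1 & Hct1).
  assert (Hrd : 0 <= r ^ 2 / d) by (apply Rdiv_le_0_compat; [apply pow2_ge_0|lra]).
  set (T := Rmax (Rmax t0 t1) (rho + r ^ 2 / d + 1)).
  pose proof (Rmax_l (Rmax t0 t1) (rho + r ^ 2 / d + 1)) as M1. pose proof (Rmax_r (Rmax t0 t1) (rho + r ^ 2 / d + 1)) as M2.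
  pose proof (Rmax_l t0 t1). pose proof (Rmax_r t0 t1). fold T in M1, M2.
  destruct (Hct1 T ltac:(lra)) as (R & th & HR & E & Hth & _).
  pose proof (ray_push m W _ _ (pol 0 0) t0 T Hs ltac:(lra)) as HP.
  rewrite (dist_sym m W (sigma t0)) in HP.
  pose proof (nrm_dist m W (sigma T) (pol 0 0)) as HN. pose proof (nrm_ray m W _ _ T Hs ltac:(lra)) as HN2.
  rewrite E, !nrm_pol in HN by lra. rewrite E, !nrm_pol in HN2 by lra. rewrite E in HP.
  rewrite Rabs_pos_eq in HN by lra.
  specialize (HC sigma Hs T ltac:(lra)). rewrite E in HC.
  pose proof (dist_le_edist m W (pol R th) (pol r al)) as HE. rewrite edist_pol in HE.
  assert (HRd : R + d <= T) by (unfold d; lra).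
  assert (Hcos : - eta <= cos (th - al)).
  { rewrite cos_sin. set (u := PI / 2 + (th - al)). destruct (Rle_dec 0 u) as [Hu|Hu].
    - assert (0 <= sin u) by (apply sin_ge_0; unfold u in *; lra). lra.
    - pose proof (Rabs_sin_le u). rewrite (Rabs_left u) in H2 by lra.
      pose proof (Rle_abs (- sin u)) as H3. rewrite Rabs_Ropp in H3. unfold u in *. lra. }
  assert (HR2 : r ^ 2 < R * d).
  { assert (Hlt : r ^ 2 / d < R) by lra. apply Rlt_div_l in Hlt; lra. }
  assert (sqrt (R ^ 2 + r ^ 2 - 2 * R * r * cos (th - al)) < R + d); [|lra].
  rewrite <- (sqrt_pow2 (R + d)) by lra. apply sqrt_lt_1_alt.
  assert (Rr : 0 <= R * r) by (apply Rmult_le_pos; lra).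
  assert (- (2 * R * r * cos (th - al)) <= 2 * R * r * eta) by nra.
  assert (R * (r * eta) <= R * (d / 2)) by (apply Rmult_le_compat_l; lra).
  split; [|nra].
  pose proof (COS_bound (th - al)) as [_ Hc1].
  assert (0 <= R * r * (1 - cos (th - al))) by (apply Rmult_le_pos; lra).
  pose proof (pow2_ge_0 (R - r)). lra.
Qed.

Lemma meridian_covers rho r : 0 <= rho < r -> ~ C0 m (pol rho 0) (pol r 0).
Proof.
  intros H HC. assert (Hs : ray m (pol rho 0) (fun t => pol (rho + Rabs t) 0)).
  { split; [rewrite Rabs_R0; f_equal; ring|]. intros s t Hs Ht.
    rewrite !Rabs_pos_eq by lra. rewrite (dist_radial m W) by lra. f_equal. ring. }
  specialize (HC _ Hs (r - rho) ltac:(lra)). cbv beta in HC.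
  rewrite Rabs_pos_eq in HC by lra. replace (rho + (r - rho)) with r in HC by ring. rewrite (dist_refl m W) in HC. lra.
Qed.

(** If the tangential ray has not passed angle [al] at radius [r], it reaches [al] at a radius [R]
    further out, and its length up to there exceeds [R - rho], hence the radial distance [R - r].
    Otherwise some transversal ray passes through the point itself. *)
Lemma outer_covered rho r al : 0 < rho <= r -> ~ bent m rho -> 0 < al < PI / 2 -> ~ C0 m (pol rho 0) (pol r al).
Proof.
  intros Hr Hs Hal HC. pose proof (straight_unbounded m W rho ltac:(lra) Hs) as Hu.
  pose proof (unbounded_dm_pos m W rho ltac:(lra) Hu) as Hd. pose proof PI_RGT_0.
  destruct (tangent_ang m W rho ltac:(lra) Hd) as [Th HTh].
  pose proof (tangent_outgoing m W rho ltac:(lra) Hd) as Ho.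
  pose proof (warp_pos m W rho ltac:(lra)) as HM.
  destruct (Rle_dec (Th r) al) as [Hle|Hgt].
  - destruct (qf_large m (m rho) Hu ltac:(lra) (m rho / (PI / 2 - al))) as [R0 HR0].
    set (R1 := Rmax r R0). pose proof (Rmax_l r R0). pose proof (Rmax_r r R0). fold R1 in H0, H1.
    destruct (HR0 R1 ltac:(lra)) as [Hm Hq]. pose proof (qf_pos m (m rho) R1 ltac:(lra)) as Hqp.
    pose proof (Af_lower m (m rho) R1 ltac:(lra)) as HA. pose proof (tangent_ge_Af m W rho Th R1 Ho HTh ltac:(lra)) as HT.
    assert (m rho / qf m (m rho) R1 <= PI / 2 - al).
    { apply Rle_div_l; [lra|]. apply Rle_div_l in Hq; lra. }
    destruct (intermediate_value Th r R1 al) as (R & HR & ER); [lra| |lra|].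
    { intros x Hx. apply HTh; lra. }
    destruct (outgoing_ray m W (m rho) rho Th Ho HTh Hu) as [sigma [Hsg HsR]].
    { intros x Hx. apply (straight_tangent m W rho); auto; lra. }
    assert (HRr : rho < R).
    { destruct (Req_dec R rho) as [E|]; [|lra]. subst R. destruct HTh as (_ & _ & T0). lra. }
    pose proof (arc_expand m W _ rho Th rho R Ho HTh ltac:(lra)) as HE. rewrite (arc_0 m _ rho Th HTh) in HE.
    specialize (HC sigma Hsg (arc m (m rho) rho Th R) ltac:(lra)). rewrite HsR, ER, (dist_radial m W) in HC by lra.
    rewrite Rabs_pos_eq in HC by lra.
    assert (arc m (m rho) rho Th rho - rho < arc m (m rho) rho Th R - R); [|rewrite (arc_0 m _ rho Th HTh) in *; lra].
    assert (Hpos : forall x, rho < x -> 0 < m x / qf m (m rho) x - 1).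
    { intros x Hx. pose proof (outgoing_qf m _ rho x Ho Hx) as Hqx. assert (m rho < m x) by (apply Ho; lra).
      enough (1 < m x / qf m (m rho) x) by lra. apply Rlt_div_r; [lra|].
      pose proof (qf_sq m (m rho) x ltac:(lra)). nra. }
    apply (strict_of_derive (fun x => arc m (m rho) rho Th x - x) (fun x => m x / qf m (m rho) x - 1) rho R ((rho + R) / 2)); [| | |lra|].
    + intros x Hx. apply cont_minus; [|cont]. apply (arc_continuous m W); auto; lra.
    + intros x Hx. apply (is_derive_minus (arc m (m rho) rho Th) (fun x => x)).
      * apply (is_derive_arc m W); auto; lra.
      * apply (is_derive_id x).
    + intros x Hx. specialize (Hpos x). lra.
    + apply Hpos. lra.
  - assert (Hrr : rho < r).
    { destruct (Req_dec r rho) as [E|]; [|lra]. subst r. destruct HTh as (_ & _ & T0). lra. }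
    destruct (tangent_swept_limit m W rho Th r al) as (c & Hc & Hcr); auto; try lra.
    destruct (swept_attains m W c rho r al) as (c' & Hc' & E); auto; try lra.
    destruct (outgoing_ray m W c' rho (swept m c' rho)) as [sigma [Hsg HsR]]; auto.
    { apply (transverse_outgoing m W); lra. }
    { apply (swept_ang m W); lra. }
    { intros R HR. apply Rnot_lt_le. intros Hn. apply Hs. exists c', R. repeat split; try easy; lra. }
    pose proof (transverse_outgoing m W c' rho ltac:(lra) ltac:(lra)) as Ho'.
    pose proof (swept_ang m W c' rho ltac:(lra) ltac:(lra)) as Ha'.
    pose proof (arc_expand m W _ rho _ rho r Ho' Ha' ltac:(lra)) as HE. rewrite (arc_0 m _ rho _ Ha') in HE.
    specialize (HC sigma Hsg (arc m c' rho (swept m c' rho) r) ltac:(lra)).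
    rewrite HsR, E, (dist_refl m W) in HC by lra. lra.
Qed.

Lemma captured_origin rho : 0 < rho -> ~ bent m rho -> captured m rho 0.
Proof.
  intros Hr Hs. apply captured_straight; [exact W|lra|easy|]. intros Hh.
  pose proof (warp_C1 m W 0) as HC. rewrite continuous_eps in HC.
  destruct (HC (1 / 4) ltac:(lra)) as (d & Hd & H). specialize (H (d / 2)).
  rewrite Hh, (warp_D0 m W) in H by lra. rewrite Rminus_0_r, Rabs_pos_eq in H by lra.
  specialize (H ltac:(lra)). rewrite Rabs_left in H by lra. lra.
Qed.

Lemma C0_straight rho r al : 0 < rho -> ~ bent m rho -> 0 <= r -> 0 <= al <= PI ->
  C0 m (pol rho 0) (pol r al) -> r = rho /\ al = 0 \/ r < rho /\ al < PI / 2 /\ ~ captured m rho r.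
Proof.
  intros Hrho Hs Hr Hal HC. destruct (Rle_dec (PI / 2) al) as [Hbig|Hsmall].
  - exfalso. apply (captured_far rho r al); auto; [lra|]. apply captured_origin; auto.
  - destruct (Rlt_dec r rho) as [Hlt|Hge].
    + right. repeat split; try lra. intros Hc. apply (captured_near rho r al); auto; lra.
    + left. destruct (Req_dec al 0) as [->|Hn].
      * destruct (Req_dec r rho); [easy|]. exfalso. apply (meridian_covers rho r); auto; lra.
      * exfalso. apply (outer_covered rho r al); auto; lra.
Qed.

End Warped.

(** * The soul construction *)

Lemma edist_shift (x : pt) (e u v : R) : 0 <= e -> u ^ 2 + v ^ 2 = 1 ->
  edist x (fst x + e * u, snd x + e * v) = e.
Proof.
  intros He Hu. unfold edist. simpl fst. simpl snd.
  replace ((fst x - (fst x + e * u)) ^ 2 + (snd x - (snd x + e * v)) ^ 2) with (e ^ 2 * (u ^ 2 + v ^ 2)) by ring.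
  rewrite Hu, Rmult_1_r. now apply sqrt_pow2.
Qed.

Section Warped.
Context (m : R -> R) (W : warp m).

Lemma singleton_no_bdry (C : set_pt) q : (forall x, C x <-> x = q) -> ~ exists x, bdry m C x.
Proof.
  intros HC (x & _ & [[(y & e & He & Hy) _]|(_ & (a & b & Ha & Hb & Hab) & _)]).
  - assert (E1 : y = q) by (apply HC, Hy; replace y with (fst y + 0 * 1, snd y + 0 * 0) at 2
      by (destruct y; simpl; f_equal; ring); rewrite edist_shift; lra).
    assert (E2 : (fst y + e / 2 * 1, snd y + e / 2 * 0) = q) by (apply HC, Hy; rewrite edist_shift; lra).
    rewrite <- E1 in E2. apply (f_equal fst) in E2. simpl in E2. lra.
  - apply Hab. transitivity q; [apply HC|symmetry; apply HC]; auto.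
Qed.

Lemma C0_basepoint p : C0 m p p.
Proof. intros sigma Hs t Ht. rewrite dist_sym, (ray_dist m p sigma t) by auto. lra. Qed.

Lemma soul_of_point p : (forall x, C0 m p x -> x = p) -> soul_of m p (fun x => x = p).
Proof.
  intros H. assert (H' : forall x, x = p <-> C0 m p x).
  { intros x. split; [intros ->; apply C0_basepoint|apply H]. }
  exists (fun _ x => x = p), 0%nat. split; [exact H'|]. split; [intros i Hi; lia|]. split; [|reflexivity].
  apply singleton_no_bdry with p. reflexivity.
Qed.

Lemma soul_origin : soul_of m (0, 0) (fun x => x = (0, 0)).
Proof.
  apply soul_of_point. intros x Hx. destruct (pol_surj x) as [th E].
  pose proof (nrm_ge0 x) as Hr. specialize (Hx _ (meridian_ray m W th) (nrm x) Hr). cbv beta in Hx.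
  rewrite <- E, (dist_refl m W) in Hx. apply nrm0. lra.
Qed.

Lemma soul_captured rho phi : 0 < rho -> ~ bent m rho -> (forall r, 0 <= r < rho -> captured m rho r) ->
  soul_of m (pol rho phi) (fun x => x = pol rho phi).
Proof.
  intros Hr Hs Hc. apply soul_of_point. intros x Hx.
  destruct (C0_polar m W _ _ _ Hx) as (r & al & Hr0 & Hal & HC & E).
  destruct (C0_straight m W _ _ _ Hr Hs Hr0 Hal HC) as [[-> ->]|(H1 & _ & H2)].
  - destruct E as [->| ->]; f_equal; ring.
  - exfalso. apply H2, Hc. lra.
Qed.

Definition segment (a b phi : R) : set_pt := fun x => exists r, a <= r <= b /\ x = pol r phi.

Lemma pol_inj r s phi : 0 <= r -> 0 <= s -> pol r phi = pol s phi -> r = s.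
Proof. intros Hr Hs E. apply (f_equal nrm) in E. rewrite !nrm_pol in E; auto. Qed.

Lemma segment_tint a b phi x : ~ tint (segment a b phi) x.
Proof.
  intros (e & He & H).
  assert (Hx : segment a b phi x).
  { apply H. replace x with (fst x + 0 * 1, snd x + 0 * 0) at 2 by (destruct x; simpl; f_equal; ring).
    rewrite edist_shift; lra. }
  pose proof (sin2_cos2 phi) as Hsc. unfold Rsqr in Hsc.
  destruct (H (fst x + e / 2 * - sin phi, snd x + e / 2 * cos phi)) as (s & _ & E2).
  { rewrite edist_shift; lra. }
  destruct Hx as (r & _ & E1). rewrite E1 in E2. unfold pol in E2. simpl in E2. injection E2. intros E3 E4.
  assert (K : e / 2 * (sin phi * sin phi + cos phi * cos phi) = cos phi * (s * sin phi) - sin phi * (s * cos phi))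
    by (rewrite <- E3, <- E4; ring).
  rewrite Hsc in K. lra.
Qed.

Lemma segment_bdry (C : set_pt) a b phi : 0 <= a < b -> (forall x, C x <-> segment a b phi x) ->
  forall x, bdry m C x <-> x = pol a phi \/ x = pol b phi.
Proof.
  intros Hab HC.
  assert (Hint : forall x, ~ tint C x).
  { intros x (e & He & H). apply (segment_tint a b phi x). exists e. split; [easy|]. intros y Hy. apply HC. auto. }
  assert (Ca : C (pol a phi)) by (apply HC; exists a; split; [lra|easy]).
  assert (Cb : C (pol b phi)) by (apply HC; exists b; split; [lra|easy]).
  assert (Hend : forall e, (e = a \/ e = b) -> bdry m C (pol e phi)).
  { intros e He. split; [destruct He as [-> | ->]; auto|]. right. repeat split.
    - intros (y & Hy). now apply (Hint y).
    - exists (pol a phi), (pol b phi). repeat split; auto. intros E. apply pol_inj in E; lra.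
    - intros (x & y & Hx & Hy & Hxe & Hye & Hd). apply HC in Hx as (r & Hr & ->). apply HC in Hy as (s & Hs & ->).
      rewrite !(dist_radial m W) in Hd by lra.
      assert (r <> e) by (intros ->; easy). assert (s <> e) by (intros ->; easy).
      destruct He as [-> | ->].
      + rewrite (Rabs_pos_eq (r - a)), (Rabs_left (a - s)) in Hd by lra. unfold Rabs in Hd; destruct (Rcase_abs (r - s)); lra.
      + rewrite (Rabs_left (r - b)), (Rabs_pos_eq (b - s)) in Hd by lra. unfold Rabs in Hd; destruct (Rcase_abs (r - s)); lra. }
  intros x. split.
  - intros (Hx & [[(y & Hy) _]|(_ & _ & Hno)]); [now apply Hint in Hy|].
    apply HC in Hx as (r & Hr & ->). apply NNPP. intros Hne. apply Hno. exists (pol a phi), (pol b phi).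
    assert (a <> r) by (intros <-; auto). assert (b <> r) by (intros <-; auto).
    split; [auto|]. split; [auto|]. split; [intros E; apply pol_inj in E; lra|].
    split; [intros E; apply pol_inj in E; lra|].
    rewrite !(dist_radial m W) by lra. rewrite (Rabs_left (a - b)), (Rabs_left (a - r)), (Rabs_left (r - b)); lra.
  - intros [-> | ->]; apply Hend; auto.
Qed.

Lemma soul_of_segment p a b phi : 0 <= a < b -> (forall x, C0 m p x <-> segment a b phi x) ->
  soul_of m p (fun x => x = pol ((a + b) / 2) phi).
Proof.
  intros Hab HC. set (q := pol ((a + b) / 2) phi).
  exists (fun i => match i with O => segment a b phi | _ => fun x => x = q end), 1%nat.
  split; [intros x; symmetry; apply HC|].
  assert (Hb : forall x, bdry m (segment a b phi) x <-> x = pol a phi \/ x = pol b phi).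
  { apply segment_bdry; [easy|reflexivity]. }
  split; [|split; [now apply singleton_no_bdry with q|reflexivity]].
  intros i Hi. replace i with 0%nat by lia. split; [exists (pol a phi); apply Hb; auto|].
  assert (Hex : exists x, bdry m (segment a b phi) x) by (exists (pol a phi); apply Hb; auto).
  assert (Hle : forall r, a <= r <= b -> distset m (bdry m (segment a b phi)) (pol r phi) <= r - a /\
    distset m (bdry m (segment a b phi)) (pol r phi) <= b - r).
  { intros r Hr. destruct (distset_glb m W _ (pol r phi) Hex) as [H _]. split.
    - rewrite <- (Rabs_pos_eq (r - a)), <- (dist_radial m W r a phi) by lra. apply H, Hb; auto.
    - replace (b - r) with (Rabs (r - b)) by (rewrite Rabs_left1; lra).
      rewrite <- (dist_radial m W r b phi) by lra. apply H, Hb; auto. }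
  assert (Hq : (b - a) / 2 <= distset m (bdry m (segment a b phi)) q).
  { destruct (distset_glb m W _ q Hex) as [_ H]. apply H. intros y Hy. apply Hb in Hy.
    destruct Hy as [-> | ->]; unfold q; rewrite (dist_radial m W) by lra.
    - rewrite Rabs_pos_eq; lra.
    - rewrite Rabs_left1; lra. }
  intros x. split.
  - intros ->. split; [exists ((a + b) / 2); split; [lra|easy]|]. intros y (r & Hr & ->).
    destruct (Hle r Hr). lra.
  - intros [(r & Hr & ->) Hmax]. specialize (Hmax q). destruct (Hle r Hr).
    assert ((b - a) / 2 <= distset m (bdry m (segment a b phi)) (pol r phi)).
    { apply Rle_trans with (1 := Hq). apply Hmax. exists ((a + b) / 2). split; [lra|easy]. }
    unfold q. f_equal. lra.
Qed.

End Warped.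

(** * The critical cone of slope 1/2, where the soul comes from a basepoint further out *)

Section Warped.
Context (m : R -> R) (W : warp m).

Section HalfCone.
Context (r1 : R) (Hr1 : 0 < r1) (Hcone : forall x, r1 < x -> Derive m x = 1 / 2).

Lemma half_unbounded : unbounded m.
Proof.
  intros V. exists (r1 + 2 * Rabs V). intros R HR. pose proof (Rabs_pos V). pose proof (Rle_abs V).
  rewrite (cone_m m W r1 (1 / 2) Hcone) by lra. pose proof (warp_pos m W r1 Hr1). lra.
Qed.

Lemma half_increase x y : 0 <= x < y -> m x < m y.
Proof. apply (cone_increase m W r1 (1 / 2)); auto; lra. Qed.

Lemma half_tangent rho : r1 <= rho -> outgoing m (m rho) rho /\ ang m (m rho) rho (fun x => 2 * Af m (m rho) x).
Proof.
  intros H. pose proof (warp_pos m W rho ltac:(lra)).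
  split; [split; [lra|split; [lra|intros; apply half_increase; lra]]|]. split; [|split].
  - intros x Hx. apply cont_mult; [cont|apply (Af_continuous m W)].
  - intros x Hx. pose proof (half_increase rho x ltac:(lra)). pose proof (qf_pos m (m rho) x ltac:(lra)).
    replace (m rho / (m x * qf m (m rho) x)) with (2 * (m rho * Derive m x / (m x * qf m (m rho) x))).
    + apply (is_derive_scal (Af m (m rho))). apply (is_derive_Af m W). lra.
    + rewrite Hcone by lra. field. lra.
  - rewrite Af_eq0 by easy. ring.
Qed.

Lemma half_tangent_arc rho R : r1 <= rho <= R -> arc m (m rho) rho (fun x => 2 * Af m (m rho) x) R = 2 * qf m (m rho) R.
Proof.
  intros H. pose proof (cone_J m W r1 (1 / 2) ltac:(lra) Hcone rho rho R ltac:(lra) ltac:(lra) ltac:(lra)) as E.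
  rewrite J_point, (La_eq0 m _ rho) in E by easy. unfold arc. unfold La in E. lra.
Qed.

Lemma half_straight P : r1 < P -> ~ bent m P.
Proof.
  intros HP (c & R & Hc & HR & Hb).
  pose proof (transverse_outgoing m W c P ltac:(lra) Hc) as (_ & _ & Ho).
  pose proof (cone_ang m W r1 (1 / 2) Hcone P c _ R ltac:(lra) ltac:(lra) Ho (swept_ang m W c P ltac:(lra) Hc) HR) as E.
  pose proof (Af_range m c R ltac:(lra)). pose proof (Af_range m c P ltac:(lra)). lra.
Qed.

(** Points off the meridian segment lie in the horoball of a tangential ray: a line from such a
    point with the same limit direction reaches far radii with a fixed saving [gap]. *)
Lemma half_inner_covered r P al : r1 <= r < P -> 0 < al < PI / 2 -> ~ C0 m (pol P 0) (pol r al).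
Proof.
  intros Hr Hal HC. pose proof PI_RGT_0. set (M := m P).
  destruct (half_tangent P ltac:(lra)) as [Ho Ha].
  destruct (outgoing_ray m W M P _ Ho Ha half_unbounded) as (sigma & Hs & HsR).
  { intros R HR. pose proof (Af_range m (m P) R ltac:(apply Ho)). lra. }
  assert (Hmr : 0 < m r) by (apply (warp_pos m W); lra).
  assert (HmM : m r < M) by (apply half_increase; lra).
  (* An outgoing geodesic of constant [c] turns by PI - 2 [Af c r] in total. This [c] makes it PI -
     al, so that the geodesic from angle [al] ends in the limit direction [PI] of the tangential
     ray. *)
  set (c := m r * cos (al / 2)).
  assert (Hcos : 0 < cos (al / 2)) by (apply cos_gt_0; lra).
  assert (Hsin : 0 < sin (al / 2)) by (apply sin_gt_0; lra).
  assert (Hcos1 : cos (al / 2) < 1).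
  { rewrite <- cos_0. apply cos_decreasing_1; lra. }
  assert (Hc : 0 < c < m r) by (unfold c; split; nra).
  destruct (Af_polar m c r ltac:(lra)) as (HA & HAc & HAs).
  assert (EA : Af m c r = al / 2).
  { apply cos_inj; try lra. apply Rmult_eq_reg_l with (m r); [exact HAc|lra]. }
  pose proof (swept_ang m W c r ltac:(lra) ltac:(lra)) as Hac.
  pose proof (transverse_outgoing m W c r ltac:(lra) ltac:(lra)) as Hoc.
  set (gap := 2 * qf m c r). assert (Hgap : 0 < gap) by (pose proof (qf_pos m c r ltac:(lra)); unfold gap; lra).
  (* The difference of the two [qf] and the mismatch of the angles each cost at most 2 M^2 / [qf]; 5
     leaves a strict margin. *)
  destruct (qf_large m M half_unbounded ltac:(lra) (5 * M ^ 2 / gap)) as [R0 HR0].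
  set (R := Rmax P R0). pose proof (Rmax_l P R0) as M1. pose proof (Rmax_r P R0) as M2. fold R in M1, M2.
  destruct (HR0 R M2) as [HMR Hq]. pose proof (qf_pos m M R ltac:(lra)) as HqM.
  pose proof (cone_ang m W r1 (1 / 2) Hcone r c _ R ltac:(lra) ltac:(lra) (proj2 (proj2 Hoc)) Hac ltac:(lra)) as ES.
  rewrite EA in ES.
  assert (EJ : 1 / 2 * J m c r R = La m c R - La m c r).
  { pose proof (equal_increments (fun x => 1 / 2 * J m c r x) (La m c) (fun x => 1 / 2 * jc m c x) r R ltac:(lra)) as E.
    cbv beta in E. rewrite J_point, Rmult_0_r, Rminus_0_r in E. apply E.
    - intros x Hx. apply cont_mult; [cont|]. eapply is_derive_continuous, (is_derive_J m W); lra.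
    - intros; apply (La_continuous m W).
    - intros x Hx. apply (is_derive_scal (J m c r)). apply (is_derive_J m W); lra.
    - intros x Hx. rewrite <- (Hcone x) by lra. apply (is_derive_La m W). pose proof (half_increase r x ltac:(lra)). lra. }
  assert (Harc : arc m c r (swept m c r) R = 2 * qf m c R - gap).
  { unfold arc, gap. unfold La in EJ. rewrite EA in EJ. nra. }
  pose proof (arc_expand m W _ P _ P R Ho Ha ltac:(lra)) as HE. rewrite (arc_0 m _ P _ Ha) in HE.
  specialize (HC sigma Hs (arc m M P (fun x => 2 * Af m M x) R)). rewrite HsR in HC by lra.
  pose proof (half_tangent_arc P R ltac:(lra)) as EP. fold M in EP. fold M in HE. rewrite EP in HC, HE.
  specialize (HC ltac:(lra)). rewrite dist_sym, (dist_pol_diff m W) in HC by auto.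
  pose proof (dist_upper m W c r _ R (2 * Af m M R - al) Hoc Hac ltac:(lra)) as HU. rewrite Harc in HU.
  assert (HqcM : qf m M R <= qf m c R) by (apply qf_mono_c; lra).
  pose proof (qf_diff_le m M c R ltac:(lra) HMR) as HD.
  assert (Habs : Rabs (2 * Af m M R - al - swept m c r R) <= 2 * (M / qf m M R)).
  { pose proof (Af_range m c R ltac:(lra)). pose proof (Af_range m M R ltac:(lra)).
    pose proof (Af_lower m M R ltac:(lra)). pose proof (Af_lower m c R ltac:(lra)).
    assert (c / qf m c R <= M / qf m M R).
    { apply Rmult_le_compat; [lra|left; apply Rinv_0_lt_compat; lra|lra|apply Rinv_le_contravar; lra]. }
    apply Rabs_le. lra. }
  assert (m r * Rabs (2 * Af m M R - al - swept m c r R) <= M * (2 * (M / qf m M R))).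
  { apply Rmult_le_compat; [lra|apply Rabs_pos|lra|exact Habs]. }
  assert (5 * M ^ 2 / qf m M R <= gap).
  { apply Rle_div_l; [lra|]. apply Rle_div_l in Hq; lra. }
  assert (0 < M ^ 2 / qf m M R) by (apply Rdiv_lt_0_compat; nra).
  replace (M * (2 * (M / qf m M R))) with (2 * (M ^ 2 / qf m M R)) in * by (field; lra).
  fold M in HC.
  replace (5 * M ^ 2 / qf m M R) with (5 * (M ^ 2 / qf m M R)) in * by (field; lra). lra.
Qed.

(** The right-hand points lie on the tangential ray from [pol P 0], and the left side is its length:
    no point of the meridian segment is closer to them than [pol P 0]. The factor 1/2 lets
    [qf_le_cone] apply directly to the angle [2 * Af]. *)
Lemma half_lower r P x : r1 <= r <= P -> P <= x ->
  2 * qf m (m P) x <= dist m (pol r 0) (pol x (2 * Af m (m P) x)).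
Proof.
  intros Hr Hx. set (M := m P).
  assert (Hmr : 0 < m r) by (apply (warp_pos m W); lra).
  assert (HmM : m r <= M) by (apply (m_mono m W); lra).
  assert (HMx : M <= m x) by (apply (m_mono m W); lra).
  pose proof (Af_range m M x ltac:(lra)).
  apply (dist_ge_calibrated m W _ _ (2 * Af m M x)).
  - rewrite nrm_pol; lra.
  - rewrite nrm_pol; lra.
  - lra.
  - rewrite dot_pol, !nrm_pol by lra. rewrite Rminus_0_l. now rewrite cos_neg.
  - intros r0. rewrite !nrm_pol by lra. intros H0 _. exists (m r0).
    pose proof (m_ge0 m W r0 ltac:(lra)) as Hm0. split; [lra|].
    assert (m r0 <= m r) by (apply (m_mono m W); lra).
    pose proof (qf_le_cone m M (m r0) x ltac:(lra) ltac:(lra)) as K.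
    pose proof (La_ge0 m (m r0) r Hm0).
    destruct (Rle_dec r1 r0) as [Hge|Hlt].
    + pose proof (cone_J m W r1 (1 / 2) ltac:(lra) Hcone r0 r0 r ltac:(lra) ltac:(lra) ltac:(lra)) as E1.
      pose proof (cone_J m W r1 (1 / 2) ltac:(lra) Hcone r0 r0 x ltac:(lra) ltac:(lra) ltac:(lra)) as E2.
      rewrite J_point, (La_eq0 m _ r0) in E1, E2 by easy. lra.
    + pose proof (half_increase r0 r1 ltac:(lra)) as Hinc.
      pose proof (cone_J m W r1 (1 / 2) ltac:(lra) Hcone r0 r1 r ltac:(lra) ltac:(lra) ltac:(lra)) as E1.
      pose proof (cone_J m W r1 (1 / 2) ltac:(lra) Hcone r0 r1 x ltac:(lra) ltac:(lra) ltac:(lra)) as E2.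
      pose proof (J_ge_La m W r0 r1 ltac:(lra) Hinc).
      assert (La m (m r0) r1 <= La m (m r0) r).
      { apply (monotone_of_derive (La m (m r0)) (fun t => Derive m t * jc m (m r0) t)); [lra| | |].
        - intros; apply (La_continuous m W).
        - intros t Ht. apply (is_derive_La m W). pose proof (half_increase r0 t ltac:(lra)). lra.
        - intros t Ht. apply Rmult_le_pos; [rewrite Hcone; lra|apply jc_ge0]. }
      lra.
Qed.

(** Far points short of the tangential ray are handled by using that ray as a barrier. The other far
    points have angles between [2 * Af] and [PI], a range that shrinks to nothing, and are compared
    with the ray point of the same radius. *)
Lemma half_busemann r P e : r1 <= r <= P -> 0 < e -> exists R0, forall Y, R0 <= nrm Y ->
  dist m (pol P 0) Y - e <= dist m (pol r 0) Y.
Proof.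
  intros Hr He. set (M := m P). assert (HM : 0 < M) by (apply (warp_pos m W); lra).
  destruct (qf_large m M half_unbounded ltac:(lra) (2 * M ^ 2 / e)) as [R0 HR0].
  exists (Rmax P R0). intros Y HY. set (R := nrm Y) in *.
  pose proof (Rmax_l P R0) as M1. pose proof (Rmax_r P R0) as M2.
  destruct (HR0 R ltac:(lra)) as [HMR Hq]. pose proof (qf_pos m M R ltac:(lra)) as HqM.
  destruct (pol_surj Y) as [th EY]. fold R in EY.
  destruct (angle_in_0_PI th) as (b & Hb & Ec & _). rewrite EY.
  rewrite <- (dist_pol_cos m W P R b th Ec), <- (dist_pol_cos m W r R b th Ec).
  destruct (half_tangent P ltac:(lra)) as [Ho Ha]. fold M in Ho, Ha.
  pose proof (Af_range m M R ltac:(lra)) as HA. pose proof (Af_lower m M R ltac:(lra)) as HAl.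
  destruct (Rle_dec b (2 * Af m M R)) as [Hsmall|Hbig].
  - enough (dist m (pol P 0) (pol R b) + 0 <= dist m (pol r 0) (pol R b)) by lra.
    apply (barrier m W (fun x => 2 * Af m M x) P r R b 0); try lra.
    + intros x Hx. apply Ha; lra.
    + apply Ha.
    + intros x Hx. rewrite Rplus_0_r. apply Rle_trans with (2 * qf m M x); [|apply half_lower; lra].
      pose proof (dist_upper m W M P _ x (2 * Af m M x) Ho Ha Hx) as HU.
      pose proof (half_tangent_arc P x ltac:(lra)) as EP. fold M in EP. rewrite EP in HU.
      rewrite Rminus_diag, Rabs_R0 in HU. lra.
    + apply cos_decr_1; lra.
  - pose proof (dist_upper m W M P _ R b Ho Ha ltac:(lra)) as HU.
    pose proof (half_tangent_arc P R ltac:(lra)) as EP. fold M in EP. rewrite EP in HU. fold M in HU.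
    rewrite Rabs_pos_eq in HU by lra.
    pose proof (half_lower r P R Hr ltac:(lra)) as HL. fold M in HL.
    pose proof (dist_pol_mono m W r R (2 * Af m M R) b ltac:(lra) ltac:(lra)) as Hmono.
    assert (cos b <= cos (2 * Af m M R)) by (apply cos_decr_1; lra).
    specialize (Hmono H).
    assert (M * (b - 2 * Af m M R) <= M * (2 * (M / qf m M R))) by (apply Rmult_le_compat_l; lra).
    assert (2 * M ^ 2 / qf m M R <= e).
    { apply Rle_div_l; [lra|]. apply Rle_div_l in Hq; lra. }
    replace (M * (2 * (M / qf m M R))) with (2 * M ^ 2 / qf m M R) in H0 by (field; lra). lra.
Qed.

Lemma half_segment_C0 P phi r : r1 <= r <= P -> C0 m (pol P phi) (pol r phi).
Proof.
  intros Hr. replace (pol P phi) with (rotate phi (pol P 0)) by (rewrite rotate_pol; f_equal; ring).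
  replace (pol r phi) with (rotate phi (pol r 0)) by (rewrite rotate_pol; f_equal; ring).
  apply C0_ortho; [exact W|apply rotate_iso|]. intros sigma Hs t Ht.
  apply Rnot_lt_le. intros Hn. set (e := (t - dist m (sigma t) (pol r 0)) / 2).
  destruct (half_busemann r P e Hr) as [R0 HR0]; [unfold e; lra|].
  set (T := Rmax t (R0 + P)). pose proof (Rmax_l t (R0 + P)). pose proof (Rmax_r t (R0 + P)). fold T in H, H0.
  pose proof (nrm_ray m W _ _ T Hs ltac:(lra)) as HN. rewrite nrm_pol in HN by lra.
  specialize (HR0 (sigma T) ltac:(lra)). rewrite (ray_dist m _ _ T Hs) in HR0 by lra.
  pose proof (ray_push m W _ _ (pol r 0) t T Hs ltac:(lra)) as HP.
  rewrite (dist_sym m W (sigma T)) in HP. unfold e in HR0. lra.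
Qed.

Lemma half_soul rho phi : r1 < rho -> (forall r, 0 <= r < r1 -> exists x, r < x /\ Derive m x <> 1 / 2) ->
  soul_of m (pol (2 * rho - r1) phi) (fun x => x = pol rho phi).
Proof.
  intros Hrho Hsteep. set (P := 2 * rho - r1).
  replace rho with ((r1 + P) / 2) by (unfold P; field). apply (soul_of_segment m W); [unfold P; lra|].
  assert (HP : r1 < P) by (unfold P; lra).
  intros x. split.
  - intros Hx. destruct (C0_polar m W _ _ _ Hx) as (r & al & Hr0 & Hal & HC & E).
    destruct (C0_straight m W P r al ltac:(lra) (half_straight P HP) Hr0 Hal HC) as [[-> ->]|(Hlt & Hal2 & Hnc)].
    + exists P. split; [lra|]. destruct E as [-> | ->]; f_equal; ring.
    + assert (Hr : r1 <= r).
      { apply Rnot_lt_le. intros Hn. apply Hnc. apply captured_straight; auto; [now apply half_straight|].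
        intros Hall. destruct (Hsteep r ltac:(lra)) as (y & Hy & Hne). apply Hne, Hall, Hy. }
      destruct (Req_dec al 0) as [-> |Hne].
      * exists r. split; [lra|]. destruct E as [-> | ->]; f_equal; ring.
      * exfalso. apply (half_inner_covered r P al); auto; lra.
  - intros (r & Hr & ->). now apply half_segment_C0.
Qed.

End HalfCone.

(** The radius [r1] is the supremum of the radii with m' > 1/2; it is positive because m'(0) = 1.
    Its minimality is what lets rays capture every smaller radius. *)
Lemma half_cone_core r rho : 0 <= r < rho -> (forall x, r < x -> Derive m x = 1 / 2) ->
  exists r1, 0 < r1 < rho /\ (forall x, r1 < x -> Derive m x = 1 / 2) /\
    forall s, 0 <= s < r1 -> exists x, s < x /\ Derive m x <> 1 / 2.
Proof.
  intros Hr Hcone. set (E := fun x => 0 <= x /\ 1 / 2 < Derive m x).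
  assert (Hbd : forall x, E x -> x <= r).
  { intros x (Hx & Hd). apply Rnot_lt_le. intros Hn. rewrite Hcone in Hd; lra. }
  pose proof (warp_C1 m W 0) as HC. rewrite continuous_eps in HC.
  destruct (HC (1 / 4) ltac:(lra)) as (d & Hd & H). specialize (H (d / 2)).
  rewrite (warp_D0 m W), Rminus_0_r, Rabs_pos_eq in H by lra. specialize (H ltac:(lra)).
  apply Rabs_def2 in H.
  destruct (completeness E) as [r1 [Hub Hlub]].
  { exists r. exact Hbd. }
  { exists (d / 2). split; lra. }
  assert (Hr1r : r1 <= r) by (apply Hlub; exact Hbd).
  assert (Hr1d : d / 2 <= r1) by (apply Hub; split; lra).
  exists r1. split; [lra|]. split.
  - intros x Hx. apply Rle_antisym.
    + apply Rnot_lt_le. intros Hn. assert (E x) by (split; lra). specialize (Hub x H0). lra.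
    + pose proof (Rmax_l x (r + 1)). pose proof (Rmax_r x (r + 1)).
      rewrite <- (Hcone (Rmax x (r + 1))) by lra. apply (warp_dec m W). lra.
  - intros s Hs. apply NNPP. intros Hno. assert (r1 <= s); [|lra]. apply Hlub. intros x (Hx & Hdx).
    apply Rnot_lt_le. intros Hn. apply Hno. exists x. split; lra.
Qed.

Lemma soul_of_straight rho phi : 0 < rho -> ~ bent m rho ->
  exists p, soul_of m p (fun x => x = pol rho phi).
Proof.
  intros Hrho Hs. destruct (classic (exists r, 0 <= r < rho /\ forall x, r < x -> Derive m x = 1 / 2)) as [(r & Hr & Hc)|Hno].
  - destruct (half_cone_core r rho Hr Hc) as (r1 & H1 & H2 & H3).
    exists (pol (2 * rho - r1) phi). apply half_soul; auto; lra.
  - exists (pol rho phi). apply (soul_captured m W); auto. intros r Hr. apply captured_straight; auto.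
    intros Hall. apply Hno. now exists r.
Qed.

End Warped.

Theorem theorem1p7 (m : R -> R) (Hm : admissible_m m)
  (HG : forall r, 0 < r -> 0 <= Gm m r) (q : pt) :
  frakC m q <-> exists p : pt, soul_of m p (fun x => x = q).
Proof.
  pose proof (warp_of_curvature m Hm HG) as W. destruct (classic (q = (0, 0))) as [-> |Hq].
  - split; intros _; [exists (0, 0); now apply soul_origin|now apply frakC_origin].
  - destruct (pol_surj q) as [phi E]. pose proof (nrm_ge0 q).
    assert (Hn : 0 < nrm q).
    { destruct H as [|H]; [easy|]. exfalso. apply Hq, nrm0. now symmetry. }
    split.
    + intros HF. rewrite E in HF. rewrite E. apply (soul_of_straight m W); auto. now apply (straight_of_frakC m W) in HF.
    + intros [p Hp]. rewrite E. apply (frakC_of_straight m W); auto. now apply (straight_of_soul m W p).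
Qed.
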